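(* Let $f$ be a transcendental entire function with $f(0)=0$, and let $R_A:\mathbb C\to[0,\infty)$ be the function $$R_A(z)=\begin{cases}\max\{R: z\in A_R(f)\}, & z\in A(f),\\ R_f, & z\notin A(f).\end{cases}$$ Then (a) $R_A$ is upper semicontinuous in $\mathbb C$; (b) $R_A$ is nowhere continuous in $A(f)\cap J(f)$; (c) $R_A$ is constant in a simply connected Fatou component of $f$; (d) $R_A$ is continuous in $A(f)^c\cup F(f)$.
   Context: The Fatou set $F(f)$ is the set of points having a neighbourhood on which $(f^n)_{n\in\mathbb N}$ is a normal family, its components are the Fatou components, and $J(f)=\mathbb C\setminus F(f)$. Here $\mathbb N=\{1,2,\dots\}$. $M(r)=\max_{|z|=r}|f(z)|$ for $r\ge 0$, and $M^n(r)$ denotes the $n$-th iterate of $r\mapsto M(r)$. For $R>0$ such that $M^n(R)\to\infty$ as $n\to\infty$ (a restriction on $R$ assumed whenever $A_R(f)$ is written), $A_R(f)=\{z:|f^n(z)|\ge M^n(R),\ n\in\mathbb N\}$. The fast escaping set is $$A(f)=\{z: \text{there exists }\ell\in\mathbb N\text{ such that }|f^{n+\ell}(z)|\ge M^n(R),\ \text{for } n\in\mathbb N\},$$ where $R>0$ is any number such that $M^n(R)\to\infty$ (the set does not depend on this choice). $A(f)^c=\mathbb C\setminus A(f)$. With $f(0)=0$, $R_f=\max\{r\ge0: M^n(r)\nrightarrow\infty\text{ as }n\to\infty\}$; then $A(f)=\bigcup_{R>R_f}A_R(f)$ and the maximum in the definition of $R_A(z)$ exists for $z\in A(f)$. In (b)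 and (d), continuity refers to continuity of $R_A$ as a function on $\mathbb C$ at the points of the indicated set. *)

(* Defs.v *)
From mathcomp Require Import all_boot all_order all_algebra.
From mathcomp Require Import all_classical all_reals all_analysis.
From mathcomp Require Import complex.

Set Implicit Arguments.
Unset Strict Implicit.
Unset Printing Implicit Defensive.

Import Order.TTheory GRing.Theory Num.Theory.
Import numFieldNormedType.Exports.

Local Open Scope classical_set_scope.
Local Open Scope ring_scope.

(* Packing R[i] as a numClosedFieldType gives it the topology and the normed
   module structure that MathComp-Analysis attaches to numeric fields. *)
Definition CC (R : realType) : numClosedFieldType := R[i]%C.

(* The norm `|z| of MathComp lives in R[i]; normc is the modulus in R. *)
Definition modulus (R : realType) (z : CC R) : R := ComplexField.Normc.normc z.

(* Unspecified if E has no maximum. *)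
Definition setmax (R : realType) (E : set R) : R :=
  get [set m | E m /\ ubound E m].

Lemma setmaxE (R : realType) (E : set R) (m : R) :
  E m -> ubound E m -> setmax E = m.
Proof.
move=> Em ubm; rewrite /setmax; case: xgetP => [y _ [Ey uby]|/(_ m)[]//].
by apply/eqP; rewrite eq_le ubm// uby.
Qed.

Definition entire (R : realType) (f : CC R -> CC R) : Prop :=
  forall z, derivable f z 1.

Definition transcendental_entire (R : realType) (f : CC R -> CC R) : Prop :=
  entire f /\ ~ (exists p : {poly CC R}, forall z, f z = p.[z]).

(* Chordal distance on the Riemann sphere, with None the point at infinity. *)
Definition chordal (R : realType) (p q : option (CC R)) : R :=
  match p, q with
  | Some z, Some w => 2 * modulus (z - w) /
      (Num.sqrt (1 + modulus z ^+ 2) * Num.sqrt (1 + modulus w ^+ 2))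
  | Some z, None | None, Some z => 2 / Num.sqrt (1 + modulus z ^+ 2)
  | None, None => 0
  end.

Definition cvg_loc_unif_sphere (R : realType) (U : set (CC R))
    (s : nat -> CC R -> CC R) (g : CC R -> option (CC R)) : Prop :=
  forall z, U z -> exists2 V : set (CC R), nbhs z V &
    forall e : R, 0 < e -> \forall n \near \oo,
      forall w, (U `&` V) w -> chordal (Some (s n w)) (g w) < e.

(* The limit g takes values in the sphere, so locally uniform convergence to
   infinity is allowed. *)
Definition normal_family (R : realType) (U : set (CC R))
    (F : set (CC R -> CC R)) : Prop :=
  forall s : nat -> CC R -> CC R, (forall n, F (s n)) ->
    exists phi : nat -> nat, {homo phi : m n / (m < n)%N} /\
      exists g : CC R -> option (CC R),
        cvg_loc_unif_sphere U (fun n => s (phi n)) g.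

Definition iterates (R : realType) (f : CC R -> CC R) : set (CC R -> CC R) :=
  [set iter n f | n in [set n | (1 <= n)%N]].

Definition fatou_set (R : realType) (f : CC R -> CC R) : set (CC R) :=
  [set z | exists2 U : set (CC R), open_nbhs z U &
             normal_family U (iterates f)].

Definition julia_set (R : realType) (f : CC R -> CC R) : set (CC R) := ~` fatou_set f.

Definition fatou_component (R : realType) (f : CC R -> CC R)
    (U : set (CC R)) : Prop :=
  exists2 z, fatou_set f z & U = connected_component (fatou_set f) z.

Definition path_in (R : realType) (U : set (CC R)) (g : R -> CC R) : Prop :=
  {within `[0, 1], continuous g} /\ forall t, 0 <= t <= 1 -> U (g t).

Definition path_connected (R : realType) (U : set (CC R)) : Prop :=
  forall a b, U a -> U b -> exists g, [/\ path_in U g, g 0 = a & g 1 = b].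

Definition null_homotopic_in (R : realType) (U : set (CC R))
    (g : R -> CC R) : Prop :=
  exists H : R * R -> CC R,
    [/\ {within `[0, 1]%classic `*` `[0, 1]%classic, continuous H},
        forall p, (`[0, 1]%classic `*` `[0, 1]%classic) p -> U (H p),
        forall t, 0 <= t <= 1 -> H (0, t) = g t,
        forall t, 0 <= t <= 1 -> H (1, t) = g 0 &
        forall s, 0 <= s <= 1 -> H (s, 0) = g 0 /\ H (s, 1) = g 0].

Definition simply_connected (R : realType) (U : set (CC R)) : Prop :=
  path_connected U /\
  forall g, path_in U g -> g 0 = g 1 -> null_homotopic_in U g.

Definition maxmod (R : realType) (f : CC R -> CC R) (r : R) : R :=
  setmax [set modulus (f z) | z in [set z | modulus z = r]].

Definition maxmod_iter_infty (R : realType) (f : CC R -> CC R) (r : R) : Prop :=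
  iter n (maxmod f) r @[n --> \oo] --> +oo.

(* The set A_r(f), with its standing restriction on r made part of it. *)
Definition fast_escaping_at (R : realType) (f : CC R -> CC R) (r : R) :
    set (CC R) :=
  [set z | [/\ 0 < r, maxmod_iter_infty f r &
    forall n, (1 <= n)%N -> iter n (maxmod f) r <= modulus (iter n f z)]].

(* The set does not depend on the admissible r, hence the existential. *)
Definition fast_escaping (R : realType) (f : CC R -> CC R) : set (CC R) :=
  [set z | exists2 r : R, 0 < r /\ maxmod_iter_infty f r &
    exists2 l : nat, (1 <= l)%N & forall n, (1 <= n)%N ->
      iter n (maxmod f) r <= modulus (iter (n + l) f z)].

Definition escape_threshold (R : realType) (f : CC R -> CC R) : R :=
  setmax [set r | 0 <= r /\ ~ maxmod_iter_infty f r].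

Definition RA (R : realType) (f : CC R -> CC R) (z : CC R) : R :=
  if `[< fast_escaping f z >] then setmax [set r | fast_escaping_at f r z]
  else escape_threshold f.

Definition upper_semicontinuous (T : topologicalType) (R : realType)
    (h : T -> R) : Prop :=
  forall x a, h x < a -> \forall y \near x, h y < a.

(* Main.v *)
Require Import Defs.
From HB Require Import structures.
From mathcomp Require Import all_boot all_order all_algebra.
From mathcomp Require Import all_classical all_reals all_analysis.
From mathcomp Require Import complex ring lra.

(* Everything is derived from the maximum modulus principle, which comes from
   Goursat bisection with trapezoid sums in place of contour integrals.
   Write rho for the escape threshold. For r > rho, R_A(z) >= r exactly when
   |f^n(z)| >= M^n(r) for all n >= 1, so the superlevel sets of R_A are closed:
   this is (a).
   On a ball where |f^n| > 1, Harnack's inequality for log|f^n| compares the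
   values at two points up to a power, whereas for r < s the quotients
   ln M^n(s) / ln M^n(r) stay bounded away from 1 by Hadamard's three circles
   theorem; this gives lower semicontinuity in F(f), hence (d). If R_A is
   continuous at a point of A(f), then R_A >= r > rho on a ball around it, on
   which f^n tends to infinity uniformly; so the point lies in F(f), whence (b).
   For (c), suppose that R_A is not constant near a point of a simply connected
   component U in A(f). Then Harnack's inequality, applied to the logarithm of
   f^n minus the logarithm of an omitted value, shows that a small ball is
   mapped by some f^n onto arbitrarily large circles. These circles lie in F(f),
   so U is bounded and {z in U : |f^n(z)| = s} is compact; but a continuous
   argument of f^n on U has no maximum there, since f^n is open. *)

Set Implicit Arguments.
Unset Strict Implicit.
Unset Printing Implicit Defensive.

Import Order.TTheory GRing.Theory Num.Theory.
Import numFieldNormedType.Exports.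
Local Open Scope classical_set_scope.
Local Open Scope ring_scope.

(** Outside A(f) continuity costs nothing: there R_A takes its least value rho, and upper
    semicontinuity suffices. On F(f) the exponent c > 1 that separates M^n(s) from M^n(r) does not
    depend on n, so Harnack's inequality may lose exactly that power on a ball whose radius does not
    depend on n either. In (c) two points need care. A circle around 0 in F(f) that meets U lies in
    U, by connectedness; it is excluded by the same maximum argument applied to a logarithm of z
    itself, which is the case n = 0, and this is why U is bounded. The set {z in U : |f^n(z)| = s}
    is closed in the plane although U need not be: at a limit point z the value f^n(z) is still on
    the circle, hence in F(f), so z is in F(f) by backward invariance and therefore in U. Logarithms
    of f^n exist because 0 is a fixed point, so that f^n has no zero in A(f). The maximum is
    excluded without winding numbers: near any point of the set f^n takes the value turned by a
    small positive angle, which raises the argument. *)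

(** * The complex plane: modulus, topology, compact sets and complex differentiability *)

Definition cre (R : realType) (z : CC R) : R := complex.Re z.
Definition cim (R : realType) (z : CC R) : R := complex.Im z.
Definition cplx (R : realType) (x y : R) : CC R := Complex x y.
Definition rc (R : realType) (x : R) : CC R := cplx x 0.

(* Locked, as curve below, since unification otherwise unfolds the filters. *)
HB.lock Definition cont (R : realType) (f : CC R -> CC R) (z : CC R) : Prop :=
  {for z, continuous f}.

Section Basics.
Variable R : realType.
Implicit Types (z w : CC R) (x y : R).

Lemma modulusE z : modulus z = Num.sqrt (cre z ^+ 2 + cim z ^+ 2).
Proof. by case: z. Qed.
Lemma modulus_ge0 z : 0 <= modulus z. Proof. by rewrite modulusE sqrtr_ge0. Qed.
Lemma normE z : `|z| = rc (modulus z). Proof. by []. Qed.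
Lemma modulusM z w : modulus (z * w) = modulus z * modulus w.
Proof. exact: ComplexField.Normc.normcM. Qed.
Lemma modulusD z w : modulus (z + w) <= modulus z + modulus w.
Proof. exact: le_normcD. Qed.
Lemma modulusN z : modulus (- z) = modulus z.
Proof. exact: normcN. Qed.
Lemma modulus0 : modulus (0 : CC R) = 0. Proof. exact: ComplexField.Normc.normc0. Qed.
Lemma modulus1 : modulus (1 : CC R) = 1. Proof. exact: ComplexField.Normc.normc1. Qed.
Lemma modulusV z : modulus z^-1 = (modulus z)^-1.
Proof. exact: ComplexField.Normc.normcV. Qed.
Lemma modulus_eq0 z : (modulus z == 0) = (z == 0).
Proof.
apply/eqP/eqP => [/ComplexField.Normc.eq0_normc//|->]; exact: modulus0.
Qed.
Lemma modulus_gt0 z : (0 < modulus z) = (z != 0).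
Proof. by rewrite lt_neqAle modulus_ge0 andbT eq_sym modulus_eq0. Qed.
Lemma modulusX z n : modulus (z ^+ n) = modulus z ^+ n.
Proof. by elim: n => [|n IH]; rewrite ?expr0 ?modulus1// !exprS modulusM IH. Qed.
Lemma modulusB z w : modulus (z - w) = modulus (w - z).
Proof. by rewrite -modulusN opprB. Qed.
Lemma modulus_sqr z : modulus z ^+ 2 = cre z ^+ 2 + cim z ^+ 2.
Proof. by rewrite modulusE sqr_sqrtr// addr_ge0// sqr_ge0. Qed.
Lemma modulusBD z w u : modulus (z - w) <= modulus (z - u) + modulus (u - w).
Proof. by have := modulusD (z - u) (u - w); rewrite addrA subrK. Qed.
Lemma modulus_dist z w : `|modulus z - modulus w| <= modulus (z - w).
Proof.
rewrite ler_norml lerBlDr -[X in X <= _]/(- modulus (z - w)).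
apply/andP; split.
  by have := modulusBD w 0 z; rewrite !subr0 modulusB; lra.
by have := modulusBD z 0 w; rewrite !subr0; lra.
Qed.
Lemma modulus_rc x : modulus (rc x) = `|x|.
Proof. by rewrite modulusE /= expr0n addr0 sqrtr_sqr. Qed.
Lemma cre_le z : `|cre z| <= modulus z.
Proof. by rewrite modulusE -sqrtr_sqr ler_wsqrtr// lerDl sqr_ge0. Qed.
Lemma cim_le z : `|cim z| <= modulus z.
Proof. by rewrite modulusE -sqrtr_sqr ler_wsqrtr// lerDr sqr_ge0. Qed.
Lemma modulus_le z : modulus z <= `|cre z| + `|cim z|.
Proof.
rewrite -(@ler_pXn2r _ 2) ?nnegrE ?addr_ge0 ?modulus_ge0// modulus_sqr.
by rewrite sqrrD !real_normK ?num_real// lerD2r lerDl mulrn_wge0// mulr_ge0.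
Qed.
Lemma creD z w : cre (z + w) = cre z + cre w. Proof. by case: z; case: w. Qed.
Lemma cimD z w : cim (z + w) = cim z + cim w. Proof. by case: z; case: w. Qed.
Lemma creN z : cre (- z) = - cre z. Proof. by case: z. Qed.
Lemma cimN z : cim (- z) = - cim z. Proof. by case: z. Qed.
Lemma creM z w : cre (z * w) = cre z * cre w - cim z * cim w.
Proof. by case: z; case: w. Qed.
Lemma cimM z w : cim (z * w) = cre z * cim w + cim z * cre w.
Proof. by case: z => a b; case: w => c d. Qed.
Lemma cplxE z : z = cplx (cre z) (cim z). Proof. by case: z. Qed.
Lemma cplx_inj z w : cre z = cre w -> cim z = cim w -> z = w.
Proof. by case: z w => [a b] [c d] /= -> ->. Qed.
Lemma rcD x y : rc (x + y) = rc x + rc y.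
Proof. by apply: cplx_inj; rewrite /= ?addr0. Qed.
Lemma rcN x : rc (- x) = - rc x.
Proof. by apply: cplx_inj; rewrite /= ?oppr0. Qed.
Lemma rcM x y : rc (x * y) = rc x * rc y.
Proof. by apply: cplx_inj; rewrite ?creM ?cimM/= ?mul0r ?mulr0 ?addr0 ?subr0. Qed.
Lemma cre_cplx x y : cre (cplx x y) = x. Proof. by []. Qed.
Lemma cim_cplx x y : cim (cplx x y) = y. Proof. by []. Qed.
Lemma cre_rc x : cre (rc x) = x. Proof. by []. Qed.
Lemma cim_rc x : cim (rc x) = 0. Proof. by []. Qed.
Lemma cre0 : cre (0 : CC R) = 0. Proof. by []. Qed.
Lemma cim0 : cim (0 : CC R) = 0. Proof. by []. Qed.
Lemma cre1 : cre (1 : CC R) = 1. Proof. by []. Qed.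
Lemma cim1 : cim (1 : CC R) = 0. Proof. by []. Qed.
Definition cE := (creD, cimD, creN, cimN, creM, cimM, cre_rc, cim_rc, cre_cplx,
  cim_cplx, cre0, cim0, cre1, cim1).
Lemma rc0 : rc 0 = 0 :> CC R. Proof. by []. Qed.
Lemma rc1 : rc 1 = 1 :> CC R. Proof. by []. Qed.
Lemma rc_nat n : rc n%:R = n%:R :> CC R.
Proof. by elim: n => // n IH; rewrite -!natr1 rcD IH. Qed.
Lemma rcV x : rc x^-1 = (rc x)^-1.
Proof.
have [->|x0] := eqVneq x 0; first by rewrite invr0 rc0 invr0.
have rx0 : rc x != 0 by apply/eqP => -[/eqP]; apply/negP.
by apply: (mulfI rx0); rewrite -rcM !divff.
Qed.

Lemma nbhsCP z (V : set (CC R)) :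
  nbhs z V <-> exists2 e : R, 0 < e & forall w, modulus (w - z) < e -> V w.
Proof.
split.
  move=> /nbhs_ballP[e /= e0 sV].
  have [er eE] : exists er : R, e = rc er.
    exists (cre e); move: e0; rewrite ltcE => /andP[/eqP h _].
    by apply: cplx_inj.
  exists er; first by move: e0; rewrite eE ltcR.
  move=> w we; apply: sV; rewrite -ball_normE/= normE eE modulusB.
  by rewrite ltcR.
move=> [e e0 sV]; apply/nbhs_ballP; exists (rc e) => /=; first by rewrite ltcR.
move=> w; rewrite -ball_normE/= normE modulusB ltcR; exact: sV.
Qed.

Lemma contP (f : CC R -> CC R) z : cont f z <->
  forall e : R, 0 < e -> exists2 d : R, 0 < d &
    forall w, modulus (w - z) < d -> modulus (f w - f z) < e.
Proof.
rewrite unlock; split=> [cf e e0|H V].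
  have /cf : nbhs (f z) [set w | modulus (w - f z) < e] by apply/nbhsCP; exists e.
  by move=> /nbhsCP.
move=> /nbhsCP[e /H[d d0 fd] sV].
by apply/nbhsCP; exists d => // w /fd; exact: sV.
Qed.

Lemma contrP (f : CC R -> R) z : {for z, continuous f} <->
  forall e : R, 0 < e -> exists2 d : R, 0 < d &
    forall w, modulus (w - z) < d -> `|f w - f z| < e.
Proof.
split=> [cf e e0|H V].
  have /cf : nbhs (f z) [set w | `|w - f z| < e].
    by apply/nbhs_ballP; exists e => //= y; rewrite -ball_normE/= distrC.
  by move=> /nbhsCP.
move=> /nbhs_ballP[e /H[d d0 fd] sV].
apply/nbhsCP; exists d => // w /fd; rewrite distrC => h; apply: sV.
by rewrite -ball_normE.
Qed.

Lemma contcP (f : R -> CC R) x : {for x, continuous f} <->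
  forall e : R, 0 < e -> exists2 d : R, 0 < d &
    forall y, `|y - x| < d -> modulus (f y - f x) < e.
Proof.
split=> [cf e e0|H V].
  have /cf : nbhs (f x) [set w | modulus (w - f x) < e] by apply/nbhsCP; exists e.
  by move=> /nbhs_ballP[d d0 sd]; exists d => // y yd; apply: sd; rewrite -ball_normE/= distrC.
move=> /nbhsCP[e /H[d d0 fd] sV].
apply/nbhs_ballP; exists d => // y; rewrite -ball_normE/= distrC => /fd; exact: sV.
Qed.

Lemma modulus_cont : continuous (@modulus R).
Proof.
move=> z; apply/contrP => e e0; exists e => // w; apply: le_lt_trans.
exact: modulus_dist.
Qed.
Lemma cre_cont : continuous (@cre R).
Proof.
move=> z; apply/contrP => e e0; exists e => // w; apply: le_lt_trans.
by rewrite -creN -creD cre_le.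
Qed.
Lemma cim_cont : continuous (@cim R).
Proof.
move=> z; apply/contrP => e e0; exists e => // w; apply: le_lt_trans.
by rewrite -cimN -cimD cim_le.
Qed.
Lemma rc_cont : continuous (@rc R).
Proof.
move=> x; apply/contcP => e e0; exists e => // y.
by rewrite -rcN -rcD modulus_rc.
Qed.
Lemma cplx_cont : continuous (fun p : R * R => cplx p.1 p.2).
Proof.
have -> : (fun p : R * R => cplx p.1 p.2) =
    (fun p => rc p.1 + rc p.2 * cplx 0 1 : CC R).
  apply/funext => p; apply: cplx_inj; rewrite ?creD ?cimD ?creM ?cimM /=.
    by rewrite mulr0 mul0r subr0 addr0.
  by rewrite mulr1 mulr0 addr0 add0r.
move=> p; apply: (@continuousD _ _ _ (fun p : R * R => rc p.1)).
  by apply: (@continuous_comp _ _ _ (@fst R R) (@rc R)); [exact: cvg_fst|exact: rc_cont].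
apply: (@continuousM _ _ (fun p : R * R => rc p.2) (fun _ => _)); last exact: cst_continuous.
by apply: (@continuous_comp _ _ _ (@snd R R) (@rc R)); [exact: cvg_snd|exact: rc_cont].
Qed.

Definition cball z x : set (CC R) := [set w | modulus (w - z) <= x].

Lemma closed_sublevel (f : CC R -> R) x : continuous f -> closed [set z | f z <= x].
Proof. move=> cf; exact: (preimage_closed (fun z _ => cf z) (@closed_le R x)). Qed.
Lemma closed_superlevel (f : CC R -> R) x : continuous f -> closed [set z | x <= f z].
Proof. move=> cf; exact: (preimage_closed (fun z _ => cf z) (@closed_ge R x)). Qed.
Lemma closed_level (f : CC R -> R) x : continuous f -> closed [set z | f z = x].
Proof. move=> cf; exact: (preimage_closed (fun z _ => cf z) (@closed_eq R x)). Qed.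

Lemma dist_cont (a : CC R) : continuous (fun z => modulus (z - a)).
Proof.
move=> z; apply/contrP => e e0; exists e => // w; apply: le_lt_trans.
by apply: le_trans (modulus_dist _ _) _; rewrite opprB addrA subrK.
Qed.

Lemma compact_of_closed_bounded (K : set (CC R)) (B : R) :
  closed K -> (forall z, K z -> modulus z <= B) -> compact K.
Proof.
move=> cK bK.
pose Q := (fun p : R * R => cplx p.1 p.2) @` (`[- B, B] `*` `[- B, B]).
have cQ : compact Q.
  apply: continuous_compact; first by apply: continuous_subspaceT; exact: cplx_cont.
  by apply: compact_setX; exact: segment_compact.
apply: (subclosed_compact cK cQ) => z /bK zB.
exists (cre z, cim z); last by rewrite -cplxE.
by split => /=; rewrite in_itv /= -ler_norml; apply: le_trans zB;
   rewrite ?cre_le ?cim_le.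
Qed.

Lemma cball_compact z x : compact (cball z x).
Proof.
apply: (@compact_of_closed_bounded _ (modulus z + x)).
  exact: (@closed_sublevel (fun w => modulus (w - z)) x (@dist_cont z)).
move=> w; rewrite /cball/= => wx.
by have := modulusD (w - z) z; rewrite subrK; lra.
Qed.

Global Opaque CC.

(* Caratheodory's form of complex differentiability. *)
Definition cdiff (f : CC R -> CC R) z := exists2 phi : CC R -> CC R,
  cont phi z & forall w, f w - f z = phi w * (w - z).

Lemma cont_cst (c z : CC R) : cont (fun _ : CC R => c) z.
Proof. by rewrite unlock; exact: cst_continuous. Qed.
Lemma cont_id z : cont (fun w : CC R => w) z.
Proof. by rewrite unlock. Qed.
Lemma contD (f g : CC R -> CC R) z : cont f z ->
  cont g z -> cont (fun w => f w + g w) z.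
Proof. rewrite unlock => cf cg; exact: (@continuousD _ _ _ f g z cf cg). Qed.
Lemma contN (f : CC R -> CC R) z : cont f z ->
  cont (fun w => - f w) z.
Proof. rewrite unlock => cf; exact: (@continuousN _ _ _ f z cf). Qed.
Lemma contM (f g : CC R -> CC R) z : cont f z ->
  cont g z -> cont (fun w => f w * g w) z.
Proof. rewrite unlock => cf cg; exact: (@continuousM _ _ f g z cf cg). Qed.
Lemma contV (f : CC R -> CC R) z : f z != 0 -> cont f z ->
  cont (fun w => (f w)^-1) z.
Proof. rewrite unlock => f0 cf; exact: (@continuousV _ _ f z f0 cf). Qed.
Lemma cont_comp (f g : CC R -> CC R) z : cont f z ->
  cont g (f z) -> cont (fun w => g (f w)) z.
Proof. rewrite unlock => cf cg; exact: (@continuous_comp _ _ _ f g z cf cg). Qed.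
Lemma cont_near (f g : CC R -> CC R) z : (\forall w \near z, f w = g w) ->
  cont f z -> cont g z.
Proof.
rewrite unlock => fg cf V; rewrite -(nbhs_singleton fg) => /cf fV.
by apply: filterS2 fg fV => w /= <-.
Qed.

Lemma cdiff_cont f z : cdiff f z -> cont f z.
Proof.
move=> [phi cphi fE]; have -> : f = (fun w => f z + phi w * (w - z)).
  by apply/funext => w; rewrite -fE addrC subrK.
apply: contD; first exact: cont_cst.
by apply: contM => //; apply: contD; [exact: cont_id | exact: cont_cst].
Qed.
Lemma cdiff_cst (c z : CC R) : cdiff (fun _ => c) z.
Proof. by exists (fun _ => 0) => [|w]; [exact: cont_cst | rewrite subrr mul0r]. Qed.
Lemma cdiff_id z : cdiff id z.
Proof. by exists (fun _ => 1) => [|w]; [exact: cont_cst | rewrite mul1r]. Qed.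
Lemma cdiffD f g z : cdiff f z -> cdiff g z -> cdiff (fun w => f w + g w) z.
Proof.
move=> [p cp fE] [q cq gE]; exists (fun w => p w + q w) => [|w]; first exact: contD.
by rewrite mulrDl -fE -gE opprD addrACA.
Qed.
Lemma cdiffN f z : cdiff f z -> cdiff (fun w => - f w) z.
Proof.
move=> [p cp fE]; exists (fun w => - p w) => [|w]; first exact: contN.
by rewrite mulNr -fE opprB opprK addrC.
Qed.
Lemma cdiffM f g z : cdiff f z -> cdiff g z -> cdiff (fun w => f w * g w) z.
Proof.
move=> df dg; have cf := cdiff_cont df; move: df dg => [p cp fE] [q cq gE].
exists (fun w => p w * g z + f w * q w) => [|w].
  by apply: contD; apply: contM => //; exact: cont_cst.
by rewrite mulrDl -[f w * _ * _]mulrA -gE mulrAC -fE; ring.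
Qed.
Lemma cdiffV f z : f z != 0 -> cdiff f z -> cdiff (fun w => (f w)^-1) z.
Proof.
move=> f0 df; have cf := cdiff_cont df; move: df => [p cp fE].
have n0 : \forall w \near z, f w != 0.
  have /contP/(_ (modulus (f z))) [|d d0 H] := cf; first by rewrite modulus_gt0.
  apply/nbhsCP; exists d => // w /H; apply: contraTneq => ->.
  by rewrite sub0r modulusN ltxx.
(* The slope identity is demanded at every w, including zeros of f, where the inverse is 0 by
   convention; there are none near z, so continuity of the slope is not affected. *)
exists (fun w => if f w == 0 then - (f z)^-1 / (w - z) else - p w / (f w * f z)) => [|w].
  apply: (@cont_near (fun w => - p w * (f w * f z)^-1)).
    by apply: filterS n0 => w /negPf ->.
  apply: contM; first exact: contN.
  by apply: contV; [rewrite mulf_neq0 | apply: contM => //; exact: cont_cst].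
case: ifPn => [/eqP fw|fw].
  rewrite fw invr0 sub0r -mulrA mulVf ?mulr1//.
  by apply: contra_neq f0; move/eqP; rewrite subr_eq0 => /eqP <-.
by rewrite mulrAC mulNr -fE; field; rewrite f0.
Qed.
Lemma cdiff_comp f g z : cdiff f z -> cdiff g (f z) -> cdiff (fun w => g (f w)) z.
Proof.
move=> df [q cq gE]; have cf := cdiff_cont df; move: df => [p cp fE].
exists (fun w => q (f w) * p w) => [|w]; last by rewrite gE fE mulrA.
by apply: contM => //; exact: cont_comp.
Qed.
Lemma cdiffX f z n : cdiff f z -> cdiff (fun w => f w ^+ n) z.
Proof.
move=> df; elim: n => [|n IH].
  by under eq_fun do rewrite expr0; exact: cdiff_cst.
by under eq_fun do rewrite exprS; exact: cdiffM.
Qed.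
Lemma cdiffB f g z : cdiff f z -> cdiff g z -> cdiff (fun w => f w - g w) z.
Proof. by move=> df dg; apply: cdiffD => //; exact: cdiffN. Qed.
Lemma cdiff_near f g z : (\forall w \near z, f w = g w) -> cdiff f z -> cdiff g z.
Proof.
move=> fg [p cp fE]; have fgz := nbhs_singleton fg.
exists (fun w => if f w == g w then p w else (g w - g z) / (w - z)) => [|w].
  by apply: (@cont_near p) => //; apply: filterS fg => w ->; rewrite eqxx.
case: ifPn => [/eqP <-|fw]; first by rewrite -fgz.
rewrite mulfVK// subr_eq0; apply: contraNneq fw => ->; exact/eqP.
Qed.
Lemma derivable_cdiff (f : CC R -> CC R) z : derivable f z 1 -> cdiff f z.
Proof.
move=> /cvg_ex[l fl].
exists (fun w => if w == z then l else (f w - f z) / (w - z)) => [|w]; last first.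
  by case: eqVneq => [->|wz]; rewrite ?subrr ?mulr0// mulfVK// subr_eq0.
rewrite unlock => V /=; rewrite eqxx => lV; have Vl := nbhs_singleton lV.
have : nbhs (0 : CC R) (fun h : CC R => h != 0 ->
    V (h^-1 *: ((f \o shift z) (h *: 1) - f z))) by exact: fl.
move=> /nbhsCP[e e0 H]; apply/nbhsCP; exists e => // w we /=.
have := H (w - z); rewrite subr0 /= subr_eq0 => /(_ we).
case: (eqVneq w z) => [//|wz] /(_ isT).
have -> : (w - z)%:A + z = w :> CC R by rewrite [_%:A]mulr1 subrK.
by rewrite [X in V X -> _]mulrC.
Qed.

End Basics.

(** * Trapezoid sums around squares and Goursat's bisection *)

Section Trapezoid.
Variable R : realType.
Implicit Types (f g : CC R -> CC R) (p d z w : CC R) (m n : nat).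

Definition ii : CC R := cplx 0 1.
Lemma iiM : ii * ii = -1.
Proof. by apply: cplx_inj; rewrite !cE; ring. Qed.
Lemma modulus_ii : modulus ii = 1.
Proof. by rewrite modulusE /= expr0n add0r expr1n sqrtr1. Qed.

Definition node p d m j := p + j%:R / m%:R * d.

(* The trapezoid rule is exact on affine functions; this is all that Goursat's
   argument needs of an integral. *)
Definition trapezoid f p d m : CC R :=
  \sum_(0 <= j < m) (f (node p d m j) + f (node p d m j.+1)) / 2 * (d / m%:R).

Lemma trapezoidD f g p d m :
  trapezoid (fun z => f z + g z) p d m = trapezoid f p d m + trapezoid g p d m.
Proof.
rewrite /trapezoid -big_split /=; apply: eq_bigr => j _.
by rewrite -mulrDl -mulrDl [_ + g _ + _]addrACA.
Qed.

Lemma trapezoidZ (c : CC R) f p d m :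
  trapezoid (fun z => c * f z) p d m = c * trapezoid f p d m.
Proof.
rewrite /trapezoid mulr_sumr; apply: eq_bigr => j _.
by rewrite -mulrDr !mulrA.
Qed.

Lemma trapezoid_split f p d m : (0 < m)%N ->
  trapezoid f p (d + d) (m + m) = trapezoid f p d m + trapezoid f (p + d) d m.
Proof.
move=> m0; have m0' : m%:R != 0 :> CC R by rewrite pnatr_eq0 -lt0n.
rewrite /trapezoid (@big_cat_nat _ _ _ m) ?leq_addr//=; congr (_ + _).
  apply: eq_bigr => j _; congr ((f _ + f _) / 2 * _); rewrite /node.
  - by rewrite natrD; field; rewrite m0' -mulr2n mulrn_eq0.
  - by rewrite natrD; field; rewrite m0' -mulr2n mulrn_eq0.
  - by rewrite natrD; field; rewrite m0' -mulr2n mulrn_eq0.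
rewrite -{1}[m]add0n big_addn addnK; apply: eq_bigr => j _.
congr ((f _ + f _) / 2 * _); rewrite /node.
  - by rewrite !natrD; field; rewrite m0' -mulr2n mulrn_eq0.
  - by rewrite -addSn !natrD; field; rewrite m0' -mulr2n mulrn_eq0.
  - by rewrite natrD; field; rewrite m0' -mulr2n mulrn_eq0.
Qed.

Lemma trapezoid_affine (a b : CC R) p d m : (0 < m)%N ->
  trapezoid (fun z => a + b * z) p d m = a * d + b / 2 * ((p + d) ^+ 2 - p ^+ 2).
Proof.
move=> m0; have m0' : m%:R != 0 :> CC R by rewrite pnatr_eq0 -lt0n.
pose G z := a * z + b / 2 * z ^+ 2.
transitivity (\sum_(0 <= j < m) (G (node p d m j.+1) - G (node p d m j))).
  by apply: eq_bigr => j _; rewrite /G /node -natr1; field.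
rewrite telescope_sumr// /G /node divff// mul0r mul0r addr0 mul1r.
by ring.
Qed.

Lemma trapezoid_le (B : R) f p d m :
  (forall t : R, 0 <= t <= 1 -> modulus (f (p + rc t * d)) <= B) ->
  modulus (trapezoid f p d m) <= B * modulus d.
Proof.
move=> fB; have [->|m0] := posnP m.
  rewrite /trapezoid big_geq// modulus0 mulr_ge0 ?modulus_ge0//.
  by apply: le_trans (modulus_ge0 _) (fB 0 _); rewrite lexx ler01.
have m0' : m%:R != 0 :> R by rewrite pnatr_eq0 -lt0n.
have nodeB j : (j <= m)%N -> modulus (f (node p d m j)) <= B.
  move=> jm; have -> : node p d m j = p + rc (j%:R / m%:R) * d.
    by rewrite rcM rcV !rc_nat.
  by apply: fB; rewrite divr_ge0//= ler_pdivrMr ?ltr0n// mul1r ler_nat.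
have modsum (s : nat -> CC R) k :
    modulus (\sum_(0 <= j < k) s j) <= \sum_(0 <= j < k) modulus (s j).
  elim: k => [|k IH]; first by rewrite !big_geq// modulus0.
  by rewrite !big_nat_recr//=; apply: le_trans (modulusD _ _) _; rewrite lerD2r.
apply: le_trans (modsum _ _) _.
apply: (@le_trans _ _ (\sum_(0 <= j < m) (B * (modulus d / m%:R)))).
  rewrite big_nat_cond [leRHS]big_nat_cond.
  apply: ler_sum => j; rewrite andbT => /andP[_ jm].
  rewrite !modulusM !modulusV -!rc_nat !modulus_rc !normr_nat.
  rewrite ler_wpM2r ?divr_ge0 ?modulus_ge0// ler_pdivrMr// mulr_natr mulr2n.
  by apply: le_trans (modulusD _ _) _; rewrite lerD ?nodeB// ltnW.
rewrite sumr_const_nat subn0 -mulr_natr le_eqVlt; apply/orP; left; apply/eqP.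
by field.
Qed.

(* Counterclockwise along the boundary of the square with side d and corner p. *)
Definition square f p d m := trapezoid f p d m + trapezoid f (p + d) (ii * d) m
  - trapezoid f (p + ii * d) d m - trapezoid f p (ii * d) m.

Lemma square_split f p d m : (0 < m)%N -> square f p (d + d) (m + m) =
  square f p d m + square f (p + d) d m + square f (p + ii * d) d m +
  square f (p + d + ii * d) d m.
Proof.
move=> m0; rewrite /square mulrDr !trapezoid_split//.
rewrite !(addrA p) [p + ii * d + ii * d + d]addrAC [p + ii * d + d]addrAC.
by rewrite [p + d + d + ii * d]addrAC; ring.
Qed.

Lemma square_affine (a b : CC R) p d m : (0 < m)%N ->
  square (fun z => a + b * z) p d m = 0.
Proof. by move=> m0; rewrite /square !trapezoid_affine//; ring. Qed.

Lemma squareD f g p d m :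
  square (fun z => f z + g z) p d m = square f p d m + square g p d m.
Proof. by rewrite /square !trapezoidD; ring. Qed.

Definition closed_square p d : set (CC R) :=
  [set w | exists s t : R, [/\ 0 <= s <= 1, 0 <= t <= 1 &
    w = p + rc s * d + rc t * (ii * d)]].

Lemma square_le (B : R) f p d m :
  (forall w, closed_square p d w -> modulus (f w) <= B) ->
  modulus (square f p d m) <= 4 * B * modulus d.
Proof.
move=> fB; rewrite /square.
have I0 : 0 <= (0 : R) <= 1 by rewrite lexx ler01.
have I1 : 0 <= (1 : R) <= 1 by rewrite lexx ler01.
have h1 : modulus (trapezoid f p d m) <= B * modulus d.
  apply: trapezoid_le => t t01; apply: fB; exists t, 0; split=> //.
  by rewrite rc0 mul0r addr0.
have h2 : modulus (trapezoid f (p + d) (ii * d) m) <= B * modulus d.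
  rewrite -[modulus d]mul1r -modulus_ii -modulusM.
  apply: trapezoid_le => t t01; apply: fB; exists 1, t; split=> //.
  by rewrite rc1 mul1r.
have h3 : modulus (trapezoid f (p + ii * d) d m) <= B * modulus d.
  apply: trapezoid_le => t t01; apply: fB; exists t, 1; split=> //.
  by rewrite rc1 mul1r addrAC.
have h4 : modulus (trapezoid f p (ii * d) m) <= B * modulus d.
  rewrite -[modulus d]mul1r -modulus_ii -modulusM.
  apply: trapezoid_le => t t01; apply: fB; exists 0, t; split=> //.
  by rewrite rc0 mul0r addr0.
set A1 := trapezoid f p d m in h1 *; set A2 := trapezoid _ (p + d) _ _ in h2 *.
set A3 := trapezoid _ _ d m in h3 *; set A4 := trapezoid _ _ _ _ in h4 *.
have := modulusD (A1 + A2 - A3) (- A4); have := modulusD (A1 + A2) (- A3).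
have := modulusD A1 A2; rewrite !modulusN; lra.
Qed.

(** No limit of the sums is formed; the bound is asked of all fine enough subdivisions. Powers of
    two make a subdivision of a square restrict to its quarters, and the bound is additive: four
    quarters of side d give 4 e |d|^2 = e |2 d|^2. *)
Definition square_good f (e : R) p d := exists N, forall n, (N <= n)%N ->
  modulus (square f p d (2 ^ n)) <= e * modulus d ^+ 2.

Lemma square_good_split f e p d :
  square_good f e p d -> square_good f e (p + d) d ->
  square_good f e (p + ii * d) d -> square_good f e (p + d + ii * d) d ->
  square_good f e p (d + d).
Proof.
move=> [N1 H1] [N2 H2] [N3 H3] [N4 H4].
exists (N1 + N2 + N3 + N4).+1 => -[//|n]; rewrite ltnS => Nn.
rewrite expnS mul2n -addnn square_split ?expn_gt0//.
have {}H1 := H1 n (leq_trans (leq_trans (leq_addr _ _)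
  (leq_trans (leq_addr _ _) (leq_addr _ _))) Nn).
have {}H2 := H2 n (leq_trans (leq_trans (leq_addl _ _)
  (leq_trans (leq_addr _ _) (leq_addr _ _))) Nn).
have {}H3 := H3 n (leq_trans (leq_trans (leq_addl _ _) (leq_addr _ _)) Nn).
have {}H4 := H4 n (leq_trans (leq_addl _ _) Nn).
rewrite -mulr2n -mulr_natl modulusM -rc_nat modulus_rc normr_nat.
set A1 := square f p d _ in H1 *; set A2 := square f (p + d) d _ in H2 *.
set A3 := square _ (p + ii * d) d _ in H3 *; set A4 := square _ _ _ _ in H4 *.
have := modulusD (A1 + A2 + A3) A4; have := modulusD (A1 + A2) A3.
have := modulusD A1 A2; rewrite exprMn; lra.
Qed.

(** The limit of the left ends of nested intervals of length 2^-k, for either coordinate of the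
    corners in the bisection. *)
Lemma nested_sup (s : nat -> R) :
  (forall k, s k <= s k.+1 <= s k + 2^-1 ^+ k.+1) ->
  exists x, forall k, s k <= x <= s k + 2^-1 ^+ k.
Proof.
move=> H.
have sS j k : (j <= k)%N -> s j <= s k.
  by move=> jk; apply: (@homo_leq _ s <=%R) jk => // [x y z|n];
     [exact: le_trans | case/andP: (H n)].
have uS j k : (j <= k)%N -> s k + 2^-1 ^+ k <= s j + 2^-1 ^+ j.
  move=> /subnK <-; elim: (k - j)%N => // n; apply: le_trans.
  by have /andP[_] := H (n + j)%N; rewrite addSn exprS; lra.
have half_ge0 k : 0 <= 2^-1 ^+ k :> R by rewrite exprn_ge0 ?invr_ge0.
have ub k : ubound (range s) (s k + 2^-1 ^+ k).
  move=> _ [j _ <-]; have [jk|/ltnW kj] := leqP j k.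
    by apply: le_trans (sS _ _ jk) _; rewrite lerDl.
  by apply: le_trans (uS _ _ kj); rewrite lerDl.
exists (sup (range s)) => k; apply/andP; split.
  by apply: ub_le_sup; [exists (s 0%N + 2^-1 ^+ 0); exact: ub | exists k].
by apply: ge_sup; [exists (s 0%N), 0%N | exact: ub].
Qed.

(** The tangent at z is affine and contributes 0. The remainder is at most (e / 8) (2 |d|) on the
    square, and four sides of length |d| turn this into e |d|^2. *)
Lemma cdiff_good f z (e : R) : 0 < e -> cdiff f z ->
  exists2 D : R, 0 < D & forall p d, closed_square p d z -> modulus d < D ->
    square_good f e p d.
Proof.
move=> e0 [phi /contP/(_ (e / 8)) H fE]; have {H} [|D D0 HD] := H.
  by rewrite divr_gt0.
exists (D / 2) => [|p d zS dD]; first by rewrite divr_gt0.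
exists 0%N => n _.
have -> : f = (fun w => (f z - phi z * z + phi z * w) + (phi w - phi z) * (w - z)).
  by apply/funext => w; rewrite mulrBl -fE; ring.
rewrite squareD square_affine ?expn_gt0// add0r.
apply: le_trans (@square_le (e / 8 * (2 * modulus d)) _ _ _ _ _) _; last lra.
move=> w wS; have wz : modulus (w - z) <= 2 * modulus d.
  case: zS wS => [s [t [s01 t01 ->]]] [s' [t' [s01' t01' ->]]].
  have -> : p + rc s' * d + rc t' * (ii * d) - (p + rc s * d + rc t * (ii * d))
     = (rc (s' - s) + rc (t' - t) * ii) * d by rewrite !rcD !rcN; ring.
  rewrite modulusM ler_wpM2r ?modulus_ge0//.
  apply: le_trans (modulusD _ _) _; rewrite modulusM modulus_ii mulr1 !modulus_rc.
  have : `|s' - s| <= 1 by rewrite ler_norml; lra.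
  have : `|t' - t| <= 1 by rewrite ler_norml; lra.
  lra.
rewrite modulusM ler_pM ?modulus_ge0//; apply/ltW/HD; lra.
Qed.

(* Goursat's bisection: a square on which the estimate fails has a quarter on
   which it fails. *)
Lemma goursat f p d (e : R) : 0 < e ->
  (forall z, closed_square p d z -> cdiff f z) -> square_good f e p d.
Proof.
move=> e0 df; apply: contrapT => bad0.
pose pt (x : R * R) : CC R := p + rc x.1 * d + rc x.2 * (ii * d).
pose dk k : CC R := rc (2^-1 ^+ k) * d.
have dkS k : dk k = dk k.+1 + dk k.+1.
  rewrite /dk -mulrDl -rcD exprS; congr (rc _ * _); lra.
(* A state is a depth and the coordinates of a corner. The estimates are conditional on failure so
   that every state has a successor, as dependent choice requires. *)
pose step (a b : nat * (R * R)) := b.1 = a.1.+1 /\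
   (~ square_good f e (pt a.2) (dk a.1) -> [/\ ~ square_good f e (pt b.2) (dk b.1),
      a.2.1 <= b.2.1 <= a.2.1 + 2^-1 ^+ b.1 & a.2.2 <= b.2.2 <= a.2.2 + 2^-1 ^+ b.1]).
have [x [x0 xS]] : {x : nat -> nat * (R * R) |
    x 0%N = (0%N, (0, 0)) /\ forall n, step (x n) (x n.+1)}.
  apply: dependent_choice => -[k y]; apply: cid; rewrite /step /=.
  have h0 : 0 <= 2^-1 ^+ k.+1 :> R by rewrite exprn_ge0 ?invr_ge0.
  have I0 (a : R) : a <= a <= a + 2^-1 ^+ k.+1 by rewrite lexx lerDl.
  have I1 (a : R) : a <= a + 2^-1 ^+ k.+1 <= a + 2^-1 ^+ k.+1 by rewrite lexx lerDl h0.
  have [g|b1] := pselect (square_good f e (pt y) (dk k)).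
    by exists (k.+1, y); split.
  have [g1|b2] := pselect (square_good f e (pt y) (dk k.+1)); last first.
    by exists (k.+1, y); split.
  have [g2|b3] := pselect (square_good f e (pt (y.1 + 2^-1 ^+ k.+1, y.2)) (dk k.+1)); last first.
    by exists (k.+1, (y.1 + 2^-1 ^+ k.+1, y.2)); split.
  have [g3|b4] := pselect (square_good f e (pt (y.1, y.2 + 2^-1 ^+ k.+1)) (dk k.+1)); last first.
    by exists (k.+1, (y.1, y.2 + 2^-1 ^+ k.+1)); split.
  have [g4|b5] := pselect (square_good f e
      (pt (y.1 + 2^-1 ^+ k.+1, y.2 + 2^-1 ^+ k.+1)) (dk k.+1)); last first.
    by exists (k.+1, (y.1 + 2^-1 ^+ k.+1, y.2 + 2^-1 ^+ k.+1)); split.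
  exfalso; apply: b1; rewrite dkS; apply: square_good_split => //.
  - have <- : pt (y.1 + 2^-1 ^+ k.+1, y.2) = pt y + dk k.+1 by rewrite /pt /dk /= rcD; ring.
    exact: g2.
  - have <- : pt (y.1, y.2 + 2^-1 ^+ k.+1) = pt y + ii * dk k.+1 by rewrite /pt /dk /= rcD; ring.
    exact: g3.
  - have <- : pt (y.1 + 2^-1 ^+ k.+1, y.2 + 2^-1 ^+ k.+1) = pt y + dk k.+1 + ii * dk k.+1.
      by rewrite /pt /dk /= !rcD; ring.
    exact: g4.
have xk k : (x k).1 = k.
  elim: k => [|k IH]; first by rewrite x0.
  by case: (xS k) => ->; rewrite IH.
pose y k := (x k).2.
have yS k : ~ square_good f e (pt (y k)) (dk k) ->
   [/\ ~ square_good f e (pt (y k.+1)) (dk k.+1),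
     (y k).1 <= (y k.+1).1 <= (y k).1 + 2^-1 ^+ k.+1 &
     (y k).2 <= (y k.+1).2 <= (y k).2 + 2^-1 ^+ k.+1].
  by have [_] := xS k; rewrite !xk.
have bad k : ~ square_good f e (pt (y k)) (dk k).
  elim: k => [|k IH]; last by case: (yS k IH).
  by rewrite /y x0 /pt /dk /= rc0 !mul0r !addr0 expr0 rc1 mul1r.
have [s Hs] : exists s, forall k, (y k).1 <= s <= (y k).1 + 2^-1 ^+ k.
  by apply: nested_sup => k; case: (yS k (bad k)).
have [t Ht] : exists t, forall k, (y k).2 <= t <= (y k).2 + 2^-1 ^+ k.
  by apply: nested_sup => k; case: (yS k (bad k)).
have zS k : closed_square (pt (y k)) (dk k) (pt (s, t)).
  have h0 : 0 < 2^-1 ^+ k :> R by rewrite exprn_gt0 ?invr_gt0.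
  have h1 : rc (2^-1 ^+ k) != 0 :> CC R.
    by rewrite -modulus_gt0 modulus_rc normr_gt0 gt_eqF.
  exists ((s - (y k).1) / 2^-1 ^+ k), ((t - (y k).2) / 2^-1 ^+ k).
  have unit01 (a b : R) : a <= b <= a + 2^-1 ^+ k -> 0 <= (b - a) / 2^-1 ^+ k <= 1.
    move=> /andP[ab ba]; apply/andP; split.
      by apply: divr_ge0; [rewrite subr_ge0 | exact: ltW].
    by rewrite ler_pdivrMr// mul1r lerBlDl.
  split; [exact: unit01 (Hs k) | exact: unit01 (Ht k) | ].
  by rewrite /pt /dk /= !rcM !rcV !rcD !rcN; field.
have [|D D0 HD] := cdiff_good e0 (df (pt (s, t)) _).
  by move: (zS 0%N); rewrite /y x0 /pt /dk/= expr0 rc1 rc0 !mul0r !addr0 mul1r.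
have [k kD] : exists k, modulus d * 2^-1 ^+ k < D.
  have [d0|d0] := leP (modulus d) 0.
    by exists 0%N; rewrite expr0 mulr1; exact: le_lt_trans D0.
  have [k _ /(_ k (leqnn _)) Hk] := near_infty_natSinv_expn_lt (PosNum (divr_gt0 D0 d0)).
  exists k; move: Hk; rewrite /= ltr_pdivlMr// mulrC; apply: le_lt_trans.
  by rewrite div1r exprVn.
apply: (bad k); apply: HD => //.
rewrite /dk modulusM modulus_rc ger0_norm ?exprn_ge0 ?invr_ge0// mulrC.
exact: kD.
Qed.

End Trapezoid.

(** * Maxima, bounds and uniform continuity on compact sets *)

Section Compactness.
Variable R : realType.
Implicit Types (f g : CC R -> CC R) (K : set (CC R)).

Lemma argmax_on_compact (h : CC R -> R) K : compact K -> K !=set0 ->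
  (forall z, K z -> {for z, continuous h}) ->
  exists2 p, K p & forall z, K z -> h z <= h p.
Proof.
move=> cK K0 ch.
have [p /set_mem Kp Hp] : exists2 c, c \in K & forall t, t \in K -> h t <= h c.
  apply: compact_EVT_max => //; apply: continuous_in_subspaceT => z /set_mem.
  exact: ch.
by exists p => // z Kz; apply: Hp; exact/mem_set.
Qed.

Lemma cont_modulus f z : cont f z -> {for z, continuous (fun w => modulus (f w))}.
Proof.
rewrite unlock => cf; apply: (@continuous_comp _ _ _ f (@modulus R) z cf).
exact: modulus_cont.
Qed.

Lemma cont_bounded f K : compact K -> (forall z, K z -> cont f z) ->
  exists2 B : R, 0 <= B & forall z, K z -> modulus (f z) <= B.
Proof.
move=> cK cf; have [K0|nK0] := pselect (K !=set0); last first.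
  by exists 0 => // z Kz; case: nK0; exists z.
have [z Kz|p Kp Hp] := @argmax_on_compact (fun w => modulus (f w)) K cK K0.
  exact/cont_modulus/cf.
by exists (modulus (f p)) => //; exact: modulus_ge0.
Qed.

Lemma uniform_cont f K (e : R) : compact K -> (forall z, K z -> cont f z) ->
  0 < e -> exists2 D : R, 0 < D & forall z w, K z -> modulus (w - z) < D ->
    modulus (f w - f z) < e.
Proof.
move=> /compact_near_coveringP cK cf e0.
have := cK _ (0 : R)^'+
  (fun D z => forall w, modulus (w - z) < D -> modulus (f w - f z) < e) _.
case=> [z Kz|D /= D0 HD].
  have /contP/(_ (e / 2)) [|d d0 Hd] := cf z Kz; first by rewrite divr_gt0.
  exists ([set w | modulus (w - z) < d / 2], [set D | D < d / 2]).
    split => /=; first by apply/nbhsCP; exists (d / 2); rewrite ?divr_gt0.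
    by apply: nbhs_right_lt; rewrite divr_gt0.
  move=> [u D] /= [uz Dd] w wu.
  have h1 : modulus (f u - f z) < e / 2 by apply: Hd; lra.
  have h2 : modulus (f w - f z) < e / 2.
    by apply: Hd; have := modulusBD w z u; lra.
  by have := modulusBD (f w) (f u) (f z); rewrite (modulusB (f z)); lra.
exists (D / 2) => [|z w Kz wz]; first by rewrite divr_gt0.
apply: (HD (D / 2)) => //=; last by rewrite divr_gt0.
by rewrite sub0r normrN gtr0_norm ?divr_gt0//; lra.
Qed.

End Compactness.

(** * A Cauchy estimate for the value at the centre of a disc *)

Section CauchyEstimate.
Variable R : realType.
Implicit Types (f g : CC R -> CC R) (p d z w u : CC R) (m n : nat).
Local Notation ii := (ii R).

(** That is, the limit superior of the sums over dyadic subdivisions is at most [b]. *)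
Definition square_lim_le f p d (b : R) := forall e : R, 0 < e ->
  exists N, forall n, (N <= n)%N -> modulus (square f p d (2 ^ n)) <= b + e.

Lemma goursat_lim f p d :
  (forall z, closed_square p d z -> cdiff f z) -> square_lim_le f p d 0.
Proof.
move=> df e e0.
have D0 : 0 < modulus d ^+ 2 + 1 by rewrite ltr_wpDl ?sqr_ge0.
have [|N HN] := @goursat _ f p d (e / (modulus d ^+ 2 + 1)) _ df.
  by rewrite divr_gt0.
exists N => n /HN; rewrite add0r => /le_trans; apply.
rewrite mulrAC ler_pdivrMr//; have := sqr_ge0 (modulus d); nra.
Qed.

Lemma square_lim_split f p d b : square_lim_le f p d b ->
  square_lim_le f (p + d) d 0 -> square_lim_le f (p + ii * d) d 0 ->
  square_lim_le f (p + d + ii * d) d 0 -> square_lim_le f p (d + d) b.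
Proof.
move=> h1 h2 h3 h4 e e0; have e4 : 0 < e / 4 by rewrite divr_gt0.
have [N1 H1] := h1 _ e4; have [N2 H2] := h2 _ e4.
have [N3 H3] := h3 _ e4; have [N4 H4] := h4 _ e4.
exists (N1 + N2 + N3 + N4).+1 => -[//|n]; rewrite ltnS => Nn.
rewrite expnS mul2n -addnn square_split ?expn_gt0//.
have {}H1 := H1 n (leq_trans (leq_trans (leq_addr _ _)
  (leq_trans (leq_addr _ _) (leq_addr _ _))) Nn).
have {}H2 := H2 n (leq_trans (leq_trans (leq_addl _ _)
  (leq_trans (leq_addr _ _) (leq_addr _ _))) Nn).
have {}H3 := H3 n (leq_trans (leq_trans (leq_addl _ _) (leq_addr _ _)) Nn).
have {}H4 := H4 n (leq_trans (leq_addl _ _) Nn).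
set A1 := square f p d _ in H1 *; set A2 := square f (p + d) d _ in H2 *.
set A3 := square _ (p + ii * d) d _ in H3 *; set A4 := square _ _ _ _ in H4 *.
have := modulusD (A1 + A2 + A3) A4; have := modulusD (A1 + A2) A3.
have := modulusD A1 A2; lra.
Qed.

(* At a corner where f is merely bounded, halving the square towards the corner
   shows that its contribution vanishes. *)
Lemma goursat_corner f p d (B : R) : d != 0 ->
  (forall z, closed_square p d z -> modulus (f z) <= B) ->
  (forall z, closed_square p d z -> z != p -> cdiff f z) ->
  square_lim_le f p d 0.
Proof.
move=> d0 fB df.
(* 4 B |d| s is the trivial bound for the square of scale s. Each of k halvings towards p divides it
   by 2, since the other three quarters contribute 0. *)
suff H k (s : R) : 0 < s <= 1 -> square_lim_le f p (rc s * d) (4 * B * modulus d * s * 2^-1 ^+ k).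
  move=> e e0.
  have B0 : 0 <= B.
    apply: le_trans (modulus_ge0 (f p)) (fB _ _); exists 0, 0.
    by rewrite lexx ler01 rc0 !mul0r !addr0.
  have C0 : 0 < 4 * B * modulus d + 1.
    by rewrite ltr_wpDl// !mulr_ge0 ?modulus_ge0.
  have lt02 : 0 < 2 :> R by [].
  have [k _ /(_ k (leqnn _)) Hk] :=
    near_infty_natSinv_expn_lt (PosNum (divr_gt0 (divr_gt0 e0 lt02) C0)).
  have [||N HN] := H k 1 _ (e / 2); rewrite ?ltr01 ?lexx ?divr_gt0//.
  exists N => n /HN; rewrite rc1 mul1r mulr1 => /le_trans; apply; rewrite add0r.
  move: Hk; rewrite /= ltr_pdivlMr// div1r -exprVn.
  have : 0 <= 2^-1 ^+ k :> R by rewrite exprn_ge0 ?invr_ge0.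
  set q := 2^-1 ^+ k; set C := 4 * B * modulus d; nra.
elim: k s => [|k IH] s /andP[s0 s1].
  move=> e e0; exists 0%N => n _; rewrite expr0 mulr1.
  apply: (@le_trans _ _ (4 * B * modulus (rc s * d))).
    apply: square_le => w [a [b [a01 b01 ->]]]; apply: fB.
    exists (a * s), (b * s); rewrite !rcM; split; [nra|nra|ring].
  rewrite modulusM modulus_rc gtr0_norm//.
  lra.
have -> : rc s * d = rc (s / 2) * d + rc (s / 2) * d.
  by rewrite -mulrDl -rcD; congr (rc _ * _); lra.
have I (a b : R) : 1 <= a <= 2 \/ 1 <= b <= 2 -> 0 <= a <= 2 -> 0 <= b <= 2 ->
    cdiff f (p + rc a * (rc (s / 2) * d) + rc b * (ii * (rc (s / 2) * d))).
  move=> ab a02 b02; apply: df.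
    exists (a * (s / 2)), (b * (s / 2)); rewrite !rcM; split; [nra|nra|ring].
  rewrite -subr_eq0.
  have -> : p + rc a * (rc (s / 2) * d) + rc b * (ii * (rc (s / 2) * d)) - p
      = (rc a + rc b * ii) * (rc (s / 2) * d) by ring.
  rewrite !mulf_neq0//.
    apply/eqP => E; have := congr1 (@cre R) E; have := congr1 (@cim R) E.
    rewrite !cE; lra.
  by rewrite -modulus_gt0 modulus_rc normr_gt0 gt_eqF// divr_gt0.
apply: square_lim_split.
- have -> : 4 * B * modulus d * s * 2^-1 ^+ k.+1 = 4 * B * modulus d * (s / 2) * 2^-1 ^+ k.
    by rewrite exprS; ring.
  by apply: IH; lra.
- apply: goursat_lim => z [a [b [a01 b01 ->]]].
  set h := rc (s / 2) * d.
  have -> : p + h + rc a * h + rc b * (ii * h) = p + rc (a + 1) * h + rc b * (ii * h).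
    by rewrite rcD rc1; ring.
  by apply: I; lra.
- apply: goursat_lim => z [a [b [a01 b01 ->]]].
  set h := rc (s / 2) * d.
  have -> : p + ii * h + rc a * h + rc b * (ii * h) = p + rc a * h + rc (b + 1) * (ii * h).
    by rewrite rcD rc1; ring.
  by apply: I; lra.
- apply: goursat_lim => z [a [b [a01 b01 ->]]].
  set h := rc (s / 2) * d.
  have -> : p + h + ii * h + rc a * h + rc b * (ii * h) =
      p + rc (a + 1) * h + rc (b + 1) * (ii * h).
    by rewrite !rcD rc1; ring.
  by apply: I; lra.
Qed.

(* The two sides, of the square with corner z and side u, that avoid z. *)
Definition outer_edges f z u m :=
  trapezoid f (z + u) (ii * u) m - trapezoid f (z + ii * u) u m.

(** The outer sides lie between the circles of radii |u| and sqrt 2 |u| around z; 2 is a convenient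
    upper bound for sqrt 2. *)
Lemma outer_edges_le (B : R) f z u m :
  (forall w, modulus u <= modulus (w - z) <= 2 * modulus u -> modulus (f w) <= B) ->
  modulus (outer_edges f z u m) <= 2 * B * modulus u.
Proof.
move=> fB.
have bnd (a : CC R) t : modulus a = modulus (1 + rc t * ii) -> 0 <= t <= 1 ->
    modulus u <= modulus (a * u) <= 2 * modulus u.
  move=> at1 t01; rewrite modulusM at1.
  have lb : 1 <= modulus (1 + rc t * ii).
    have := cre_le (1 + rc t * ii); rewrite !cE mulr0 mul0r subr0 addr0.
    by rewrite normr1.
  have ub : modulus (1 + rc t * ii) <= 2.
    apply: le_trans (modulusD _ _) _; rewrite modulus1 modulusM modulus_ii mulr1.
    by rewrite modulus_rc ger0_norm; lra.
  by have := modulus_ge0 u; nra.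
have h1 : modulus (trapezoid f (z + u) (ii * u) m) <= B * modulus u.
  rewrite -[modulus u]mul1r -modulus_ii -modulusM.
  apply: trapezoid_le => t t01; apply: fB.
  have -> : z + u + rc t * (ii * u) - z = (1 + rc t * ii) * u by ring.
  exact: bnd.
have h2 : modulus (trapezoid f (z + ii * u) u m) <= B * modulus u.
  apply: trapezoid_le => t t01; apply: fB.
  have -> : z + ii * u + rc t * u - z = (rc t + ii) * u by ring.
  apply: (bnd _ t); last exact: t01.
  rewrite [LHS]modulusE [RHS]modulusE !cE; congr Num.sqrt; ring.
have := modulusD (trapezoid f (z + u) (ii * u) m) (- trapezoid f (z + ii * u) u m).
rewrite modulusN -/(outer_edges f z u m); lra.
Qed.

Lemma outer_edges_lin f g (c : CC R) z u m :
  outer_edges (fun w => f w + c * g w) z u m =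
  outer_edges f z u m + c * outer_edges g z u m.
Proof. by rewrite /outer_edges !trapezoidD !trapezoidZ; ring. Qed.

Lemma outer_edges_eq f g z u m :
  (forall w, modulus u <= modulus (w - z) <= 2 * modulus u -> f w = g w) ->
  outer_edges f z u m = outer_edges g z u m.
Proof.
move=> fg; have : modulus (outer_edges (fun w => f w + (-1) * g w) z u m) <= 0.
  apply: le_trans (@outer_edges_le 0 _ _ _ _ _) _; last by rewrite mulr0 mul0r.
  by move=> w /fg ->; rewrite mulN1r subrr modulus0.
rewrite outer_edges_lin mulN1r => h; apply/eqP.
by rewrite -subr_eq0 -modulus_eq0 eq_le h modulus_ge0.
Qed.

Lemma square_sum f z d m :
  square f z d m + square f z (ii * d) m + square f z (- d) m +
    square f z (- (ii * d)) m =
  outer_edges f z d m + outer_edges f z (ii * d) m + outer_edges f z (- d) m +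
    outer_edges f z (- (ii * d)) m.
Proof.
have e1 : ii * (ii * d) = - d by rewrite mulrA iiM mulN1r.
have e2 : ii * (- d) = - (ii * d) by rewrite mulrN.
have e3 : ii * (- (ii * d)) = d by rewrite mulrN e1 opprK.
by rewrite /square /outer_edges e1 e2 e3; ring.
Qed.

(** Approximates a quarter of the integral of dw / w around 0, that is i pi / 2. As dw / w is
    invariant under scaling and rotation, one number serves all centres and sides. *)
Definition inv_edges m : CC R := outer_edges (fun w => w^-1) 0 1 m.

Lemma outer_edges_inv z u m : u != 0 ->
  outer_edges (fun w => (w - z)^-1) z u m = inv_edges m.
Proof.
move=> u0; rewrite /inv_edges /outer_edges !mulr1 !add0r.
have tr (c e : CC R) : trapezoid (fun w => (w - z)^-1) (z + c * u) (e * u) m =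
    trapezoid (fun w => w^-1) c e m.
  apply: eq_bigr => j _; rewrite /node.
  have sc (t : CC R) : (z + c * u + t * (e * u) - z)^-1 = (c + t * e)^-1 / u.
    have -> : z + c * u + t * (e * u) - z = (c + t * e) * u by ring.
    by rewrite invfM.
  rewrite !sc; set x := (c + _)^-1; set y := (c + _)^-1.
  have -> : (x / u + y / u) / 2 * (e * u / m%:R) = (x + y) / 2 * (e / m%:R) * (u^-1 * u).
    by ring.
  by rewrite mulVf// mulr1.
by have := tr 1 ii; have := tr ii 1; rewrite !mul1r => -> ->.
Qed.

(** On both sides the imaginary part of dw / w is dt / (1 + t^2) >= dt / 2. This holds node by node,
    so no limit in [m] is needed; having 1 in place of pi / 2 only worsens the constant in the
    Cauchy estimate. *)
Lemma cim_inv_edges m : (0 < m)%N -> 1 <= cim (inv_edges m).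
Proof.
move=> m0; have m0' : 0 < m%:R :> R by rewrite ltr0n.
have cim_sum (s : nat -> CC R) k :
    cim (\sum_(0 <= j < k) s j) = \sum_(0 <= j < k) cim (s j).
  elim: k => [|k IH]; first by rewrite !big_geq.
  by rewrite !big_nat_recr//= cimD IH.
have inv1 (t : R) : (1 + rc t * ii)^-1 * ii = cplx (t / (1 + t ^+ 2)) ((1 + t ^+ 2)^-1).
  have n0 : 1 + t ^+ 2 != 0 by rewrite gt_eqF// ltr_wpDr ?sqr_ge0.
  have q0 : 1 + rc t * ii != 0.
    by apply/eqP => /(congr1 (@cre R)); rewrite !cE; lra.
  apply: (mulfI q0); rewrite mulrA divff// mul1r.
  by apply: cplx_inj; rewrite !cE; field.
have inv2 (t : R) : (ii + rc t)^-1 = cplx (t / (1 + t ^+ 2)) (- (1 + t ^+ 2)^-1).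
  have n0 : 1 + t ^+ 2 != 0 by rewrite gt_eqF// ltr_wpDr ?sqr_ge0.
  have q0 : ii + rc t != 0.
    by apply/eqP => /(congr1 (@cim R)); rewrite !cE; lra.
  apply: (mulfI q0); rewrite divff//.
  by apply: cplx_inj; rewrite !cE; field.
have half (t : R) : 0 <= t <= 1 -> 1 / 2 <= (1 + t ^+ 2)^-1.
  move=> t01; rewrite div1r lef_pV2 ?posrE//; first nra.
  by rewrite ltr_wpDr ?sqr_ge0.
have tE j : j%:R / m%:R = rc (j%:R / m%:R) :> CC R by rewrite rcM rcV !rc_nat.
have mV : m%:R^-1 = rc m%:R^-1 :> CC R by rewrite rcV rc_nat.
have twoV : 2^-1 = rc 2^-1 :> CC R by rewrite rcV rc_nat.
have t01 j : (j <= m)%N -> 0 <= (j%:R / m%:R : R) <= 1.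
  by move=> jm; rewrite divr_ge0//= ler_pdivrMr// mul1r ler_nat.
have sumc : \sum_(0 <= j < m) (1 / 2 / m%:R) = 1 / 2 :> R.
  by rewrite sumr_const_nat subn0 -[LHS]mulr_natr -mulrA mulVf ?mulr1 ?gt_eqF.
have A : 1 / 2 <= cim (trapezoid (fun w => w^-1) 1 ii m).
  rewrite cim_sum -[leLHS]sumc big_nat_cond [leRHS]big_nat_cond.
  apply: ler_sum => j; rewrite andbT => /andP[_ jm]; rewrite /node !tE.
  set a := rc (j%:R / _); set b := rc (_.+1%:R / _).
  have -> : ((1 + a * ii)^-1 + (1 + b * ii)^-1) / 2 * (ii / m%:R) =
     ((1 + a * ii)^-1 * ii + (1 + b * ii)^-1 * ii) * (2^-1 * m%:R^-1) by ring.
  rewrite !inv1 twoV mV -rcM !cE mulr0 add0r mulrA.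
  rewrite ler_pM2r ?invr_gt0//.
  by have := half _ (t01 _ (ltnW jm)); have := half _ (t01 _ jm); lra.
have B : cim (trapezoid (fun w => w^-1) ii 1 m) <= - (1 / 2).
  rewrite cim_sum -[X in - X]sumc -sumrN big_nat_cond [leRHS]big_nat_cond.
  apply: ler_sum => j; rewrite andbT => /andP[_ jm]; rewrite /node !tE !mulr1.
  rewrite !inv2 mul1r twoV mV -mulrA -rcM !cE mulr0 add0r mulrA -mulNr.
  rewrite ler_pM2r ?invr_gt0//.
  by have := half _ (t01 _ (ltnW jm)); have := half _ (t01 _ jm); lra.
rewrite /inv_edges /outer_edges !mulr1 !add0r cimD cimN; lra.
Qed.

(* The slope of f at z is bounded, so its sums over the four squares around the
   corner z tend to 0. The sides through z cancel; on the outer sides the slope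
   splits into f(w) / (w - z), of size at most m / r, and f(z) / (w - z). *)
Lemma cauchy_estimate f z (r m : R) : 0 < r ->
  (forall w, modulus (w - z) <= 2 * r -> cdiff f w) ->
  (forall w, r <= modulus (w - z) <= 2 * r -> modulus (f w) <= m) ->
  modulus (f z) <= 2 * m.
Proof.
move=> r0 df fm.
have [phi cphi fE] : cdiff f z by apply: df; rewrite subrr modulus0 mulr_ge0// ltW.
have cvp w : modulus (w - z) <= 2 * r -> w != z -> cdiff phi w.
  move=> wr wz; apply: (@cdiff_near _ (fun u => (f u - f z) / (u - z))).
    apply/nbhsCP; exists (modulus (w - z)); first by rewrite modulus_gt0 subr_eq0.
    move=> u uw; rewrite fE mulfK// subr_eq0; apply: contraTneq uw => ->.
    by rewrite modulusB ltxx.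
  apply: cdiffM.
    by apply: cdiffB; [exact: df | exact: cdiff_cst].
  apply: cdiffV; first by rewrite subr_eq0.
  by apply: cdiffB; [exact: cdiff_id | exact: cdiff_cst].
have [B B0 HB] : exists2 B : R, 0 <= B &
    forall w, cball z (2 * r) w -> modulus (phi w) <= B.
  apply: cont_bounded; first exact: cball_compact.
  move=> w wr; have [->//|wz] := eqVneq w z; exact/cdiff_cont/cvp.
pose d : CC R := rc r.
have dr : modulus d = r by rewrite modulus_rc gtr0_norm.
have sq u : modulus u = r -> square_lim_le phi z u 0.
  move=> ur.
  have inb w : closed_square z u w -> modulus (w - z) <= 2 * r.
    move=> [a [b [a01 b01 ->]]].
    have -> : z + rc a * u + rc b * (ii * u) - z = (rc a + rc b * ii) * u by ring.
    rewrite modulusM ur ler_pM2r//; apply: le_trans (modulusD _ _) _.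
    by rewrite modulusM modulus_ii !modulus_rc !ger0_norm; lra.
  apply: (@goursat_corner _ _ _ B).
  - by rewrite -modulus_gt0 ur.
  - by move=> w /inb; exact: HB.
  - by move=> w /inb; exact: cvp.
have iu u : modulus (ii * u) = modulus u by rewrite modulusM modulus_ii mul1r.
rewrite leNgt; apply/negP => fz.
pose e := (modulus (f z) - 2 * m) / 2.
have e0 : 0 < e by rewrite divr_gt0// subr_gt0.
have [N1 H1] := sq d dr _ e0.
have [|N2 H2] := sq (ii * d) _ _ e0; first by rewrite iu.
have [|N3 H3] := sq (- d) _ _ e0; first by rewrite modulusN.
have [|N4 H4] := sq (- (ii * d)) _ _ e0; first by rewrite modulusN iu.
pose n := (N1 + N2 + N3 + N4)%N; pose M := (2 ^ n)%N.
have {}H1 := H1 n (leq_trans (leq_addr _ _) (leq_trans (leq_addr _ _) (leq_addr _ _))).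
have {}H2 := H2 n (leq_trans (leq_addl _ _) (leq_trans (leq_addr _ _) (leq_addr _ _))).
have {}H3 := H3 n (leq_trans (leq_addl _ _) (leq_addr _ _)).
have {}H4 := H4 n (leq_addl _ _).
have M0 : (0 < M)%N by rewrite expn_gt0.
have split_phi u : modulus u = r -> outer_edges phi z u M =
   outer_edges (fun w => f w / (w - z)) z u M - f z * inv_edges M.
  move=> ur; have u0 : u != 0 by rewrite -modulus_gt0 ur.
  rewrite -(outer_edges_inv z M u0) -mulNr -outer_edges_lin.
  apply: outer_edges_eq => w /andP[wu _].
  have wz : w - z != 0 by rewrite -modulus_gt0 (lt_le_trans _ wu)// ur.
  by apply: (mulIf wz); rewrite -fE; field.
have small u : modulus u = r ->
    modulus (outer_edges (fun w => f w / (w - z)) z u M) <= 2 * m.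
  move=> ur; apply: le_trans (@outer_edges_le (m / r) _ _ _ _ _) _.
    move=> w; rewrite ur => /[dup] wr /andP[rw _].
    rewrite modulusM modulusV ler_pM ?modulus_ge0 ?invr_ge0 ?modulus_ge0 ?fm//.
    by rewrite lef_pV2 ?posrE// (lt_le_trans r0).
  by rewrite ur -mulrA divfK ?gt_eqF.
have := square_sum phi z d M.
rewrite !split_phi ?modulusN ?iu//.
have := small d dr; have := small (ii * d); have := small (- d).
have := small (- (ii * d)); rewrite !modulusN !iu dr.
set a1 := outer_edges _ z d M; set a2 := outer_edges _ z (ii * d) M.
set a3 := outer_edges _ z (- d) M; set a4 := outer_edges _ z (- _) M.
move=> /(_ erefl) h4 /(_ erefl) h3 /(_ erefl) h2 h1.
move: H1 H2 H3 H4; rewrite -/M !add0r.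
set s1 := square _ _ _ _; set s2 := square _ _ _ _.
set s3 := square _ _ _ _; set s4 := square _ _ _ _ => H1 H2 H3 H4 E.
have {}E : 4 * (f z * inv_edges M) = (a1 + a2 + a3 + a4) - (s1 + s2 + s3 + s4).
  by rewrite E; ring.
have := congr1 (@modulus R) E.
rewrite !modulusM -[4]rc_nat modulus_rc normr_nat.
have k1 : 1 <= modulus (inv_edges M).
  by have := cim_inv_edges M0; have := cim_le (inv_edges M); have := ler_norm (cim (inv_edges M)); lra.
have := modulusD (a1 + a2 + a3 + a4) (- (s1 + s2 + s3 + s4)).
have := modulusD (a1 + a2 + a3) a4; have := modulusD (a1 + a2) a3.
have := modulusD a1 a2; have := modulusD (s1 + s2 + s3) s4.
have := modulusD (s1 + s2) s3; have := modulusD s1 s2; rewrite modulusN.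
move: (modulus (a1 + a2 + a3 + a4 - _)) => X.
have : modulus (f z) <= modulus (f z) * modulus (inv_edges M).
  by rewrite ler_peMr ?modulus_ge0.
by rewrite /e in H1 H2 H3 H4 *; lra.
Qed.

End CauchyEstimate.

(** * The maximum modulus principle, also with exceptional points *)

Section MaximumModulus.
Variable R : realType.
Implicit Types (f g : CC R -> CC R) (p z w u : CC R) (m : R) (n : nat).

Lemma expn_lt_ex (q e : R) : 0 <= q < 1 -> 0 < e -> exists n, q ^+ n < e.
Proof.
move=> /andP[q0 q1] e0; have q1' : `|q| < 1 by rewrite ger0_norm.
have [n _ /(_ n (leqnn _))] := cvgr0_norm_lt _ (cvg_expr q1') _ e0.
by rewrite normrX ger0_norm//; exists n.
Qed.

(** Taking n-th roots makes the constants c and C disappear in the limit. *)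
Lemma le_of_expn (a b c C : R) : 0 <= b -> 0 < c -> 0 <= C ->
  (forall n, c * a ^+ n <= C * b ^+ n) -> a <= b.
Proof.
move=> b0 c0 C0 H; rewrite leNgt; apply/negP => ba.
have a0 : 0 < a by exact: le_lt_trans ba.
have q1 : 0 <= b / a < 1 by rewrite divr_ge0 ?(ltW a0)//= ltr_pdivrMr// mul1r.
have C1 : 0 < C + 1 by rewrite ltr_wpDl.
have [n] := expn_lt_ex q1 (divr_gt0 c0 C1).
rewrite expr_div_n ltr_pdivrMr ?exprn_gt0// => h.
have := H n; have an : 0 < a ^+ n by rewrite exprn_gt0.
have bn : 0 <= b ^+ n by rewrite exprn_ge0.
move: h; rewrite mulrAC ltr_pdivlMr//; nra.
Qed.

(* Landau's trick: the constant 2 disappears on applying the estimate to the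
   powers of f. *)
Lemma center_le f z (r m : R) : 0 < r -> 0 <= m ->
  (forall w, modulus (w - z) <= 2 * r -> cdiff f w) ->
  (forall w, r <= modulus (w - z) <= 2 * r -> modulus (f w) <= m) ->
  modulus (f z) <= m.
Proof.
move=> r0 m0 df fm; apply: (@le_of_expn _ _ 1 2) => // n.
rewrite mul1r -modulusX.
apply: (@cauchy_estimate _ (fun w => f w ^+ n) z r) => // w wr.
  by apply: cdiffX; exact: df.
by rewrite modulusX lerXn2r ?nnegrE ?modulus_ge0 ?fm.
Qed.

(* The auxiliary factor 1 + la (w - p) compensates the linear part of
   e |w|^2 - e |p|^2, so that |f|^2 + e |w|^2 being maximal at p makes
   |f(w) (1 + la (w - p))| strictly smaller than |f(p)| on a circle around p. *)
Lemma max_modulus (K Z : set (CC R)) f m : compact K -> 0 <= m ->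
  (forall z, K z -> cont f z) ->
  (forall z, K z -> ~ Z z -> exists2 r : R, 0 < r &
    forall w, modulus (w - z) <= r -> K w /\ cdiff f w) ->
  (forall z, K z -> Z z -> modulus (f z) <= m) ->
  forall z, K z -> modulus (f z) <= m.
Proof.
move=> cK m0 cf df fm z1 Kz1; rewrite leNgt; apply/negP => fz1.
have [b0 b00 Hb0] := cont_bounded cK (fun z _ => @cont_id R z).
pose b := b0 + 1; have b_gt0 : 0 < b by rewrite ltr_wpDl.
have Kb z : K z -> modulus z ^+ 2 <= b ^+ 2.
  move=> /Hb0 zb; rewrite lerXn2r ?nnegrE ?modulus_ge0//; first exact: ltW.
  by rewrite /b; lra.
pose D := modulus (f z1) ^+ 2 - m ^+ 2.
have D0 : 0 < D by rewrite subr_gt0 ltr_pXn2r ?nnegrE ?modulus_ge0.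
(* The perturbation e |z|^2 is at most D / 4 on K, so that a maximum point p of the perturbed
   function still has |f(p)| > m and lies off Z. *)
pose e := D / 4 / b ^+ 2.
have e0 : 0 < e by rewrite !divr_gt0// exprn_gt0.
have eb z : K z -> 0 <= e * modulus z ^+ 2 <= D / 4.
  move=> /Kb zb; rewrite mulr_ge0 ?sqr_ge0 ?(ltW e0)//=.
  by rewrite -[leRHS](@divfK _ (b ^+ 2)) ?gt_eqF ?exprn_gt0// ler_wpM2l// ltW.
pose h w : R := modulus (f w) ^+ 2 + e * modulus w ^+ 2.
have ch z : K z -> {for z, continuous h}.
  move=> Kz; apply: (@continuousD _ _ _ (fun w => modulus (f w) ^+ 2)).
    apply: (@continuous_comp _ _ _ (fun w => modulus (f w)) (fun x : R => x ^+ 2)).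
      exact/cont_modulus/cf.
    exact: exprn_continuous.
  apply: (@continuousM _ _ (fun _ => e)); first exact: cst_continuous.
  apply: (@continuous_comp _ _ _ (@modulus R) (fun x : R => x ^+ 2)).
    exact: modulus_cont.
  exact: exprn_continuous.
have [p Kp Hp] := argmax_on_compact cK (ex_intro _ z1 Kz1) ch.
have hz1 := Hp _ Kz1.
have fp : m ^+ 2 + 3 / 4 * D <= modulus (f p) ^+ 2.
  by have := eb _ Kp; have := eb _ Kz1; move: hz1; rewrite /h /D; lra.
have Zp : ~ Z p.
  move=> /(fm _ Kp) fpm.
  have : modulus (f p) ^+ 2 <= m ^+ 2 by rewrite lerXn2r ?nnegrE ?modulus_ge0.
  by lra.
have [r0 r00 Hr] := df _ Kp Zp.
pose P := modulus (f p) ^+ 2.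
have P0 : 0 < P by rewrite /P; have := sqr_ge0 m; lra.
pose a := e / P; have a0 : 0 < a by rewrite divr_gt0.
pose la : CC R := rc a * cplx (cre p) (- cim p).
pose r := Num.min (r0 / 2) ((a + 1)^-1).
have a1 : 0 < a + 1 by rewrite ltr_wpDl ?ltW.
have r_gt0 : 0 < r by rewrite lt_min divr_gt0//= invr_gt0.
have r_r0 : 2 * r <= r0.
  have : r <= r0 / 2 by rewrite ge_min lexx.
  lra.
have ar : a * r ^+ 2 <= 1.
  have ra : r <= (a + 1)^-1 by rewrite ge_min lexx orbT.
  have : r * (a + 1) <= 1 by rewrite -ler_pdivlMr// mul1r.
  by nra.
(* With x = a r^2 one has (1 - x / 8)^2 >= 1 - x / 4, and 1 - t / 4 with t >= x is the factor that
   remains below. *)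
pose m' := modulus (f p) * (1 - a * r ^+ 2 / 8).
have x0 : 0 < a * r ^+ 2 by rewrite mulr_gt0 ?exprn_gt0.
have fp0 : 0 < modulus (f p).
  by rewrite lt_neqAle modulus_ge0 andbT eq_sym -sqrf_eq0 gt_eqF.
suff : modulus (f p) <= m' by rewrite /m'; nra.
have <- : f p * (1 + la * (p - p)) = f p by rewrite subrr mulr0 addr0 mulr1.
have inK w : modulus (w - p) <= 2 * r -> K w /\ cdiff f w.
  by move=> wr; apply: Hr; lra.
apply: (@center_le (fun w => f w * (1 + la * (w - p))) p r) => //.
- by rewrite /m' mulr_ge0// ?modulus_ge0//; lra.
- move=> w wr; apply: cdiffM; first by case: (inK _ wr).
  apply: cdiffD; first exact: cdiff_cst.
  apply: cdiffM; first exact: cdiff_cst.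
  by apply: cdiffB; [exact: cdiff_id | exact: cdiff_cst].
move=> w /andP[rw wr]; have Kw : K w by case: (inK _ wr).
have {}Hp := Hp _ Kw.
set H := w - p in rw wr *.
have wE : w = p + H by rewrite addrC subrK.
clearbody H.
pose s := 2 * a * (cre p * cre H + cim p * cim H).
pose t := a * modulus H ^+ 2.
have la2 : modulus (1 + la * H) ^+ 2 = 1 + s + (a * modulus p ^+ 2) * t.
  by rewrite /t /la !modulus_sqr !cE /s; ring.
have w2 : modulus w ^+ 2 = modulus p ^+ 2 + 2 * (cre p * cre H + cim p * cim H) + modulus H ^+ 2.
  by rewrite wE !modulus_sqr !cE; ring.
have ePa : e = a * P by rewrite /a divfK// gt_eqF.
have fw2 : modulus (f w) ^+ 2 <= P * (1 - s - t).
  by move: Hp; rewrite /h w2 -/P ePa /s /t; lra.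
have ap : a * modulus p ^+ 2 <= 1 / 2.
  rewrite /a mulrAC ler_pdivrMr//; have /andP[_] := eb _ Kp.
  by have := sqr_ge0 m; rewrite -/P in fp *; lra.
have Hr2 : r ^+ 2 <= modulus H ^+ 2 <= 4 * r ^+ 2.
  have := modulus_ge0 H => ?; apply/andP; split; nra.
have t1 : a * r ^+ 2 <= t <= 4 by rewrite /t; apply/andP; split; nra.
rewrite -(@ler_pXn2r _ 2) ?nnegrE ?modulus_ge0//; last first.
  by rewrite /m' mulr_ge0// ?modulus_ge0//; lra.
rewrite modulusM exprMn la2 /m' exprMn -/P.
have f0 : 0 <= modulus (f w) ^+ 2 by rewrite sqr_ge0.
have st : 0 <= 1 - s - t by rewrite -(pmulr_rge0 _ P0); exact: le_trans fw2.
have st2 : 0 <= 1 + s + (a * modulus p ^+ 2) * t by rewrite -la2 sqr_ge0.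
apply: (@le_trans _ _ (P * (1 - s - t) * (1 + s + a * modulus p ^+ 2 * t))).
  by rewrite ler_wpM2r.
rewrite -mulrA ler_pM2l//.
apply: (@le_trans _ _ ((1 - s - t) * (1 + s + t / 2))).
  by rewrite ler_wpM2l// lerD2l; nra.
(* Completing the square in s leaves t / 4 - t^2 / 16, which is nonnegative because t <= 4. *)
have : (1 - s - t) * (1 + s + t / 2) <= 1 - t / 4.
  have := sqr_ge0 (s + 3 / 4 * t); nra.
move/le_trans; apply; nra.
Qed.

(* At an exceptional point e, (w - e) f(w)^n is differentiable as soon as f is
   continuous; letting n grow removes the factor w - e. *)
Lemma max_modulus_except (E : seq (CC R)) (K Z : set (CC R)) f m :
  compact K -> 0 <= m ->
  (forall z, K z -> cont f z) ->
  (forall z, K z -> ~ Z z -> exists2 r : R, 0 < r &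
    forall w, modulus (w - z) <= r -> K w /\ (w \notin E -> cdiff f w)) ->
  (forall z, K z -> Z z -> modulus (f z) <= m) ->
  forall z, K z -> modulus (f z) <= m.
Proof.
elim: E f m => [|e E IH] f m cK m0 cf df fm.
  apply: (max_modulus cK m0 cf _ fm) => z Kz /(df _ Kz)[r r0 H].
  by exists r => // w /H[Kw dw]; split=> //; exact: dw.
have [b b0 Hb] := cont_bounded cK (fun z _ => @contD R id (fun _ => - e) z
  (@cont_id R z) (@cont_cst R _ z)).
have main z : K z -> z != e -> modulus (f z) <= m.
  move=> Kz ze.
  apply: (@le_of_expn _ _ (modulus (z - e)) b) => //.
    by rewrite modulus_gt0 subr_eq0.
  move=> n; rewrite -modulusX -modulusM.
  apply: (IH (fun w => (w - e) * f w ^+ n)) => //.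
  - by rewrite mulr_ge0// exprn_ge0.
  - move=> w Kw; apply: contM; first exact: contD (@cont_id _ _) (@cont_cst _ _ _).
    elim: n => [|n IHn]; first by under eq_fun do rewrite expr0; exact: cont_cst.
    by under eq_fun do rewrite exprS; apply: contM => //; exact: cf.
  - move=> w Kw /(df _ Kw)[r r0 H]; exists r => // u /H[Ku dfu]; split=> // uE.
    have [ue|ue] := eqVneq u e; last first.
      apply: cdiffM; first by apply: cdiffB; [exact: cdiff_id | exact: cdiff_cst].
      by apply: cdiffX; apply: dfu; rewrite inE negb_or ue.
    exists (fun w => f w ^+ n) => [|v]; last by rewrite ue subrr mul0r subr0 mulrC.
    elim: n => [|n IHn]; first by under eq_fun do rewrite expr0; exact: cont_cst.
    by under eq_fun do rewrite exprS; apply: contM => //; exact: cf.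
  - move=> w Kw Zw; rewrite modulusM modulusX ler_pM ?modulus_ge0 ?exprn_ge0 ?modulus_ge0//.
      exact: Hb.
    by rewrite lerXn2r ?nnegrE ?modulus_ge0// fm.
move=> z Kz; have [ze|] := eqVneq z e; last exact: main.
have [Zz|Zz] := pselect (Z z); first exact: fm.
have [r r0 Hr] := df _ Kz Zz.
rewrite leNgt; apply/negP => mz.
have /contP/(_ (modulus (f z) - m)) [|d d0 Hd] := cf _ Kz; first by rewrite subr_gt0.
pose v := z + rc (Num.min (r / 2) (d / 2)).
have vz : modulus (v - z) = Num.min (r / 2) (d / 2).
  by rewrite addrAC subrr add0r modulus_rc ger0_norm// le_min !divr_ge0 ?ltW.
have m_gt0 : 0 < Num.min (r / 2) (d / 2) by rewrite lt_min !divr_gt0.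
have vr : modulus (v - z) <= r by rewrite vz ge_min; apply/orP; left; lra.
have vd : modulus (v - z) < d by rewrite vz gt_min; apply/orP; right; lra.
have Kv : K v by case: (Hr _ vr).
have ve : v != e by rewrite -ze -subr_eq0 -modulus_gt0 vz.
have := main _ Kv ve; have := Hd _ vd; have := modulus_dist (f v) (f z).
by rewrite ler_norml; lra.
Qed.

End MaximumModulus.

(** * Consequences for entire functions: polynomial growth and an identity theorem *)

Section Growth.
Variable R : realType.
Implicit Types (f g : CC R -> CC R) (p a z w u : CC R) (m r s : R) (n k : nat).

Lemma cont_sub a z : cont (fun w => w - a) z.
Proof. exact: contD (@cont_id _ _) (@cont_cst _ _ _). Qed.
Lemma cdiff_sub a z : cdiff (fun w => w - a) z.
Proof. exact: cdiffB (@cdiff_id _ _) (@cdiff_cst _ _ _). Qed.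

(** The exceptional points serve for slopes (f(w) - f(a)) / (w - a), which are only known to be
    continuous at [a]. *)
Lemma disc_le (E : seq (CC R)) f a r m : 0 <= m ->
  (forall w, modulus (w - a) <= r -> cont f w) ->
  (forall w, modulus (w - a) < r -> w \notin E -> cdiff f w) ->
  (forall w, modulus (w - a) = r -> modulus (f w) <= m) ->
  forall z, modulus (z - a) <= r -> modulus (f z) <= m.
Proof.
move=> m0 cf df fm.
apply: (@max_modulus_except _ E (cball a r) [set w | modulus (w - a) = r]) => //.
- exact: cball_compact.
- move=> z /= zr nzr; have zr' : modulus (z - a) < r by rewrite lt_neqAle zr andbT; apply/eqP.
  exists ((r - modulus (z - a)) / 2) => [|w wz]; first by rewrite divr_gt0// subr_gt0.
  have wr : modulus (w - a) < r by have := modulusBD w a z; lra.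
  by split; [exact: ltW | exact: df].
- by move=> z _; exact: fm.
Qed.

Lemma annulus_le f a r1 r2 m : 0 <= m ->
  (forall w, r1 <= modulus (w - a) <= r2 -> cdiff f w) ->
  (forall w, modulus (w - a) = r1 -> modulus (f w) <= m) ->
  (forall w, modulus (w - a) = r2 -> modulus (f w) <= m) ->
  forall z, r1 <= modulus (z - a) <= r2 -> modulus (f z) <= m.
Proof.
move=> m0 df fm1 fm2.
apply: (@max_modulus _ [set w | r1 <= modulus (w - a) <= r2]
  [set w | modulus (w - a) = r1 \/ modulus (w - a) = r2]) => //.
- have -> : [set w | r1 <= modulus (w - a) <= r2] =
      cball a r2 `&` [set w | r1 <= modulus (w - a)].
    by apply/seteqP; split => w /=; [move/andP => [] | move=> [h1 h2]; apply/andP].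
  apply: compact_closedI; first exact: cball_compact.
  exact: (@closed_superlevel _ (fun w => modulus (w - a)) r1 (@dist_cont _ a)).
- by move=> z zr; exact/cdiff_cont/df.
- move=> z /= /andP[zr1 zr2] /not_orP[n1 n2].
  have zr1' : r1 < modulus (z - a) by rewrite lt_neqAle zr1 andbT eq_sym; apply/eqP.
  have zr2' : modulus (z - a) < r2 by rewrite lt_neqAle zr2 andbT; apply/eqP.
  exists (Num.min ((r2 - modulus (z - a)) / 2) ((modulus (z - a) - r1) / 2)) => [|w].
    by rewrite lt_min !divr_gt0 ?subr_gt0.
  rewrite le_min => /andP[w1 w2].
  have wr : r1 <= modulus (w - a) <= r2.
    have := modulusBD w a z; have := modulusBD z a w; rewrite (modulusB z w).
    by move=> ? ?; apply/andP; split; lra.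
  by split=> //; exact: df.
- by move=> z _ [/fm1|/fm2].
Qed.

Lemma cdiff_slope f a : cdiff f a -> exists phi : CC R -> CC R,
  [/\ cont phi a, forall w, f w - f a = phi w * (w - a),
    forall w, w != a -> cont f w -> cont phi w &
    forall w, w != a -> cdiff f w -> cdiff phi w].
Proof.
move=> [phi cphi fE]; exists phi.
have near_slope w : w != a -> \forall u \near w, (f u - f a) / (u - a) = phi u.
  move=> wa; apply/nbhsCP; exists (modulus (w - a)); first by rewrite modulus_gt0 subr_eq0.
  move=> u uw; rewrite fE mulfK// subr_eq0; apply: contraTneq uw => ->.
  by rewrite modulusB ltxx.
split=> // w wa fw.
  apply: (cont_near (near_slope _ wa)); apply: contM.
    exact: contD (@cont_cst _ _ _).
  by apply: contV; [rewrite subr_eq0 | exact: cont_sub].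
apply: (cdiff_near (near_slope _ wa)); apply: cdiffM.
  exact: cdiffB (@cdiff_cst _ _ _).
by apply: cdiffV; [rewrite subr_eq0 | exact: cdiff_sub].
Qed.

(* Division by w - a at a point a where F is differentiable lowers the growth
   exponent; a may become a new exceptional point. *)
Lemma polynomial_growth k (E : seq (CC R)) (F : CC R -> CC R) (C : R) :
  (forall z, cont F z) -> (forall z, z \notin E -> cdiff F z) ->
  (forall r0 : R, exists2 r, r0 <= r &
     forall z, modulus z = r -> r * modulus (F z) <= C * r ^+ k) ->
  exists p : {poly CC R}, forall z, F z = p.[z].
Proof.
elim: k E F C => [|k IH] E F C cF dF HF.
  (* Exponent 0 means |F| <= C / r on arbitrarily large circles, so F vanishes. *)
  exists 0 => z; rewrite horner0; apply/eqP; rewrite -modulus_eq0 eq_le modulus_ge0 andbT.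
  rewrite leNgt; apply/negP => Fz.
  have [r] := HF (modulus z + 1 + `|C| / modulus (F z)).
  have q0 : 0 <= `|C| / modulus (F z) by rewrite divr_ge0 ?modulus_ge0.
  have z0 := modulus_ge0 z => rr HC.
  have r0 : 0 < r by lra.
  have : modulus (F z) <= `|C| / r.
    apply: (@disc_le E F 0 r); rewrite ?divr_ge0 ?(ltW r0)//.
    - by move=> w _; exact: dF.
    - move=> w; rewrite subr0 ler_pdivlMr// mulrC => /HC; rewrite expr0 mulr1.
      by move/le_trans; apply; exact: ler_norm.
    - by rewrite subr0; lra.
  rewrite ler_pdivlMr// mulrC -ler_pdivlMr//; lra.
have [a aE] : exists a : CC R, a \notin E.
  exists (rc (1 + \sum_(e <- E) modulus e)); apply/negP => aE.
  have := ler_norm (1 + \sum_(e <- E) modulus e); rewrite -modulus_rc.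
  have : modulus (rc (1 + \sum_(e <- E) modulus e)) <= \sum_(e <- E) modulus e.
    rewrite [leRHS](big_rem _ aE)/= lerDl sumr_ge0// => e _; exact: modulus_ge0.
  lra.
have [G [cG FG cG' dG]] := cdiff_slope (dF _ aE).
have [p pE] : exists p : {poly CC R}, forall z, G z = p.[z].
  apply: (IH (a :: E) G (2 * (`|C| + modulus (F a)))).
  - by move=> z; have [->//|za] := eqVneq z a; exact: cG'.
  - by move=> z; rewrite inE negb_or => /andP[za zE]; apply: dG => //; exact: dF.
  move=> r0; have [r] := HF (`|r0| + 2 * modulus a + 1).
  have a0 := modulus_ge0 a; have r0r := ler_norm r0; have r0n := normr_ge0 r0.
  move=> rr HC; exists r => [|z zr]; first by lra.
  have r1 : 1 <= r by lra.
  have rp : 0 < r by lra.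
  have za : r / 2 <= modulus (z - a).
    have := modulusBD z 0 a; rewrite !subr0 zr; lra.
  have Fb : modulus (F z) <= `|C| * r ^+ k.
    have := HC z zr; rewrite exprS mulrCA ler_pM2l// => /le_trans; apply.
    by rewrite ler_wpM2r ?exprn_ge0 ?ler_norm// ltW.
  have Fab : modulus (F a) <= modulus (F a) * r ^+ k.
    by rewrite ler_peMr ?modulus_ge0// exprn_ege1.
  have : modulus (G z) * modulus (z - a) <= (`|C| + modulus (F a)) * r ^+ k.
    rewrite -modulusM -FG; have := modulusD (F z) (- F a); rewrite modulusN; lra.
  have := modulus_ge0 (G z); nra.
exists (p * ('X - a%:P) + (F a)%:P) => z.
by rewrite !hornerE -pE -FG subrK.
Qed.

(** An identity theorem without power series: g(w) / (w - a)^n vanishes on the inner circle of the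
    annulus r <= |w - a| <= 2 |z - a|, so the maximum principle gives |g(z)| <= B / 2^n for all
    n. *)
Lemma vanish_ball g a r : 0 < r -> (forall z, cdiff g z) ->
  (forall z, modulus (z - a) <= r -> g z = 0) -> forall z, g z = 0.
Proof.
move=> r0 dg g0 z; have [/g0//|zr] := leP (modulus (z - a)) r.
have [B B0 HB] : exists2 B : R, 0 <= B & forall w, cball a (2 * modulus (z - a)) w -> modulus (g w) <= B.
  by apply: cont_bounded; [exact: cball_compact | move=> w _; exact: cdiff_cont].
have z0 : 0 < modulus (z - a) by exact: lt_trans zr.
apply/eqP; rewrite -modulus_eq0 eq_le modulus_ge0 andbT leNgt; apply/negP => gz.
have I : 0 <= (1 / 2 : R) < 1 by apply/andP; split; lra.
have B1 : 0 < B + 1 by rewrite ltr_wpDl.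
have [n] := expn_lt_ex I (divr_gt0 gz B1).
apply/negP; rewrite -leNgt ler_pdivrMr//.
apply: (@le_trans _ _ ((1 / 2) ^+ n * B)); last first.
  by rewrite ler_wpM2l ?exprn_ge0//; lra.
suff : modulus (g z / (z - a) ^+ n) <= B / (2 * modulus (z - a)) ^+ n.
  rewrite modulusM modulusV modulusX exprMn invfM mulrA.
  rewrite ler_pM2r ?invr_gt0 ?exprn_gt0// => /le_trans; apply.
  by rewrite div1r exprVn mulrC.
apply: (@annulus_le (fun w => g w / (w - a) ^+ n) a r (2 * modulus (z - a))).
- by rewrite divr_ge0// exprn_ge0// mulr_ge0// ltW.
- move=> w /andP[rw _]; apply: cdiffM => //; apply: cdiffV.
    by rewrite expf_neq0// -modulus_gt0 (lt_le_trans r0).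
  exact/cdiffX/cdiff_sub.
- move=> w wr; rewrite g0 ?wr// mul0r modulus0.
  by rewrite divr_ge0// exprn_ge0// mulr_ge0// ltW.
- move=> w wr; rewrite modulusM modulusV modulusX wr ler_wpM2r//.
    by rewrite invr_ge0 exprn_ge0// mulr_ge0// ltW.
  by apply: HB; rewrite /cball/= wr.
- by rewrite (ltW zr)/=; lra.
Qed.

End Growth.

(** * The maximum modulus function: growth, monotonicity, continuity, three circles *)

Section MaxModulusFunction.
Variables (R : realType) (f : CC R -> CC R).
Hypothesis df : forall z, cdiff f z.
Hypothesis f0 : f 0 = 0.
Hypothesis f_transc : ~ exists p : {poly CC R}, forall z, f z = p.[z].
Implicit Types (p a z w u : CC R) (m r s e : R) (n k : nat).
Local Notation M := (maxmod f).

Lemma maxmodP r : 0 <= r -> (exists2 z, modulus z = r & modulus (f z) = M r) /\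
  forall w, modulus w = r -> modulus (f w) <= M r.
Proof.
move=> r0; pose K := [set z : CC R | modulus z = r].
have cK : compact K.
  apply: (@compact_of_closed_bounded R K r); last by move=> z ->.
  exact: (closed_level (x := r) (@modulus_cont R)).
have [|z Kz|p Kp Hp] := @argmax_on_compact R (fun w => modulus (f w)) K cK.
- by exists (rc r); rewrite /K /mkset modulus_rc ger0_norm.
- exact/cont_modulus/cdiff_cont.
have ME : M r = modulus (f p).
  by apply: setmaxE; [exists p | move=> _ [z Kz <-]; exact: Hp].
by rewrite ME; split => [|w wr]; [exists p | exact: Hp].
Qed.

Lemma maxmod_ge0 r : 0 <= r -> 0 <= M r.
Proof. by move=> /maxmodP[[z _ <-] _]; exact: modulus_ge0. Qed.

Lemma maxmod_disc z r : modulus z <= r -> modulus (f z) <= M r.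
Proof.
move=> zr; have r0 : 0 <= r := le_trans (modulus_ge0 z) zr.
apply: (@disc_le _ [::] f 0 r); rewrite ?subr0 ?maxmod_ge0//.
- by move=> w _; exact: cdiff_cont.
- by move=> w; rewrite subr0; exact: (maxmodP r0).2.
Qed.

Lemma le_maxmod r s : 0 <= r <= s -> M r <= M s.
Proof.
move=> /andP[r0 rs]; have [[z zr <-] _] := maxmodP r0.
by apply: maxmod_disc; rewrite zr.
Qed.

Lemma maxmod0 : M 0 = 0.
Proof.
have [[z + <-] _] := maxmodP (lexx (0 : R)).
by move/eqP; rewrite modulus_eq0 => /eqP ->; rewrite f0 modulus0.
Qed.

(** Transcendence enters here: if M(r) <= C r^k held for arbitrarily large r, then f would be a
    polynomial. *)
Lemma maxmod_growth k (C : R) : exists r0 : R, forall r, r0 <= r -> C * r ^+ k < M r.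
Proof.
apply: contrapT => H; apply: f_transc.
apply: (@polynomial_growth _ k.+1 [::] f C) => // [z|r0]; first exact: cdiff_cont.
apply: contrapT => H2; apply: H; exists (Num.max r0 0) => r.
rewrite ge_max => /andP[r0r rp]; rewrite ltNge; apply/negP => HM; apply: H2.
exists r => // z zr; rewrite exprS mulrCA ler_wpM2l//.
exact: le_trans ((maxmodP rp).2 _ zr) HM.
Qed.

Lemma maxmod_gt0 r : 0 < r -> 0 < M r.
Proof.
move=> r0; rewrite lt_neqAle maxmod_ge0 ?(ltW r0)// andbT eq_sym.
apply/negP => /eqP Mr; apply: f_transc; exists 0 => z; rewrite horner0.
apply: (vanish_ball r0 df (a := 0)) => w; rewrite subr0 => wr; apply/eqP.
by rewrite -modulus_eq0 eq_le modulus_ge0 -Mr maxmod_disc.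
Qed.

(** The Schwarz lemma: f(w) / w extends continuously to 0 because f(0) = 0, so M(r) / r is
    nondecreasing. Strict monotonicity of M follows. *)
Lemma maxmod_slope r s : 0 < r <= s -> M r * s <= M s * r.
Proof.
move=> /andP[r0 rs]; have s0 : 0 < s := lt_le_trans r0 rs.
have [G [cG FG cG' dG]] := cdiff_slope (df 0).
have {}FG w : f w = G w * w by have := FG w; rewrite f0 !subr0.
have [[z zr <-] _] := maxmodP (ltW r0).
rewrite FG modulusM zr mulrAC ler_pM2r// -ler_pdivlMr//.
apply: (@disc_le _ [:: 0] G 0 s); rewrite ?subr0 ?zr//.
- by rewrite divr_ge0 ?maxmod_ge0 ?ltW.
- by move=> w _; have [->//|w0] := eqVneq w 0; apply: cG' => //; exact: cdiff_cont.
- by move=> w _; rewrite inE => w0; exact: dG.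
move=> w; rewrite subr0 => ws; rewrite ler_pdivlMr// -[X in _ * X <= _]ws -modulusM -FG.
exact: (maxmodP (ltW s0)).2.
Qed.

Lemma lt_maxmod r s : 0 <= r < s -> M r < M s.
Proof.
move=> /andP[]; rewrite le_eqVlt => /orP[/eqP <-|r0 rs]; first by rewrite maxmod0; exact: maxmod_gt0.
have := maxmod_slope (r := r) (s := s); rewrite r0 ltW// => /(_ isT).
by have := maxmod_gt0 r0; nra.
Qed.

Lemma maxmod_cont r e : 0 <= r -> 0 < e -> exists2 D : R, 0 < D &
  forall s, 0 <= s -> `|s - r| < D -> `|M s - M r| < e.
Proof.
move=> r0 e0.
have [D D0 HD] := @uniform_cont _ f (cball 0 (r + 1)) e (@cball_compact _ _ _) (fun z _ => cdiff_cont (df z)) e0.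
exists (Num.min D 1) => [|s s0]; first by rewrite lt_min D0 ltr01.
rewrite lt_min => /andP[sD s1].
(* A point of the circle of radius b is moved radially to the circle of radius a; for b = 0 there is
   no direction, and any point will do. *)
have half (a b : R) : 0 <= a <= r + 1 -> 0 <= b -> `|b - a| < D -> M b < M a + e.
  move=> /andP[a0 a1] b0 baD; have [[z zb <-] _] := maxmodP b0.
  have [w wa wz] : exists2 w : CC R, modulus w = a & modulus (z - w) < D.
    have [bz|bnz] := eqVneq b 0.
      exists (rc a); first by rewrite modulus_rc ger0_norm.
      move/eqP: zb; rewrite bz modulus_eq0 => /eqP ->; rewrite sub0r modulusN modulus_rc.
      by rewrite ger0_norm//; move: baD; rewrite bz sub0r normrN ger0_norm.
    exists (rc (a / b) * z).
      by rewrite modulusM modulus_rc zb ger0_norm ?divr_ge0// divfK.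
    have -> : z - rc (a / b) * z = rc (1 - a / b) * z by rewrite rcD rcN rc1; ring.
    rewrite modulusM modulus_rc zb -{2}(ger0_norm b0) -normrM mulrBl mul1r divfK//.
  have := HD w z; rewrite /cball/= subr0 wa => /(_ a1 wz) fd.
  have := modulus_dist (f z) (f w); have := maxmod_disc (z := w) (r := a).
  by rewrite wa lexx => /(_ isT); rewrite ler_norml; lra.
have h1 : M s < M r + e by apply: half => //; rewrite r0 lerDl ler01.
have h2 : M r < M s + e.
  apply: half => //; last by rewrite distrC.
  by rewrite s0/=; move: s1; rewrite ltr_norml; lra.
by rewrite ltr_norml; lra.
Qed.

(* Hadamard's three circles theorem on 2 <= |z| <= s, applied to f^q / z^p for a
   rational exponent p / q slightly above ln (M r) / ln r. *)
Lemma maxmod_log_convex : exists2 r1 : R, 1 < r1 & forall r s, r1 <= r <= s ->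
  1 < M r /\ ln (M r) * ln s <= ln (M s) * ln r.
Proof.
have M2 : 0 < M 2 by exact: maxmod_gt0.
have ln2 : 0 < ln (2 : R) by rewrite ln_gt0// ltr1n.
(* k exceeds ln M(2) / ln 2, and r is taken so large that M(r) > r^k. This forces the slope c of ln
   M between ln 2 and ln r to exceed b = ln M(r) / ln r. *)
pose k := Num.bound `|ln (M 2) / ln 2|.
have kM : ln (M 2) < k%:R * ln 2.
  rewrite -ltr_pdivrMr//; apply: le_lt_trans (ler_norm _) _.
  exact: archi_boundP (normr_ge0 _).
have [r0 Hr0] := maxmod_growth k 1.
have [r0' Hr0'] := maxmod_growth 0 1.
exists (Num.max (Num.max r0 r0') 3) => [|r s]; first by rewrite lt_max ltr1n orbT.
rewrite !ge_max => /andP[/andP[/andP[/Hr0 hk /Hr0' h1] r3] rs].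
rewrite expr0 mulr1 in h1; rewrite mul1r in hk; split=> //.
have r_gt0 : 0 < r by exact: lt_le_trans r3.
have s_gt0 : 0 < s by exact: lt_le_trans rs.
have lr : 0 < ln r by rewrite ln_gt0// (lt_le_trans _ r3)// ltr1n.
have lr2 : ln 2 < ln r by rewrite ltr_ln ?posrE// (lt_le_trans _ r3)// ltr_nat.
have Mr0 : 0 < M r by exact: maxmod_gt0.
have Ms0 : 0 < M s by exact: maxmod_gt0.
have hk' : k%:R * ln r < ln (M r).
  by rewrite mulr_natl -lnXn// ltr_ln ?posrE ?exprn_gt0.
rewrite leNgt; apply/negP => hs.
clear hk; clearbody k.
have rs' : r < s.
  by rewrite lt_neqAle rs andbT; apply/negP => /eqP E; rewrite E ltxx in hs.
have lrs : ln r < ln s by rewrite ltr_ln ?posrE.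
pose b := ln (M r) / ln r.
have bE : b * ln r = ln (M r) by rewrite divfK// gt_eqF.
have b0 : 0 < b by rewrite divr_gt0// ln_gt0.
have bk : k%:R < b by rewrite ltr_pdivlMr.
pose c := (ln (M r) - ln (M 2)) / (ln r - ln 2).
have cE : c * (ln r - ln 2) = ln (M r) - ln (M 2).
  by rewrite divfK// gt_eqF// subr_gt0.
have bc : b < c.
  rewrite ltr_pdivlMr ?subr_gt0// mulrBr bE.
  have : k%:R * ln 2 < b * ln 2 by rewrite ltr_pM2r.
  lra.
(* A denominator with 1 / q < c - b leaves room for b < p / q < c. By p / q < c the function M(x)^q
   / x^p is larger at r than at 2; by p / q > b it is larger at r than at s, should the claim
   fail. *)
pose q := (Num.bound `|(c - b)^-1|).
have q0 : 0 < (c - b)^-1 by rewrite invr_gt0 subr_gt0.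
have qc : (c - b)^-1 < q%:R.
  by apply: le_lt_trans (ler_norm _) _; exact: archi_boundP (normr_ge0 _).
have q1 : 1 < q%:R * (c - b).
  by move: qc; rewrite -[X in X < _]mul1r ltr_pdivrMr ?subr_gt0.
have qR0 : 0 < q%:R :> R by exact: lt_trans qc.
pose p := (Num.truncn (b * q%:R)).+1.
have bq : 0 <= b * q%:R by apply/ltW/mulr_gt0.
have /andP[p1 p2] : (p.-1)%:R <= b * q%:R < p%:R by exact: truncn_itv.
clearbody q.
have pc : p%:R < c * q%:R by move: p1; rewrite /p /= -natr1; lra.
clearbody p.
pose m := Num.max (M 2 ^+ q / 2 ^+ p) (M s ^+ q / s ^+ p).
have m1 : M 2 ^+ q / 2 ^+ p <= m by rewrite le_max lexx.
have m2 : M s ^+ q / s ^+ p <= m by rewrite le_max lexx orbT.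
have m0 : 0 <= m by apply: le_trans m1; rewrite divr_ge0// exprn_ge0// ltW.
have bound (x : R) w : 0 < x -> modulus w = x ->
    modulus (f w ^+ q / w ^+ p) <= M x ^+ q / x ^+ p.
  move=> x0 wx; rewrite modulusM modulusV !modulusX wx ler_wpM2r//.
    by rewrite invr_ge0 exprn_ge0// ltW.
  by rewrite lerXn2r ?nnegrE ?modulus_ge0 ?maxmod_ge0 ?(ltW x0)// maxmod_disc// wx.
have Hm : M r ^+ q / r ^+ p <= m.
  have [[z zr fz] _] := maxmodP (ltW r_gt0).
  have -> : M r ^+ q / r ^+ p = modulus (f z ^+ q / z ^+ p).
    by rewrite modulusM modulusV !modulusX zr fz.
  apply: (@annulus_le _ (fun z => f z ^+ q / z ^+ p) 0 2 s) => //.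
  - move=> w; rewrite subr0 => /andP[w2 _]; apply: cdiffM; first exact: cdiffX.
    apply: cdiffV; last exact: cdiffX (@cdiff_id _ _).
    by rewrite expf_neq0// -modulus_gt0 (lt_le_trans _ w2).
  - by move=> w; rewrite subr0 => w2; apply: le_trans m1; exact: bound.
  - by move=> w; rewrite subr0 => ws; apply: le_trans m2; exact: bound.
  - by rewrite subr0 zr rs andbT (le_trans _ r3)// ler_nat.
have lnq (x y : R) : 0 < x -> 0 < y -> ln (x ^+ q / y ^+ p) = q%:R * ln x - p%:R * ln y.
  move=> x0 y0; rewrite ln_div ?posrE ?exprn_gt0// !lnXn//.
  by rewrite !mulr_natl.
have pos (x y : R) : 0 < x -> 0 < y -> 0 < x ^+ q / y ^+ p.
  by move=> x0 y0; rewrite divr_gt0 ?exprn_gt0.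
move: Hm; rewrite le_max => /orP[|].
  rewrite -ler_ln ?posrE ?pos// !lnq//.
  have : p%:R * (ln r - ln 2) < c * q%:R * (ln r - ln 2) by rewrite ltr_pM2r ?subr_gt0.
  by rewrite mulrAC cE; lra.
rewrite -ler_ln ?posrE ?pos// !lnq// => h.
have : b * q%:R * (ln s - ln r) < p%:R * (ln s - ln r) by rewrite ltr_pM2r ?subr_gt0.
have hs' : q%:R * ln (M s) < q%:R * (b * ln s).
  by rewrite ltr_pM2l// /b mulrAC ltr_pdivlMr.
by move: h hs'; rewrite -bE; lra.
Qed.

End MaxModulusFunction.

(** * Iteration of M, the escape threshold, and upper semicontinuity of R_A *)

Section FastEscaping.
Variables (R : realType) (f : CC R -> CC R).
Hypothesis df : forall z, cdiff f z.
Hypothesis f0 : f 0 = 0.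
Hypothesis f_transc : ~ exists p : {poly CC R}, forall z, f z = p.[z].
Implicit Types (p a z w u : CC R) (r s e : R) (n k m l : nat).
Local Notation M := (maxmod f).
Local Notation Mn n := (iter n (maxmod f)).
Local Notation fn n := (iter n f).

Lemma cdiff_iter n z : cdiff (fn n) z.
Proof. by elim: n => [|n IH] //=; [exact: cdiff_id | exact: cdiff_comp]. Qed.

Lemma iter_maxmod_ge0 n r : 0 <= r -> 0 <= Mn n r.
Proof. by move=> r0; elim: n => //= n IH; exact: maxmod_ge0. Qed.

Lemma le_iter_maxmod n r s : 0 <= r <= s -> Mn n r <= Mn n s.
Proof.
move=> /[dup] rs /andP[r0 _]; elim: n => [|n IH] /=; first by case/andP: rs.
by apply: le_maxmod => //; rewrite iter_maxmod_ge0.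
Qed.

Lemma lt_iter_maxmod n r s : 0 <= r < s -> Mn n r < Mn n s.
Proof.
move=> /[dup] rs /andP[r0 _]; elim: n => [|n IH] /=; first by case/andP: rs.
by apply: lt_maxmod => //; rewrite iter_maxmod_ge0.
Qed.

Lemma iter_maxmod_cont n r e : 0 <= r -> 0 < e -> exists2 D : R, 0 < D &
  forall s, 0 <= s -> `|s - r| < D -> `|Mn n s - Mn n r| < e.
Proof.
move=> r0; elim: n e => [|n IH] e e0; first by exists e.
have [D D0 HD] := maxmod_cont df (iter_maxmod_ge0 n r0) e0.
have [D' D'0 HD'] := IH D D0.
by exists D' => // s s0 sr /=; apply: HD; [exact: iter_maxmod_ge0 | exact: HD'].
Qed.

Lemma orbit_le n k z r : modulus (fn n z) <= r -> modulus (fn (k + n) z) <= Mn k r.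
Proof.
move=> h; elim: k => //= k IH; exact: maxmod_disc.
Qed.

(** Falling strictly below M^n(r) is irreversible, since |f(w)| <= M(|w|) and M is strictly
    increasing. *)
Lemma orbit_lt n k z r : modulus (fn n z) < Mn n r -> 0 <= r ->
  modulus (fn (k + n) z) < Mn (k + n) r.
Proof.
move=> h r0; rewrite [X in _ < X]iterD; apply: le_lt_trans (orbit_le k (lexx _)) _.
by apply: lt_iter_maxmod; rewrite modulus_ge0.
Qed.

(** rho is the supremum of the radii with M(r) <= r, a set that contains 0 and is bounded by
    superlinear growth. Continuity of M excludes both M(rho) > rho and M(rho) < rho. *)
Lemma maxmod_last_fixed : exists rho : R, [/\ 0 <= rho, M rho = rho &
  forall r, rho < r -> r < M r].
Proof.
have [r1 Hr1] := maxmod_growth df f_transc 1 1.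
pose A := [set r : R | 0 <= r /\ M r <= r].
have A0 : A 0 by split=> //; rewrite maxmod0.
have Aub : ubound A (Num.max r1 0).
  move=> r [r0 Mr]; rewrite le_max; apply/orP; left; rewrite leNgt; apply/negP => r1r.
  by have := Hr1 r (ltW r1r); rewrite mul1r expr1 ltNge Mr.
have As : has_sup A by split; [exists 0 | exists (Num.max r1 0)].
pose rho := sup A; have rho0 : 0 <= rho by exact: (sup_upper_bound As A0).
have above r : rho < r -> r < M r.
  move=> rr; rewrite ltNge; apply/negP => Mr.
  suff : r <= rho by rewrite leNgt rr.
  by apply: (sup_upper_bound As _); split=> //; rewrite (le_trans rho0) ?ltW.
exists rho; split=> //; apply/eqP; rewrite eq_le; apply/andP; split.
  rewrite leNgt; apply/negP => h.
  have e0 : 0 < (M rho - rho) by rewrite subr_gt0.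
  have [D D0 HD] := maxmod_cont df rho0 e0.
  have [r [r0 Mr] hr] := sup_adherent D0 As.
  have rrho : r <= rho by apply: (sup_upper_bound As _).
  have := HD r r0; rewrite ler0_norm ?subr_le0// opprB => /(_ _).
  have -> : rho - r < D by rewrite ltrBlDr -ltrBlDl; exact: hr.
  by move=> /(_ isT); rewrite ltr_norml; lra.
rewrite leNgt; apply/negP => h.
have e0 : 0 < (rho - M rho) by rewrite subr_gt0.
have [D D0 HD] := maxmod_cont df rho0 e0.
have h2 : rho < rho + D / 2 by rewrite ltrDl divr_gt0.
have := above _ h2; have := HD (rho + D / 2).
rewrite addrAC subrr add0r ger0_norm ?divr_ge0 ?(ltW D0)//.
have -> : 0 <= rho + D / 2 by rewrite (le_trans rho0)// ltW.
move=> /(_ isT); have -> : D / 2 < D by lra.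
by move=> /(_ isT); rewrite ltr_norml; lra.
Qed.

(** Above rho the orbit increases. Were it bounded with supremum L, then M(L) > L and continuity
    would carry some iterate beyond L. *)
Lemma maxmod_iter_inftyP rho r : 0 <= rho -> M rho = rho ->
  (forall r, rho < r -> r < M r) -> 0 <= r ->
  maxmod_iter_infty f r <-> rho < r.
Proof.
move=> rho0 Mrho above r0; split.
  move=> /cvgryPge/(_ (rho + 1)) [n _ /(_ n (leqnn _)) /= h].
  rewrite ltNge; apply/negP => rr.
  have := @le_iter_maxmod n r rho; rewrite r0 rr => /(_ isT).
  have -> : Mn n rho = rho by elim: {h} n => //= n ->.
  by move: h; rewrite /=; lra.
move=> rr; apply/cvgryPge => A; apply: contrapT => nA.
have abv n : rho < Mn n r by elim: n => //= n IH; apply: lt_trans IH (above _ IH).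
have inc n m : (n <= m)%N -> Mn n r <= Mn m r.
  move=> /subnK <-; elim: (m - n)%N => // k; rewrite addSn iterS => /le_trans; apply.
  exact/ltW/above.
have bd n : Mn n r <= A.
  rewrite leNgt; apply/negP => nA'; apply: nA; exists n => // m /= nm.
  by apply: le_trans (inc _ _ nm); exact: ltW.
pose S := range (fun n => Mn n r).
have Ss : has_sup S by split; [exists r, 0%N | exists A => _ [n _ <-]].
pose L := sup S; have SL n : Mn n r <= L by apply: (sup_upper_bound Ss _); exists n.
have rL : rho < L by apply: lt_le_trans (SL 0%N).
have L0 : 0 <= L by apply: le_trans rho0 (ltW rL).
have e0 : 0 < M L - L by rewrite subr_gt0 above.
have [D D0 HD] := maxmod_cont df L0 e0.
have [_ [n _ <-] hn] := sup_adherent D0 Ss.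
have := HD (Mn n r) (iter_maxmod_ge0 n r0).
rewrite ler0_norm ?subr_le0// opprB => /(_ _).
have -> : L - Mn n r < D by rewrite ltrBlDr -ltrBlDl; exact: hn.
by move=> /(_ isT); have := SL n.+1; rewrite /= ltr_norml; lra.
Qed.

Local Notation rho := (escape_threshold f).

(** The maximum defining [escape_threshold] exists and is the last fixed point of M, so the
    unspecified value of [setmax] does not occur. *)
Lemma escape_thresholdP : [/\ 0 <= rho, M rho = rho &
  forall r, rho < r -> r < M r].
Proof.
have [x [x0 Mx above]] := maxmod_last_fixed.
suff -> : rho = x by [].
apply: setmaxE.
  by split=> // /(maxmod_iter_inftyP x0 Mx above x0); rewrite ltxx.
move=> r [r0 H]; rewrite leNgt; apply/negP => xr; apply: H.
exact/(maxmod_iter_inftyP x0 Mx above r0).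
Qed.

Lemma escape_threshold_ge0 : 0 <= rho. Proof. by case: escape_thresholdP. Qed.
Lemma maxmod_gt_id r : rho < r -> r < M r.
Proof. by case: escape_thresholdP => _ _; exact. Qed.
Lemma iter_maxmod_threshold n : Mn n rho = rho.
Proof. by case: escape_thresholdP => _ h _; elim: n => //= n ->. Qed.
Lemma iter_infty_gt r : 0 <= r -> maxmod_iter_infty f r <-> rho < r.
Proof. by case: escape_thresholdP => *; exact: maxmod_iter_inftyP. Qed.

Lemma gt_threshold_ge0 r : rho < r -> 0 <= r.
Proof. by move=> h; exact: le_trans escape_threshold_ge0 (ltW h). Qed.

Lemma iter_maxmod_gt r n : rho < r -> rho < Mn n r.
Proof. by move=> rr; elim: n => //= n IH; apply: lt_trans IH (maxmod_gt_id IH). Qed.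

Lemma iter_maxmod_inc r n m : rho < r -> (n <= m)%N -> Mn n r <= Mn m r.
Proof.
move=> rr /subnK <-; elim: (m - n)%N => // k; rewrite addSn iterS => /le_trans; apply.
exact/ltW/maxmod_gt_id/iter_maxmod_gt.
Qed.

Lemma iter_maxmod_unbounded r (A : R) : rho < r ->
  exists N, forall n, (N <= n)%N -> A <= Mn n r.
Proof.
move=> rr; have /cvgryPge/(_ A)[N _ H] := (iter_infty_gt (gt_threshold_ge0 rr)).2 rr.
by exists N.
Qed.

(** The orbit condition of A_r(f) alone; the restriction on r is carried separately as [rho < r]. *)
Definition dominates r z := forall n, (1 <= n)%N -> Mn n r <= modulus (fn n z).

Lemma fast_escaping_atP r z : fast_escaping_at f r z <-> rho < r /\ dominates r z.
Proof.
split=> [[r0 /(iter_infty_gt (ltW r0)) rr H]//|[rr H]].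
split=> //; first exact: le_lt_trans escape_threshold_ge0 rr.
by apply/iter_infty_gt => //; exact: gt_threshold_ge0.
Qed.

(** M^l is continuous and fixes rho. The lemma trades a shift of the iteration index for a smaller
    radius. *)
Lemma small_preimage l r : rho < r -> exists2 r', rho < r' & Mn l r' <= r.
Proof.
move=> rr; have e0 : 0 < r - rho by rewrite subr_gt0.
have [D D0 HD] := iter_maxmod_cont l escape_threshold_ge0 e0.
exists (rho + D / 2) => [|]; first by rewrite ltrDl divr_gt0.
have := HD (rho + D / 2).
rewrite addrAC subrr add0r ger0_norm ?divr_ge0 ?(ltW D0)//.
have -> : 0 <= rho + D / 2 by rewrite addr_ge0 ?escape_threshold_ge0// divr_ge0// ltW.
move=> /(_ isT); have -> : D / 2 < D by lra.
by rewrite iter_maxmod_threshold => /(_ isT); rewrite ltr_norml; lra.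
Qed.

(* If the orbit of z dominates that of r at one late time, it does so at all
   earlier times. *)
Lemma dominates_late r z : 0 <= r -> (forall N, exists2 n, (N <= n)%N &
  Mn n r <= modulus (fn n z)) -> dominates r z.
Proof.
move=> r0 H n _; rewrite leNgt; apply/negP => h.
have [m nm] := H n; rewrite leNgt => /negP; apply.
by rewrite -(subnK nm); exact: orbit_lt.
Qed.

(** The shift l is absorbed into the radius: if M^l(r') <= r, then M^(n+l)(r') <= M^n(r) <=
    |f^(n+l)(z)| for all n >= 1, and domination at late times suffices. *)
Lemma fast_escapingP z : fast_escaping f z <-> exists2 r, rho < r & dominates r z.
Proof.
split=> [[r [r0 /(iter_infty_gt (ltW r0)) rr] [l _ H]]|[r rr H]].
  have [r' rr' lr'] := small_preimage l rr.
  exists r' => //; apply: dominates_late; first exact: gt_threshold_ge0.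
  move=> N; exists (N.+1 + l)%N; first by rewrite (leq_trans _ (leq_addr _ _)).
  apply: le_trans (H N.+1 isT); rewrite iterD; apply: le_iter_maxmod.
  by rewrite iter_maxmod_ge0//; exact: gt_threshold_ge0.
exists r; first split.
- exact: le_lt_trans escape_threshold_ge0 rr.
- by apply/iter_infty_gt => //; exact: gt_threshold_ge0.
- exists 1%N => // n n1; rewrite addn1; apply: le_trans (H n.+1 isT).
  exact: iter_maxmod_inc.
Qed.

(** The admissible radii are bounded by |f(z)|, since r < M(r) <= |f(z)|. Their supremum is
    admissible because each condition M^n(r) <= |f^n(z)| is closed in r by continuity of M^n. *)
Lemma RA_max z : fast_escaping f z -> [/\ rho < RA f z, dominates (RA f z) z &
  forall r, rho < r -> dominates r z -> r <= RA f z].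
Proof.
move=> Az; have RAE : RA f z = setmax [set r | fast_escaping_at f r z].
  by rewrite /RA; case: asboolP.
have [r1 r1r r1z] := (fast_escapingP z).1 Az.
pose S := [set r | fast_escaping_at f r z].
have Sr1 : S r1 by apply/fast_escaping_atP.
have Sub : ubound S (modulus (f z)).
  move=> r /fast_escaping_atP[rr /(_ 1%N isT) /=]; apply: le_trans.
  exact/ltW/maxmod_gt_id.
have Ss : has_sup S by split; [exists r1 | exists (modulus (f z))].
pose s := sup S.
have sr : rho < s by apply: lt_le_trans r1r _; exact: (sup_upper_bound Ss _).
have s0 := gt_threshold_ge0 sr.
have Sub' : ubound S s by move=> r Sr; exact: (sup_upper_bound Ss _).
have Sz : S s.
  apply/fast_escaping_atP; split=> // n n1; rewrite leNgt; apply/negP => h.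
  have e0 : 0 < Mn n s - modulus (fn n z) by rewrite subr_gt0.
  have [D D0 HD] := iter_maxmod_cont n s0 e0.
  have [r Sr hr] := sup_adherent D0 Ss.
  have /fast_escaping_atP[rr /(_ n n1) rz] := Sr.
  have := HD r (gt_threshold_ge0 rr).
  rewrite ler0_norm ?subr_le0 ?Sub'// opprB => /(_ _).
  have -> : s - r < D by rewrite ltrBlDr -ltrBlDl; exact: hr.
  by move=> /(_ isT); rewrite ltr_norml; lra.
have -> : RA f z = s by rewrite RAE; exact: setmaxE.
have /fast_escaping_atP[_ Hs] := Sz.
by split=> // r rr rz; apply: Sub'; apply/fast_escaping_atP.
Qed.

Lemma RA_not_fast z : ~ fast_escaping f z -> RA f z = rho.
Proof. by rewrite /RA; case: asboolP. Qed.

Lemma RA_ge_threshold z : rho <= RA f z.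
Proof.
have [/RA_max[/ltW]//|/RA_not_fast ->] := pselect (fast_escaping f z); exact: lexx.
Qed.

Lemma RA_geP r z : rho < r -> r <= RA f z <-> dominates r z.
Proof.
move=> rr; split=> [rz|rz].
  have Az : fast_escaping f z.
    by apply: contrapT => /RA_not_fast E; move: rz; rewrite E leNgt rr.
  have [_ H _] := RA_max Az => n n1; apply: le_trans (H n n1).
  by apply: le_iter_maxmod; rewrite rz andbT; exact: gt_threshold_ge0.
have Az : fast_escaping f z by apply/fast_escapingP; exists r.
by have [_ _] := RA_max Az; exact.
Qed.

Lemma fast_escaping_RA z : fast_escaping f z <-> rho < RA f z.
Proof.
split=> [/RA_max[]//|h]; apply: contrapT => /RA_not_fast E.
by rewrite E ltxx in h.
Qed.

Lemma RA_usc : upper_semicontinuous (RA f).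
Proof.
move=> x a xa; have ra : rho < a by exact: le_lt_trans (RA_ge_threshold x) xa.
have : ~ dominates a x by move=> /(RA_geP x ra); rewrite leNgt xa.
move=> /existsNP[n /not_implyP[n1 /negP]]; rewrite -ltNge => h.
have /contP/(_ (Mn n a - modulus (fn n x))) [|d d0 Hd] := cdiff_cont (cdiff_iter n x).
  by rewrite subr_gt0.
apply/nbhsCP; exists d => // y /Hd yd; rewrite ltNge; apply/negP.
move=> /(RA_geP y ra)/(_ n n1); apply/negP; rewrite -ltNge.
by have := modulus_dist (fn n y) (fn n x); rewrite ler_norml; lra.
Qed.

End FastEscaping.

(** * The complex exponential and the principal logarithm *)

Section Exponential.
Variable R : realType.
Implicit Types (a z w h : CC R) (x y r s e : R).

Definition expC z : CC R := rc (expR (cre z)) * cplx (cos (cim z)) (sin (cim z)).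

Lemma expCD z w : expC (z + w) = expC z * expC w.
Proof.
rewrite /expC creD cimD expRD cosD sinD rcM.
by apply: cplx_inj; rewrite !cE; ring.
Qed.
Lemma expC0 : expC 0 = 1.
Proof. by rewrite /expC cre0 cim0 expR0 cos0 sin0; apply: cplx_inj; rewrite !cE; ring. Qed.
Lemma modulus_expC z : modulus (expC z) = expR (cre z).
Proof.
rewrite modulusM modulus_rc gtr0_norm ?expR_gt0// modulusE cre_cplx cim_cplx.
by rewrite cos2Dsin2 sqrtr1 mulr1.
Qed.
Lemma expC_neq0 z : expC z != 0.
Proof. by rewrite -modulus_gt0 modulus_expC expR_gt0. Qed.
Lemma expCB z w : expC (z - w) = expC z / expC w.
Proof. by apply: (mulIf (expC_neq0 w)); rewrite divfK ?expC_neq0// -expCD subrK. Qed.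

Lemma derive_at0 (g : R -> R) (l : R) e : is_derive (0 : R) (1 : R) g l -> 0 < e ->
  exists2 d : R, 0 < d & forall x, `|x| < d -> `|g x - g 0 - l * x| <= e * `|x|.
Proof.
move=> [dg gl] e0.
have /cvgr_dist_lt/(_ e e0) : h^-1 *: (g (h *: (1 : R) + 0) - g 0) @[h --> (0 : R)^'] --> l.
  by rewrite -gl; exact: dg.
move=> /nbhs_ballP[d d0 H]; exists d => // x xd.
have [->|x0] := eqVneq x 0; first by rewrite subrr mulr0 subr0 normr0 mulr0.
have := H x; rewrite /ball /= sub0r normrN => /(_ xd x0).
rewrite addr0 [x *: _]mulr1 => /ltW.
have -> : l - x^-1 *: (g x - g 0) = - ((g x - g 0 - l * x) / x).
  by rewrite [_ *: _]mulrC; field.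
by rewrite normrN normf_div ler_pdivrMr ?normr_gt0.
Qed.

Lemma expC_at0 e : 0 < e -> exists2 d : R, 0 < d &
  forall h, modulus h < d -> modulus (expC h - 1 - h) <= e * modulus h.
Proof.
(* The real part of the remainder costs 3 q and the imaginary part 5 q, whence the division by 8. *)
move=> e0; pose q := Num.min (e / 8) 1.
have q0 : 0 < q by rewrite lt_min divr_gt0//= ltr01.
have qe : q <= e / 8 by rewrite ge_min lexx.
have q1 : q <= 1 by rewrite ge_min lexx orbT.
clearbody q.
have [d1 d10 H1] := derive_at0 (is_derive_expR 0) q0.
have [d2 d20 H2] := derive_at0 (is_derive_cos 0) q0.
have [d3 d30 H3] := derive_at0 (is_derive_sin 0) q0.
exists (Num.min (Num.min d1 d2) (Num.min d3 q)) => [|h].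
  by rewrite !lt_min d10 d20 d30 q0.
rewrite !lt_min => /andP[/andP[hd1 hd2] /andP[hd3 hq]].
set x := cre h; set y := cim h.
have xh : `|x| <= modulus h := cre_le h.
have yh : `|y| <= modulus h := cim_le h.
have := H1 x (le_lt_trans xh hd1); have := H2 y (le_lt_trans yh hd2).
have := H3 y (le_lt_trans yh hd3).
rewrite expR0 cos0 sin0 oppr0 mul0r !mul1r subr0 addr0 => hs hc he.
have cy : `|cos y| <= 1 by exact: cos_max.
set m := modulus h in xh yh hd1 hd2 hd3 hq *.
have m0 : 0 <= m := modulus_ge0 h.
have re : `|cre (expC h - 1 - h)| <= 3 * q * m.
  have -> : cre (expC h - 1 - h) = (expR x - 1 - x) * cos y + (1 + x) * (cos y - 1).
    by rewrite /expC !cE -/x -/y; ring.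
  apply: le_trans (ler_normD _ _) _; rewrite !normrM.
  have h1 : `|1 + x| <= 2 by apply: le_trans (ler_normD _ _) _; rewrite normr1; lra.
  have h2 : `|expR x - 1 - x| * `|cos y| <= q * m.
    apply: le_trans (ler_pM (normr_ge0 _) (normr_ge0 _) he cy) _.
    by rewrite mulr1 ler_wpM2l// ltW.
  have h3 : `|1 + x| * `|cos y - 1| <= 2 * (q * m).
    apply: ler_pM (normr_ge0 _) (normr_ge0 _) h1 _.
    by apply: le_trans hc _; rewrite ler_wpM2l// ltW.
  lra.
have im : `|cim (expC h - 1 - h)| <= 5 * q * m.
  have -> : cim (expC h - 1 - h) = (expR x - 1 - x) * sin y + x * sin y + (sin y - y).
    by rewrite /expC !cE -/x -/y; ring.
  have sy : `|sin y| <= 1 by exact: sin_max.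
  have sy2 : `|sin y| <= 2 * m.
    rewrite -[sin y](subrK y); apply: le_trans (ler_normD _ _) _; nra.
  apply: le_trans (ler_normD _ _) _.
  have h1 : `|sin y - y| <= q * m by apply: le_trans hs _; rewrite ler_wpM2l// ltW.
  have h2 : `|expR x - 1 - x| * `|sin y| <= q * m.
    apply: le_trans (ler_pM (normr_ge0 _) (normr_ge0 _) he sy) _.
    by rewrite mulr1 ler_wpM2l// ltW.
  have h3 : `|x| * `|sin y| <= q * (2 * m).
    by apply: ler_pM => //; exact: le_trans xh (ltW hq).
  have := ler_normD ((expR x - 1 - x) * sin y) (x * sin y).
  have qm : 0 <= q * m by rewrite mulr_ge0// ltW.
  rewrite !normrM; lra.
apply: le_trans (modulus_le _) _.
have : q * m <= e / 8 * m by rewrite ler_wpM2r.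
lra.
Qed.

Lemma cont_slope (f phi : CC R -> CC R) z : cont phi z ->
  (\forall w \near z, f w - f z = phi w * (w - z)) -> cdiff f z.
Proof.
move=> cphi fE; apply: (@cdiff_near _ (fun w => f z + phi w * (w - z))).
  by apply: filterS fE => w <-; rewrite addrC subrK.
exists phi => // w; rewrite subrr mulr0 addr0; ring.
Qed.

Lemma expC_slope z : exists2 phi : CC R -> CC R, cont phi z /\ phi z = expC z &
  forall w, expC w - expC z = phi w * (w - z).
Proof.
pose psi h : CC R := if h == 0 then 1 else (expC h - 1) / h.
exists (fun w => expC z * psi (w - z)); last first.
  move=> w; rewrite /psi subr_eq0; have [->|wz] := eqVneq w z.
    by rewrite !subrr !mulr0.
  have -> : expC w = expC z * expC (w - z) by rewrite -expCD addrC subrK.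
  by rewrite -[RHS]mulrA divfK ?subr_eq0//; ring.
split; last by rewrite subrr /psi eqxx mulr1.
apply: contM; first exact: cont_cst.
apply: (@cont_comp _ (fun w => w - z) psi); first exact: cont_sub.
rewrite subrr; apply/contP => e e0.
have e2 : 0 < e / 2 by rewrite divr_gt0.
have [d d0 Hd] := expC_at0 e2; exists d => // h; rewrite subr0 => hd.
rewrite /psi eqxx; case: eqVneq => [_|h0]; first by rewrite subrr modulus0.
have -> : (expC h - 1) / h - 1 = (expC h - 1 - h) / h by field.
rewrite modulusM modulusV; apply: (@le_lt_trans _ _ (e / 2)); last lra.
by rewrite ler_pdivrMr ?modulus_gt0//; exact: Hd.
Qed.

Lemma cont_cplx (f : CC R -> CC R) z :
  {for z, continuous (fun w => cre (f w))} -> {for z, continuous (fun w => cim (f w))} ->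
  cont f z.
Proof.
move=> /contrP cr /contrP ci; apply/contP => e e0.
have e2 : 0 < e / 2 by rewrite divr_gt0.
have [d1 d10 H1] := cr _ e2; have [d2 d20 H2] := ci _ e2.
exists (Num.min d1 d2) => [|w]; first by rewrite lt_min d10.
rewrite lt_min => /andP[/H1 h1 /H2 h2]; apply: le_lt_trans (modulus_le _) _.
rewrite !cE; lra.
Qed.

(** The principal branch, a logarithm on the right half plane only. *)
Definition logC z : CC R := cplx (ln (modulus z)) (atan (cim z / cre z)).

Lemma logC1 : logC 1 = 0.
Proof.
by apply: cplx_inj; rewrite /logC !cE ?modulus1 ?ln1// mul0r atan0.
Qed.

Lemma expC_logC z : 0 < cre z -> expC (logC z) = z.
Proof.
move=> z0; have zn : z != 0 by apply: contraTneq z0 => ->; rewrite cre0 ltxx.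
rewrite /expC /logC cre_cplx cim_cplx lnK ?posrE ?modulus_gt0//.
have sinE : sin (atan (cim z / cre z)) = cim z / cre z * cos (atan (cim z / cre z)).
  rewrite -{2}[cim z / cre z]atanK /tan divfK// cos_atan invr_eq0 gt_eqF//.
  by rewrite sqrtr_gt0 ltr_wpDr ?sqr_ge0.
rewrite sinE cos_atan.
have -> : modulus z = cre z * Num.sqrt (1 + (cim z / cre z) ^+ 2).
  rewrite modulusE -{2}(ger0_norm (ltW z0)) -sqrtr_sqr -sqrtrM ?sqr_ge0//.
  by congr Num.sqrt; field; rewrite gt_eqF.
have : 0 < Num.sqrt (1 + (cim z / cre z) ^+ 2).
  by rewrite sqrtr_gt0 ltr_wpDr ?sqr_ge0.
set q := Num.sqrt _ => q0.
by apply: cplx_inj; rewrite !cE; field; rewrite ?gt_eqF.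
Qed.

Lemma cont_logC z : 0 < cre z -> cont logC z.
Proof.
move=> z0; have zn : z != 0 by apply: contraTneq z0 => ->; rewrite cre0 ltxx.
apply: cont_cplx.
  apply: (@continuous_comp _ _ _ (@modulus R) (@ln R)); first exact: modulus_cont.
  by apply: continuous_ln; rewrite modulus_gt0.
apply: (@continuous_comp _ _ _ (fun w : CC R => cim w / cre w) (@atan R)).
  apply: (@continuousM _ _ (@cim R) (fun w => (cre w)^-1)); first exact: cim_cont.
  apply: (@continuousV _ _ (@cre R)); [by rewrite gt_eqF | exact: cre_cont].
exact: continuous_atan.
Qed.

(** Differentiation of an inverse: the slope of [logC] is the reciprocal of the slope of [expC]
    taken at [logC], and at the base point the latter is a value of [expC], hence nonzero. *)
Lemma cdiff_logC z : 0 < cre z -> cdiff logC z.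
Proof.
move=> z0; have [phi [cphi phiz] phiE] := expC_slope (logC z).
have cpl : cont (fun w => phi (logC w)) z by exact: cont_comp (cont_logC z0) cphi.
have nz : phi (logC z) != 0 by rewrite phiz expC_neq0.
apply: (@cont_slope _ (fun w => (phi (logC w))^-1)); first exact: contV.
have near_re : \forall w \near z, 0 < cre w.
  have /contrP/(_ (cre z) z0)[d d0 Hd] := @cre_cont R z.
  by apply/nbhsCP; exists d => // w /Hd; rewrite ltr_norml; lra.
have near_nz : \forall w \near z, phi (logC w) != 0.
  have /contP/(_ (modulus (phi (logC z)))) [|d d0 Hd] := cpl; first by rewrite modulus_gt0.
  apply/nbhsCP; exists d => // w /Hd; apply: contraTneq => ->.
  by rewrite sub0r modulusN ltxx.
apply: filterS2 near_re near_nz => w w0 wn.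
apply: (mulfI wn); rewrite mulrA divff// mul1r -phiE.
by rewrite !expC_logC.
Qed.

Lemma cre_gt0_near1 z : modulus (z - 1) < 1 -> 0 < cre z.
Proof.
move=> h; have := cre_le (z - 1); rewrite !cE => h2.
by have := le_lt_trans h2 h; rewrite ltr_norml; lra.
Qed.

End Exponential.

(** * Logarithms on compact star-shaped sets *)

Section Logarithm.
Variable R : realType.
Implicit Types (g : CC R -> CC R) (K : set (CC R)) (a b z w : CC R) (r t e : R).

(* The logarithm is the telescoping sum of principal logarithms of the ratios of
   g at consecutive points of a fine subdivision of the segment from a to w. *)
Lemma star_log K a g : compact K -> K a ->
  (forall w t, K w -> 0 <= t <= 1 -> K (a + rc t * (w - a))) ->
  (forall w, K w -> cont g w) -> (forall w, K w -> g w != 0) ->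
  exists L : CC R -> CC R, [/\ L a = 0, forall w, K w -> expC (L w) = g w / g a,
    forall w, K w -> cont L w &
    (forall w, K w -> cdiff g w) -> forall w, K w -> cdiff L w].
Proof.
move=> cK Ka sK cg g0.
have [B B0 HB] := cont_bounded cK (fun w Kw => contV (g0 w Kw) (cg w Kw)).
have B1 : 0 < (B + 1)^-1 by rewrite invr_gt0 ltr_wpDl.
have gB w : K w -> (B + 1)^-1 < modulus (g w).
  move=> Kw; have := HB _ Kw; rewrite modulusV => h.
  have gw : 0 < modulus (g w) by rewrite modulus_gt0 g0.
  have B2 : 0 < B + 1 by rewrite ltr_wpDl.
  rewrite -[modulus (g w)]invrK ltf_pV2 ?posrE ?invr_gt0//.
  by apply: le_lt_trans h _; rewrite ltrDl.
(* Steps shorter than D change g by less than its least modulus, so consecutive ratios stay within 1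
   of 1, where [logC] is a logarithm. *)
have [D D0 HD] := uniform_cont cK cg B1.
have [B' B'0 HB'] := cont_bounded cK (fun w _ => @cont_sub R a w).
pose N := (Num.bound `|B' / D|).+1.
have ND : B' < D * N%:R.
  rewrite -ltr_pdivrMl// mulrC; apply: le_lt_trans (ler_norm _) _.
  apply: lt_trans (archi_boundP (normr_ge0 _)) _; by rewrite ltr_nat.
have N0 : N%:R != 0 :> R by rewrite pnatr_eq0.
pose nd k w : CC R := a + rc (k%:R / N%:R) * (w - a).
have nK k w : (k <= N)%N -> K w -> K (nd k w).
  by move=> kN Kw; apply: sK => //; rewrite divr_ge0//= ler_pdivrMr ?mul1r ?ler_nat ?ltr0n.
pose q k w := g (nd k.+1 w) / g (nd k w).
have q1 k w : (k < N)%N -> K w -> 0 < cre (q k w).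
  move=> kN Kw; apply: cre_gt0_near1.
  have gk : g (nd k w) != 0 by apply/g0/nK => //; exact: ltnW.
  have -> : q k w - 1 = (g (nd k.+1 w) - g (nd k w)) / g (nd k w) by rewrite /q; field.
  rewrite modulusM modulusV ltr_pdivrMr ?modulus_gt0// mul1r.
  apply: lt_trans (gB _ (nK _ _ (ltnW kN) Kw)).
  apply: HD; first exact: nK (ltnW kN) Kw.
  have -> : nd k.+1 w - nd k w = rc N%:R^-1 * (w - a).
    rewrite /nd -natr1 mulrDl rcD mul1r; ring.
  rewrite modulusM modulus_rc ger0_norm ?invr_ge0// mulrC ltr_pdivrMr ?ltr0n//.
  by apply: le_lt_trans ND; exact: HB'.
pose L k w : CC R := \sum_(0 <= j < k) logC (q j w).
have nd_cdiff k w : cdiff (nd k) w.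
  apply: cdiffD; first exact: cdiff_cst.
  by apply: cdiffM; [exact: cdiff_cst | exact: cdiff_sub].
have nd0 w : nd 0%N w = a by rewrite /nd mul0r rc0 mul0r addr0.
have ndN w : nd N w = w by rewrite /nd divff// rc1 mul1r addrC subrK.
exists (L N); split.
- rewrite /L big1_seq// => j /andP[_]; rewrite mem_index_iota => /andP[_ jN].
  by rewrite /q /nd subrr !mulr0 !addr0 divff ?g0// logC1.
- move=> w Kw; rewrite -{2}[w]ndN; elim: {-2}N (leqnn N) => [|k IH] kN.
    by rewrite /L big_geq// expC0 nd0 divff// g0.
  rewrite /L big_nat_recr//= expCD IH ?(ltnW kN)// expC_logC ?q1//.
  by rewrite /q; field; rewrite !g0//; exact: nK (ltnW kN) Kw.
- move=> w Kw; elim: {-2}N (leqnn N) => [|k IH] kN.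
    by rewrite /L; under eq_fun do rewrite big_geq//; exact: cont_cst.
  rewrite /L; under eq_fun do rewrite big_nat_recr//=.
  apply: contD; first exact: IH (ltnW kN).
  apply: (@cont_comp _ (q k)); last exact/cont_logC/q1.
  apply: contM.
    by apply: cont_comp (cdiff_cont (nd_cdiff _ _)) _; exact/cg/nK.
  apply: contV; first by apply/g0/nK => //; exact: ltnW.
  by apply: cont_comp (cdiff_cont (nd_cdiff _ _)) _; apply/cg/nK => //; exact: ltnW.
- move=> dg w Kw; elim: {-2}N (leqnn N) => [|k IH] kN.
    by rewrite /L; under eq_fun do rewrite big_geq//; exact: cdiff_cst.
  rewrite /L; under eq_fun do rewrite big_nat_recr//=.
  apply: cdiffD; first exact: IH (ltnW kN).
  apply: (@cdiff_comp _ (q k)); last exact/cdiff_logC/q1.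
  apply: cdiffM.
    by apply: cdiff_comp (nd_cdiff _ _) _; exact/dg/nK.
  apply: cdiffV; first by apply/g0/nK => //; exact: ltnW.
  by apply: cdiff_comp (nd_cdiff _ _) _; apply/dg/nK => //; exact: ltnW.
Qed.

End Logarithm.

(** * Harnack's inequality and the open mapping theorem *)

Section Harnack.
Variable R : realType.
Implicit Types (g L : CC R -> CC R) (a b z w u v : CC R) (r t e : R).

Lemma star_cball a r : 0 <= r -> cball a r a /\
  forall w t, cball a r w -> 0 <= t <= 1 -> cball a r (a + rc t * (w - a)).
Proof.
move=> r0; rewrite /cball /mkset; split=> [|w t wr /andP[t0 t1]].
  by rewrite subrr modulus0.
rewrite addrAC subrr add0r modulusM modulus_rc ger0_norm//.
by apply: le_trans wr; rewrite ler_piMl ?modulus_ge0.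
Qed.

(* The Schwarz lemma for (L - L(a)) / (L + conj L(a)), which maps the half plane
   Re > 0 into the unit disc. *)
Lemma schwarz_half_plane L a r t b : 0 < r ->
  (forall w, cball a r w -> cdiff L w) ->
  (forall w, cball a r w -> 0 < cre (L w)) ->
  0 <= t -> modulus (b - a) <= t * r -> t <= 1 ->
  modulus (L b - L a) <= t * modulus (L b + cplx (cre (L a)) (- cim (L a))).
Proof.
move=> r0 dL L0 t0 bt t1; set cj := cplx _ _.
have aK : cball a r a by case: (star_cball a (ltW r0)).
have bK : cball a r b.
  by rewrite /cball /mkset (le_trans bt)// ler_piMl// ltW.
have den w : cball a r w -> L w + cj != 0.
  move=> wK; apply/eqP => /(congr1 (@cre R)); rewrite /cj !cE.
  by have := L0 _ wK; have := L0 _ aK; lra.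
pose h w := (L w - L a) / (L w + cj).
have dh w : cball a r w -> cdiff h w.
  move=> wK; apply: cdiffM; first exact: cdiffB (dL _ wK) (@cdiff_cst _ _ _).
  apply: cdiffV; first exact: den.
  exact: cdiffD (dL _ wK) (@cdiff_cst _ _ _).
have h1 w : cball a r w -> modulus (h w) <= 1.
  move=> wK; rewrite modulusM modulusV ler_pdivrMr ?modulus_gt0 ?den// mul1r.
  rewrite -(@ler_pXn2r _ 2) ?nnegrE ?modulus_ge0// !modulus_sqr /cj !cE.
  by have := L0 _ wK; have := L0 _ aK; nra.
have [G [cG hG cG' dG]] := cdiff_slope (dh _ aK).
have ha : h a = 0 by rewrite /h subrr mul0r.
have Gb : modulus (G b) <= r^-1.
  apply: (@disc_le _ [:: a] G a r) => //.
  - by rewrite invr_ge0 ltW.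
  - move=> w wK; have [->//|wa] := eqVneq w a.
    by apply: cG' => //; exact/cdiff_cont/dh.
  - by move=> w wr; rewrite inE => wa; apply: dG => //; apply: dh; exact: ltW.
  - move=> w wr; have wK : cball a r w by rewrite /cball /mkset wr.
    rewrite -[leRHS]mul1r ler_pdivlMr// -{1}wr -modulusM -hG ha subr0; exact: h1.
have hb : modulus (h b) <= t.
  rewrite -[h b]subr0 -ha hG modulusM.
  apply: le_trans (ler_pM (modulus_ge0 _) (modulus_ge0 _) Gb bt) _.
  by rewrite mulrC mulfK ?gt_eqF.
move: hb; rewrite /h modulusM modulusV ler_pdivrMr//.
by rewrite modulus_gt0 den.
Qed.

(** Both estimates come from the Schwarz bound. For the first, the imaginary parts enter both sides
    through the same difference and may be dropped because t < 1; for the second, |L(b) + conj L(a)|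
    <= |L(b) - L(a)| + 2 Re L(a). *)
Lemma harnack_half_plane L a r t b : 0 < r ->
  (forall w, cball a r w -> cdiff L w) ->
  (forall w, cball a r w -> 0 < cre (L w)) ->
  0 <= t -> modulus (b - a) <= t * r -> t < 1 ->
  (1 - t) * cre (L a) <= (1 + t) * cre (L b) /\
  (1 - t) * modulus (L b - L a) <= 2 * t * cre (L a).
Proof.
move=> r0 dL L0 t0 bt t1.
have aK : cball a r a by case: (star_cball a (ltW r0)).
have bK : cball a r b.
  by rewrite /cball /mkset (le_trans bt)// ler_piMl// ltW.
have La := L0 _ aK; have Lb := L0 _ bK.
have := schwarz_half_plane r0 dL L0 t0 bt (ltW t1).
set cj := cplx _ _ => H; split.
  have : modulus (L b - L a) ^+ 2 <= t ^+ 2 * modulus (L b + cj) ^+ 2.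
    by rewrite -exprMn lerXn2r ?nnegrE ?mulr_ge0 ?modulus_ge0.
  rewrite !modulus_sqr /cj !cE.
  set x := cre (L a) in La *; set x' := cre (L b) in Lb *.
  set y := cim (L a); set y' := cim (L b) => H2.
  have H3 : (x' - x) ^+ 2 <= (t * (x' + x)) ^+ 2.
    have : t ^+ 2 * (y' - y) ^+ 2 <= (y' - y) ^+ 2.
      by rewrite ler_piMl ?sqr_ge0// expr_le1// ltW.
    by rewrite exprMn; lra.
  have : `|x' - x| <= `|t * (x' + x)| by rewrite -ler_sqr ?nnegrE// !real_normK ?num_real.
  rewrite [X in _ <= X]ger0_norm; last by rewrite mulr_ge0// ltW// addr_gt0.
  by rewrite ler_norml; lra.
have : modulus (L b + cj) <= modulus (L b - L a) + 2 * cre (L a).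
  have -> : L b + cj = (L b - L a) + rc (2 * cre (L a)).
    by apply: cplx_inj; rewrite /cj !cE; ring.
  apply: le_trans (modulusD _ _) _; rewrite modulus_rc ger0_norm//.
  by rewrite mulr_ge0// ltW.
by move=> h; have := ler_wpM2l t0 h; lra.
Qed.

(** The half plane estimate for a logarithm of g normalised to have real part ln |g|. *)
Lemma harnack g a r t b : 0 < r ->
  (forall w, cball a r w -> cdiff g w) ->
  (forall w, cball a r w -> 1 < modulus (g w)) ->
  0 <= t -> modulus (b - a) <= t * r -> t < 1 ->
  (1 - t) * ln (modulus (g a)) <= (1 + t) * ln (modulus (g b)).
Proof.
move=> r0 dg g1 t0 bt t1.
have [aK sK] := star_cball a (ltW r0).
have bK : cball a r b.
  by rewrite /cball /mkset (le_trans bt)// ler_piMl// ltW.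
have g0 w : cball a r w -> g w != 0.
  by move=> /g1 h; rewrite -modulus_gt0; lra.
have [L [La LE _ dL]] := star_log (@cball_compact _ a r) aK sK
  (fun w wK => cdiff_cont (dg w wK)) g0.
pose L1 w := L w + rc (ln (modulus (g a))).
have reL1 w : cball a r w -> cre (L1 w) = ln (modulus (g w)).
  move=> wK; rewrite /L1 !cE -[cre (L w)]expRK -modulus_expC LE//.
  rewrite modulusM modulusV ln_div ?posrE ?modulus_gt0 ?g0//.
  by rewrite subrK.
rewrite -(reL1 _ aK) -(reL1 _ bK).
apply: (harnack_half_plane r0 _ _ t0 bt t1).1 => w wK.
  exact: cdiffD (dL dg _ wK) (@cdiff_cst _ _ _).
by rewrite reL1// ln_gt0// g1.
Qed.

(** At t = 1 / 2 the factor (1 + t) / (1 - t) is 3. *)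
Lemma harnack_cube g a r b : 0 < r ->
  (forall w, cball a r w -> cdiff g w) ->
  (forall w, cball a r w -> 1 < modulus (g w)) ->
  modulus (b - a) <= r / 2 -> modulus (g a) <= modulus (g b) ^+ 3.
Proof.
move=> r0 dg g1 br.
have := @harnack g a r (1 / 2) b r0 dg g1.
have -> : 1 / 2 * r = r / 2 by ring.
have h0 : 0 <= 1 / 2 :> R by rewrite divr_ge0.
have h1 : 1 / 2 < 1 :> R by lra.
move=> /(_ h0 br h1) h.
have [aK _] := star_cball a (ltW r0).
have ga := g1 _ aK.
have bK : cball a r b by rewrite /cball /mkset (le_trans br)//; lra.
have gb := g1 _ bK.
have ga0 : 0 < modulus (g a) by lra.
have gb0 : 0 < modulus (g b) by lra.
rewrite -ler_ln ?posrE ?exprn_gt0// lnXn// -mulr_natr; lra.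
Qed.

(** [harnack_cube] for C / g, whose modulus exceeds 1: a function without zeros that is small at the
    centre is small nearby. *)
Lemma harnack_small g a r b (C : R) : 0 < r ->
  (forall w, cball a r w -> cdiff g w) ->
  (forall w, cball a r w -> g w != 0) ->
  (forall w, cball a r w -> modulus (g w) < C) ->
  modulus (b - a) <= r / 2 -> modulus (g b) ^+ 3 <= C ^+ 2 * modulus (g a).
Proof.
move=> r0 dg g0 gC br.
have [aK _] := star_cball a (ltW r0).
have bK : cball a r b by rewrite /cball /mkset (le_trans br)//; lra.
have C0 : 0 < C by apply: le_lt_trans (gC _ aK); exact: modulus_ge0.
have mE w : modulus (rc C / g w) = C / modulus (g w).
  by rewrite modulusM modulusV modulus_rc gtr0_norm.
have := @harnack_cube (fun w => rc C / g w) a r b r0.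
rewrite !mE; have ga : 0 < modulus (g a) by rewrite modulus_gt0 g0.
have gb : 0 < modulus (g b) by rewrite modulus_gt0 g0.
move=> H; have {}H : C / modulus (g a) <= (C / modulus (g b)) ^+ 3.
  apply: H => // w wK.
    by apply: cdiffM; [exact: cdiff_cst | apply: cdiffV; [exact: g0 | exact: dg]].
  by rewrite mE ltr_pdivlMr ?modulus_gt0 ?g0// mul1r gC.
move: H; rewrite expr_div_n ler_pdivlMr ?exprn_gt0// mulrAC ler_pdivrMr//.
by rewrite exprS -mulrA ler_pM2l.
Qed.

(* If g omits values v close to g(u) on a ball around u, then g - v is small
   around u by Harnack's inequality, and g is constant. *)
Lemma open_mapping g u r : (forall z, cdiff g z) -> ~ (forall z, g z = g u) ->
  0 < r -> exists2 e : R, 0 < e & forall v, modulus (v - g u) < e ->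
    exists2 w, modulus (w - u) <= r & g w = v.
Proof.
move=> dg ncst r0; apply: contrapT => H; apply: ncst => z; apply/eqP.
rewrite -subr_eq0; apply/eqP; move: z.
have r2 : 0 < r / 2 by rewrite divr_gt0.
apply: (@vanish_ball R (fun z => g z - g u) u (r / 2) r2).
  by move=> z; exact: cdiffB (dg z) (@cdiff_cst _ _ _).
move=> w wr; apply/eqP; rewrite -modulus_eq0 eq_le modulus_ge0 andbT leNgt.
apply/negP => d0; set d := modulus _ in d0.
have [B B0 HB] := @cont_bounded R (fun z => g z - g u) _ (@cball_compact R u r)
  (fun z _ => cdiff_cont (cdiffB (dg z) (@cdiff_cst _ _ _))).
pose C := B + 2.
have C0 : 0 < C by rewrite /C; lra.
(* The first bound keeps |g - v| below C on the ball, the second keeps |g(w) - v| above d / 2, and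
   the third then contradicts |g(w) - v|^3 <= C^2 |v - g(u)|. *)
pose e := Num.min (Num.min 1 (d / 2)) ((d / 2) ^+ 3 / C ^+ 2).
have e0 : 0 < e by rewrite !lt_min ltr01 !divr_gt0 ?exprn_gt0// divr_gt0.
apply: H; exists e => // v ve; apply: contrapT => nv.
have [ve1 [ve2 ve3]] : modulus (v - g u) < 1 /\ modulus (v - g u) < d / 2 /\
    modulus (v - g u) < (d / 2) ^+ 3 / C ^+ 2.
  by move: ve; rewrite /e !lt_min => /andP[/andP[]].
have gv y : cball u r y -> g y - v != 0.
  by move=> yK; rewrite subr_eq0; apply/eqP => E; apply: nv; exists y.
have := @harnack_small (fun z => g z - v) u r w C r0.
have -> : g u - v = - (v - g u) by rewrite opprB.
rewrite modulusN => H.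
have {}H : modulus (g w - v) ^+ 3 <= C ^+ 2 * modulus (v - g u).
  apply: H => // y yK; first exact: cdiffB (dg y) (@cdiff_cst _ _ _).
  have := HB _ yK; have := modulusBD (g y) v (g u); rewrite (modulusB (g u)) /C; lra.
have dv : d / 2 <= modulus (g w - v).
  by have := modulusBD (g w) (g u) v; rewrite /d in ve2 *; lra.
have : (d / 2) ^+ 3 <= modulus (g w - v) ^+ 3.
  by rewrite lerXn2r ?nnegrE ?modulus_ge0// divr_ge0// ltW.
rewrite leNgt; apply/negP; rewrite -leNgt.
move: ve3; rewrite ltr_pdivlMr ?exprn_gt0// mulrC => h.
by exfalso; move: (le_lt_trans H h); apply/negP; rewrite -leNgt lerXn2r ?nnegrE ?modulus_ge0// divr_ge0// ltW.
Qed.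

End Harnack.

(** * Normal families of iterates in the chordal metric *)

Section Normality.
Variable R : realType.
Implicit Types (f g : CC R -> CC R) (a b z w u v : CC R) (r d e : R) (n k N : nat).

Definition dist_infty (p : option (CC R)) : R := chordal p None.

Lemma sqrt1D_gt0 (x : R) : 0 < Num.sqrt (1 + x ^+ 2).
Proof. by rewrite sqrtr_gt0 ltr_wpDr ?sqr_ge0. Qed.

Lemma sqrt1D_lip (x y t : R) : 0 <= y -> 0 <= t -> 0 <= x <= y + t ->
  Num.sqrt (1 + x ^+ 2) <= Num.sqrt (1 + y ^+ 2) + t.
Proof.
move=> y0 t0 /andP[x0 xyt].
have s0 := sqrt1D_gt0 y.
have ys : y <= Num.sqrt (1 + y ^+ 2).
  by rewrite -{1}(ger0_norm y0) -sqrtr_sqr ler_wsqrtr// lerDr.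
rewrite -(@ler_pXn2r _ 2) ?nnegrE ?sqrtr_ge0 ?addr_ge0 ?sqrtr_ge0//.
rewrite sqrrD !sqr_sqrtr ?addr_ge0 ?sqr_ge0//; nra.
Qed.

(** Of the triangle inequality only the case with infinity as a vertex is needed; after clearing
    denominators it says that sqrt(1 + x^2) is 1-Lipschitz in x. *)
Lemma dist_infty_tri a (p : option (CC R)) :
  dist_infty p <= dist_infty (Some a) + chordal (Some a) p /\
  dist_infty (Some a) <= dist_infty p + chordal (Some a) p.
Proof.
have A0 := sqrt1D_gt0 (modulus a).
case: p => [b|]; last first.
  rewrite /dist_infty /=; split; last by rewrite add0r.
  by rewrite addr_ge0// divr_ge0// ltW.
rewrite /dist_infty /=; have B0 := sqrt1D_gt0 (modulus b).
set sa := Num.sqrt (1 + modulus a ^+ 2) in A0 *.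
set sb := Num.sqrt (1 + modulus b ^+ 2) in B0 *.
have key (x y t : R) : 0 < x -> 0 < y -> x <= y + t -> 2 / y <= 2 / x + 2 * t / (x * y).
  move=> x0 y0 h; rewrite -subr_ge0.
  have -> : 2 / x + 2 * t / (x * y) - 2 / y = 2 * (y + t - x) / (x * y).
    by field; rewrite !gt_eqF.
  by rewrite divr_ge0 ?mulr_ge0 ?subr_ge0// ltW.
split.
  apply: key => //; apply: sqrt1D_lip; rewrite ?modulus_ge0//=.
  by have := modulusBD a 0 b; rewrite !subr0; lra.
rewrite [sa * sb]mulrC; apply: key => //.
apply: sqrt1D_lip; rewrite ?modulus_ge0//=.
by have := modulusBD b 0 a; rewrite !subr0 modulusB; lra.
Qed.

Lemma dist_infty_le a (K : R) : 0 < K -> K <= modulus a -> dist_infty (Some a) <= 2 / K.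
Proof.
move=> K0 Ka; rewrite /dist_infty /= ler_pM2l// lef_pV2 ?posrE ?sqrt1D_gt0//.
apply: le_trans Ka _; rewrite -{1}(ger0_norm (modulus_ge0 a)) -sqrtr_sqr.
by rewrite ler_wsqrtr// lerDr.
Qed.

Lemma dist_infty_large a (K : R) : 0 < K -> dist_infty (Some a) <= 2 / (K + 1) -> K <= modulus a.
Proof.
move=> K0; rewrite /dist_infty /= ler_pM2l// lef_pV2 ?posrE ?sqrt1D_gt0//; last lra.
move=> h; have := @sqrt1D_lip (modulus a) 0 (modulus a).
rewrite lexx modulus_ge0 add0r lexx => /(_ isT isT isT).
by rewrite expr0n addr0 sqrtr1; lra.
Qed.

(** For a sequence of iterates f^(k_n): either one iterate recurs and gives a constant subsequence,
    or k_n tends to infinity and the asymptotics of f^n apply. *)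
Lemma subsequence_dichotomy (k : nat -> nat) :
  (exists v : nat, exists2 phi : nat -> nat, {homo phi : m n / (m < n)%N} &
     forall n, k (phi n) = v) \/
  forall B, exists N, forall n, (N <= n)%N -> (B <= k n)%N.
Proof.
have [[v Hv]|H] := pselect (exists v : nat, forall N, exists n, (N <= n)%N /\ k n = v).
  left; exists v.
  have pick N : {n | (N <= n)%N /\ k n = v} by exact/cid/Hv.
  pose fix phi n := if n is n'.+1 then sval (pick (phi n').+1) else sval (pick 0%N).
  exists phi; last by case=> [|n] /=; case: (pick _) => m [].
  by apply: homo_ltn => [? ? ?|n /=]; [exact: ltn_trans | case: (pick _) => m []].
right; elim=> [|B [N HN]]; first by exists 0%N.
have [N' HN'] : exists N', forall n, (N' <= n)%N -> k n <> B.
  apply: contrapT => H2; apply: H; exists B => N'; apply: contrapT => H3.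
  by apply: H2; exists N' => n nN' kn; apply: H3; exists n.
exists (N + N')%N => n nN; rewrite ltn_neqAle HN ?andbT; last first.
  exact: leq_trans (leq_addr _ _) nN.
by apply/eqP => /esym; apply: HN'; exact: leq_trans (leq_addl _ _) nN.
Qed.

Lemma chordal_xx a : chordal (Some a) (Some a) = 0.
Proof. by rewrite /= subrr modulus0 mulr0 mul0r. Qed.

Lemma open_ball a d : open [set w : CC R | modulus (w - a) < d].
Proof.
rewrite openE => w /= wd; apply/nbhsCP; exists (d - modulus (w - a)).
  by rewrite subr_gt0.
by move=> u uw /=; have := modulusBD u a w; lra.
Qed.

Lemma iteratesP f (s : nat -> CC R -> CC R) : (forall n, iterates f (s n)) ->
  exists k : nat -> nat, forall n, (1 <= k n)%N /\ s n = iter (k n) f.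
Proof.
move=> H; have K n : {k | (1 <= k)%N /\ s n = iter k f}.
  by apply: cid; have [k k1 <-] := H n; exists k.
by exists (fun n => sval (K n)) => n; case: (K n).
Qed.

Lemma escape_fatou f z d : 0 < d ->
  (forall A : R, exists N, forall n w, (N <= n)%N -> modulus (w - z) < d ->
     A <= modulus (iter n f w)) ->
  fatou_set f z.
Proof.
move=> d0 H; exists [set w | modulus (w - z) < d].
  by split; [exact: open_ball | rewrite /= subrr modulus0].
move=> s /iteratesP[k Hk].
have [[v [phi hphi kv]]|kinf] := subsequence_dichotomy k.
  exists phi; split=> //; exists (fun w => Some (iter v f w)) => w _.
  exists setT; first exact: filterT.
  move=> e e0; exists 0%N => // n _ u _.
  by have [_ ->] := Hk (phi n); rewrite kv chordal_xx.
exists id; split=> //; exists (fun _ => None) => w _.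
exists setT; first exact: filterT.
move=> e e0; have [N HN] := H (2 / (e / 2)); have [N' HN'] := kinf N.
have e2 : 0 < e / 2 by rewrite divr_gt0.
exists N' => // n /= nN u [uz _]; have [_ ->] := Hk n.
apply: (@le_lt_trans _ _ (2 / (2 / (e / 2)))).
  by apply: dist_infty_le; [rewrite divr_gt0 | apply: HN => //; exact: HN'].
by rewrite invf_div mulrC divfK//; lra.
Qed.

Lemma fatou_preimage f z : (forall z, cdiff f z) -> fatou_set f (f z) -> fatou_set f z.
Proof.
move=> df [U [oU Ufz] nU].
have cf : continuous f by move=> w; have := cdiff_cont (df w); rewrite unlock.
exists (f @^-1` U); first by split=> //; apply: open_comp => // w _; exact: cf.
move=> s /iteratesP[k Hk].
have [[v [phi hphi kv]]|kinf] := subsequence_dichotomy k.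
  exists phi; split=> //; exists (fun w => Some (iter v f w)) => w _.
  exists setT; first exact: filterT.
  move=> e e0; exists 0%N => // n _ u _.
  by have [_ ->] := Hk (phi n); rewrite kv chordal_xx.
(* From N on k_n >= 2, so that k_n - 1 is again an admissible index: the family of iterates starts
   at 1. *)
have [N HN] := kinf 2%N.
have [n|phi [hphi [g gU]]] := nU (fun n => iter (k (n + N)%N).-1 f).
  exists (k (n + N)%N).-1 => //.
  by have := HN (n + N)%N (leq_addl _ _); case: (k _) => [//|[]].
exists (fun n => phi n + N)%N; split.
  by move=> m n /hphi; rewrite ltn_add2r.
exists (fun w => g (f w)) => w /gU[V Vw HV].
exists (f @^-1` V); first exact: cf.
move=> e /HV[N' _ HN']; exists N' => // n /HN' {}HN' u [Uu Vu].
have [k1 ->] := Hk (phi n + N)%N.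
have := HN' (f u) (conj Uu Vu); rewrite -iterSr prednK//.
Qed.

Lemma fatou_preimage_iter f n z : (forall z, cdiff f z) ->
  fatou_set f (iter n f z) -> fatou_set f z.
Proof. by move=> df; elim: n => //= n IH /(fatou_preimage df)/IH. Qed.

Lemma fatou_open f : open (fatou_set f).
Proof.
rewrite openE => z [U [oU Uz] nU].
by apply: filterS (open_nbhs_nbhs (conj oU Uz)) => w Uw; exists U.
Qed.

(* A limit function takes the value infinity at the points of A near z, hence is
   chordally close to infinity near z. *)
Lemma normal_near_escape f (A : set (CC R)) z : (forall z, cdiff f z) ->
  (forall w, A w -> forall B : R, exists N, forall n, (N <= n)%N -> B <= modulus (iter n f w)) ->
  fatou_set f z -> (forall d, 0 < d -> exists2 w, A w & modulus (w - z) < d) ->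
  exists2 d : R, 0 < d & forall N, exists2 n, (N <= n)%N &
    forall w, modulus (w - z) < d -> 3 <= modulus (iter n f w).
Proof.
move=> df escA [U [oU Uz] nU] clA.
have [n|phi [hphi [g gU]]] := nU (fun n => iter n.+1 f); first by exists n.+1.
have [V Vz HV] := gU z Uz.
have UVz : nbhs z (U `&` V) by apply: filterI => //; exact: open_nbhs_nbhs.
have /nbhsCP[d d0 Hd] := UVz.
(* 1 / 8 = 2 / (15 + 1) is the distance to infinity that forces modulus at least 15. Continuity at z
   costs 1, and 2 / 14 + 1 / 8 + 1 / 8 < 2 / (3 + 1) then yields modulus at least 3 for all later
   members of the subsequence. *)
have [N _ HN] := HV (1 / 8) ltac:(by rewrite divr_gt0).
have phin n : (n <= phi n)%N.
  elim: n => // n IH; exact: leq_ltn_trans IH (hphi _ _ (ltnSn n)).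
have gA w : A w -> modulus (w - z) < d -> dist_infty (g w) <= 0.
  move=> Aw wd; rewrite leNgt; apply/negP => g0.
  have e0 : 0 < dist_infty (g w) / 4 by rewrite divr_gt0.
  have [N1 _ H1] := HV _ e0.
  have [N2 H2] := escA _ Aw (2 / (dist_infty (g w) / 4)).
  pose n := (N1 + N2)%N.
  have := H1 n (leq_addr _ _) w (Hd _ wd).
  have n2 : (N2 <= (phi n).+1)%N.
    by apply: leq_trans (leq_addl N1 N2) _; apply: leq_trans (phin _) _.
  have := dist_infty_le _ (H2 _ n2); rewrite divr_gt0// => /(_ isT).
  have := (dist_infty_tri (iter (phi n).+1 f w) (g w)).1.
  by rewrite invf_div mulrC divfK//; lra.
pose n1 := (phi N).+1.
have /contP/(_ (1 / 2)) := cdiff_cont (cdiff_iter df n1 z).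
have h2 : 0 < 1 / 2 :> R by rewrite divr_gt0.
move=> /(_ h2)[d1 d10 Hd1].
have [w Aw] := clA _ (etrans (lt_min 0 d d1) (introT andP (conj d0 d10))).
rewrite lt_min => /andP[wd wd1].
have fw15 : 15 <= modulus (iter n1 f w).
  apply: dist_infty_large => //.
  have c1 : chordal (Some (iter n1 f w)) (g w) < 1 / 8 := HN N (leqnn _) w (Hd _ wd).
  move: c1 (gA _ Aw wd) (dist_infty_tri (iter n1 f w) (g w)).2.
  have -> : 15 + 1 = 16 :> R by ring.
  by move: (chordal _ _) (dist_infty (g w)) (dist_infty _) => x y t; lra.
exists (Num.min d d1) => [|N']; first by rewrite lt_min d0.
exists (phi (N + N')%N).+1.
  by apply: leq_trans (leq_addl N N') _; apply: leq_trans (phin _) _.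
move=> u; rewrite lt_min => /andP[ud ud1].
have fu14 : 14 <= modulus (iter n1 f u).
  have := Hd1 _ ud1; have := Hd1 _ wd1.
  have := modulusBD (iter n1 f w) 0 (iter n1 f u).
  have := modulusBD (iter n1 f w) (iter n1 f u) (iter n1 f z).
  rewrite !subr0 (modulusB (iter n1 f z)); lra.
have s1 : dist_infty (Some (iter n1 f u)) <= 2 / 14 by apply: dist_infty_le.
have s2 := (dist_infty_tri (iter n1 f u) (g u)).1.
have c1 : chordal (Some (iter n1 f u)) (g u) < 1 / 8 := HN N (leqnn _) u (Hd _ ud).
have c2 : chordal (Some (iter (phi (N + N')%N).+1 f u)) (g u) < 1 / 8 :=
  HN (N + N')%N (leq_addr _ _) u (Hd _ ud).
have s3 := (dist_infty_tri (iter (phi (N + N')%N).+1 f u) (g u)).2.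
apply: dist_infty_large => //; move: s1 s2 s3 c1 c2.
have -> : 3 + 1 = 4 :> R by ring.
move: (chordal (Some (iter n1 f u)) (g u)) (chordal _ (g u)) (dist_infty (g u)).
by move: (dist_infty (Some (iter n1 f u))) (dist_infty _) => x1 x2 x3 x4 x5; lra.
Qed.

End Normality.

(** * Discontinuity of R_A on the Julia set and continuity on the Fatou set *)

Section FatouContinuity.
Variables (R : realType) (f : CC R -> CC R).
Hypothesis df : forall z, cdiff f z.
Hypothesis f0 : f 0 = 0.
Hypothesis f_transc : ~ exists p : {poly CC R}, forall z, f z = p.[z].
Implicit Types (p a z w u : CC R) (r s e d t : R) (n k m l N : nat).
Local Notation M := (maxmod f).
Local Notation Mn n := (iter n (maxmod f)).
Local Notation fn n := (iter n f).
Local Notation rho := (escape_threshold f).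
Local Notation A := (fast_escaping f).

Lemma dominates_unbounded r z : rho < r -> dominates f r z -> forall B : R,
  exists N, forall n, (N <= n)%N -> B <= modulus (fn n z).
Proof.
move=> rr rz B; have [N HN] := iter_maxmod_unbounded df f0 f_transc B rr.
exists N.+1 => n Nn; apply: le_trans (rz n (leq_ltn_trans (leq0n _) Nn)).
by apply: HN; exact: ltnW.
Qed.

Lemma fast_escaping_unbounded z : A z -> forall B : R,
  exists N, forall n, (N <= n)%N -> B <= modulus (fn n z).
Proof. by move=> /(fast_escapingP df f0 f_transc)[r rr /(dominates_unbounded rr)]. Qed.

Lemma not_fast_escaping_iter0 z n : A z -> fn n z != 0.
Proof.
move=> /fast_escaping_unbounded/(_ 1)[N HN]; apply/eqP => fz.
have := HN (N + n)%N (leq_addr _ _); rewrite iterD fz.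
have -> : fn N 0 = 0 by elim: {HN} N => //= k ->.
by rewrite modulus0 ler10.
Qed.

Lemma RA_not_continuous z : (A `&` julia_set f) z -> ~ {for z, continuous (RA f)}.
Proof.
move=> [Az Jz] /contrP cz; apply: Jz.
have rz : rho < RA f z by apply/(fast_escaping_RA df f0 f_transc).
pose r := (rho + RA f z) / 2; have rr : rho < r by rewrite /r; lra.
have [d d0 Hd] : exists2 d : R, 0 < d & forall w, modulus (w - z) < d -> r <= RA f w.
  have [|d d0 Hd] := cz (RA f z - r); first by rewrite subr_gt0 /r; lra.
  by exists d => // w /Hd; rewrite ltr_norml; lra.
apply: (@escape_fatou _ f z d) => // B.
have [N HN] := iter_maxmod_unbounded df f0 f_transc B rr.
exists N.+1 => n w Nn /Hd /(RA_geP df f0 f_transc w rr)/(_ n (leq_ltn_trans (leq0n _) Nn)).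
by apply: le_trans; apply: HN; exact: ltnW.
Qed.

(** Once M^n(r) has passed the threshold of [maxmod_log_convex], the quotient ln M^n(s) / ln M^n(r)
    is nondecreasing in n; c is its value at the index N where this begins. *)
Lemma iter_ratio r s : rho < r < s -> exists N (c : R), 1 < c /\ forall n, (N <= n)%N ->
  0 < ln (Mn n r) /\ c * ln (Mn n r) <= ln (Mn n s).
Proof.
move=> /andP[rr rs]; have [r1 r11 H] := maxmod_log_convex df f_transc.
have [N HN] := iter_maxmod_unbounded df f0 f_transc r1 rr.
have r0 := gt_threshold_ge0 df f0 f_transc rr.
have lt_rs n : Mn n r < Mn n s by apply: lt_iter_maxmod => //; rewrite r0.
have gt1 n : (N <= n)%N -> 1 < Mn n r by move=> /HN; exact: lt_le_trans.
have ln0 n : (N <= n)%N -> 0 < ln (Mn n r) by move=> /gt1; exact: ln_gt0.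
exists N, (ln (Mn N s) / ln (Mn N r)); split.
  rewrite ltr_pdivlMr ?ln0// mul1r ltr_ln ?posrE//.
    by apply: lt_trans (gt1 N (leqnn _)).
  by apply: lt_trans (lt_rs N); apply: lt_trans (gt1 N (leqnn _)).
set c := _ / _; move=> n /subnK <-; elim: (n - N)%N => [|k [IH1 IH2]].
  by rewrite add0n; split; [exact: ln0 | rewrite /c divfK// gt_eqF// ln0].
split; first by apply: ln0; rewrite leq_addl.
have [|_] := H (Mn (k + N) r) (Mn (k + N) s).
  by rewrite HN ?leq_addl//= ltW.
rewrite addSn !iterS => h.
rewrite -(ler_pM2r IH1); apply: le_trans h.
rewrite mulrAC mulrC ler_wpM2l//.
by have := ln0 (k.+1 + N)%N (leq_addl _ _); rewrite addSn iterS => /ltW.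
Qed.

Lemma near_escape z : fatou_set f z -> (forall d, 0 < d -> exists2 w, A w & modulus (w - z) < d) ->
  exists2 d : R, 0 < d & forall N, exists2 n, (N <= n)%N &
    forall w, modulus (w - z) < d -> 3 <= modulus (fn n w).
Proof. exact: (normal_near_escape df fast_escaping_unbounded). Qed.

Lemma RA_lsc z r : fatou_set f z -> rho < r < RA f z -> exists2 d : R, 0 < d &
  forall w, modulus (w - z) < d -> r <= RA f w.
Proof.
move=> Fz /andP[rr rz].
have Az : A z by apply/(fast_escaping_RA df f0 f_transc); exact: lt_trans rz.
have [|d d0 Hd] := near_escape Fz.
  by move=> d d0; exists z; rewrite ?subrr ?modulus0.
have [_ Dz _] := RA_max df f0 f_transc Az.
have [|N [c [c1 Hc]]] := @iter_ratio r (RA f z); first by rewrite rr.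
(* Chosen so that Harnack's factor (1 + t) / (1 - t) equals c, which is the loss that the gap
   between M^n(r) and M^n(R_A(z)) can absorb. *)
pose t := (c - 1) / (c + 1).
have c0 : 0 < c + 1 by lra.
have t0 : 0 < t by rewrite divr_gt0 ?subr_gt0.
have t1 : t < 1 by rewrite ltr_pdivrMr//; lra.
exists (t * (d / 2)) => [|w wz]; first by rewrite mulr_gt0// divr_gt0.
apply/(RA_geP df f0 f_transc w rr).
(* Infinitely many n suffice, and [near_escape] provides no more. *)
apply: dominates_late => //; first exact: gt_threshold_ge0 rr.
move=> N'; have [n nN Hn] := Hd (N + N').+1.
exists n; first by apply: leq_trans nN; rewrite leqW// leq_addl.
have nN' : (N <= n)%N by apply: leq_trans nN; rewrite leqW// leq_addr.
have n1 : (1 <= n)%N by exact: leq_ltn_trans nN.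
have [ln1 ln2] := Hc n nN'.
have big w' : cball z (d / 2) w' -> 1 < modulus (fn n w').
  move=> w'd; apply: (@lt_le_trans _ _ 3); first by rewrite ltr1n.
  by apply: Hn; apply: le_lt_trans w'd _; lra.
have d2 : 0 < d / 2 by rewrite divr_gt0.
have := @harnack R (fn n) z (d / 2) t w d2 (fun w' _ => cdiff_iter df n w') big
  (ltW t0) (ltW wz) t1.
have [zK _] := star_cball z (ltW d2).
have wK : cball z (d / 2) w by rewrite /cball /mkset (le_trans (ltW wz))// ler_piMl// ltW.
have Mz : ln (Mn n (RA f z)) <= ln (modulus (fn n z)).
  have Mr0 : 0 < Mn n (RA f z).
    apply: le_lt_trans (iter_maxmod_gt df f0 f_transc n (lt_trans rr rz)).
    exact: escape_threshold_ge0.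
  by rewrite ler_ln ?posrE ?Dz// (lt_trans _ (big _ zK)).
have Mr0 : 0 < Mn n r.
  by apply: le_lt_trans (iter_maxmod_gt df f0 f_transc n rr); exact: escape_threshold_ge0.
move=> h; rewrite -ler_ln ?posrE//; last by rewrite (lt_trans _ (big _ wK)).
have e1 : 1 - t = 2 / (c + 1) by rewrite /t; field; rewrite gt_eqF.
have e2 : 1 + t = 2 * c / (c + 1) by rewrite /t; field; rewrite gt_eqF.
have : 2 * ln (modulus (fn n z)) <= 2 * c * ln (modulus (fn n w)).
  move: h; rewrite e1 e2 !(mulrAC _ (c + 1)^-1) ler_pM2r ?invr_gt0//.
have cp : 0 < c by lra.
by move=> h2; rewrite -(ler_pM2l cp); lra.
Qed.

Lemma RA_continuous z : (~` A `|` fatou_set f) z -> {for z, continuous (RA f)}.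
Proof.
move=> Hz; apply/contrP => e e0.
have : RA f z < RA f z + e by rewrite ltrDl.
move=> /(RA_usc df f0 f_transc)/nbhsCP[d1 d10 H1].
suff [d2 d20 H2] : exists2 d : R, 0 < d & forall w, modulus (w - z) < d ->
    RA f z - e < RA f w.
  exists (Num.min d1 d2) => [|w]; first by rewrite lt_min d10.
  by rewrite lt_min => /andP[/H1 h1 /H2 h2]; rewrite ltr_norml; lra.
have [Az|nAz] := pselect (A z); last first.
  exists 1 => // w _; rewrite (RA_not_fast nAz).
  by have := RA_ge_threshold df f0 f_transc w; lra.
have Fz : fatou_set f z by case: Hz.
have rz : rho < RA f z by apply/(fast_escaping_RA df f0 f_transc).
pose r := Num.max ((rho + RA f z) / 2) (RA f z - e / 2).
have [|d d0 Hd] := @RA_lsc z r Fz.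
  by rewrite lt_max gt_max; apply/andP; split; [apply/orP; left|apply/andP; split]; lra.
exists d => // w /Hd; apply: lt_le_trans.
by rewrite lt_max; apply/orP; right; lra.
Qed.

(** Together with [fast_escaping_closed_fatou] this makes A(f) relatively open and closed in F(f),
    so that a Fatou component meeting A(f) is contained in it. *)
Lemma fast_escaping_open_fatou z : fatou_set f z -> A z ->
  exists2 d : R, 0 < d & forall w, modulus (w - z) < d -> A w.
Proof.
move=> Fz Az; have rz : rho < RA f z by apply/(fast_escaping_RA df f0 f_transc).
have [|d d0 Hd] := @RA_lsc z ((rho + RA f z) / 2) Fz.
  by apply/andP; split; lra.
exists d => // w /Hd h; apply/(fast_escaping_RA df f0 f_transc).
by apply: lt_le_trans h; lra.
Qed.

(* Harnack's inequality costs a power 3, which is regained by shifting the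
   starting radius by one iterate since M(r) > r^3 for large r. *)
Lemma fast_escaping_closed_fatou z : fatou_set f z ->
  (forall d, 0 < d -> exists2 w, A w & modulus (w - z) < d) -> A z.
Proof.
move=> Fz clA; have [d d0 Hd] := near_escape Fz clA.
have d4 : 0 < d / 4 by rewrite divr_gt0.
have d2 : 0 < d / 2 by rewrite divr_gt0.
have [w Aw wz] := clA _ d4.
have /(fast_escapingP df f0 f_transc)[r rr Dw] := Aw.
have [r' rr' Mr'] := small_preimage df f0 f_transc 1 rr.
have [r0 Hr0] := maxmod_growth df f_transc 3 1.
have [N HN] := iter_maxmod_unbounded df f0 f_transc r0 rr.
apply/(fast_escapingP df f0 f_transc); exists r' => //.
apply: dominates_late => //; first exact: gt_threshold_ge0 rr'.
move=> N'; have [[//|n] nN Hn] := Hd (N + N').+1.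
exists n.+1; first by apply: leq_trans nN; rewrite leqW// leq_addl.
have nN' : (N <= n)%N by move: nN; rewrite ltnS; exact: leq_trans (leq_addr _ _).
have r0' := gt_threshold_ge0 df f0 f_transc rr'.
have h1 : Mn n.+1 r' <= Mn n r.
  rewrite -addn1 iterD; apply: le_iter_maxmod => //.
  by rewrite (iter_maxmod_ge0 df 1 r0').
have h2 : Mn n r ^+ 3 <= Mn n.+1 r.
  by rewrite iterS -[X in X <= _]mul1r; apply/ltW/Hr0/HN.
have h3 : modulus (fn n.+1 w) <= modulus (fn n.+1 z) ^+ 3.
  apply: (@harnack_cube R (fn n.+1) w (d / 2)) => //.
  - by move=> u _; exact: cdiff_iter.
  - move=> u uw; apply: (@lt_le_trans _ _ 3); first by rewrite ltr1n.
    by apply: Hn; have := modulusBD u z w; move: uw; rewrite /cball /mkset; lra.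
  - by rewrite modulusB; lra.
apply: le_trans h1 _.
rewrite -(@ler_pXn2r _ 3) ?nnegrE ?modulus_ge0//; last first.
  by apply: iter_maxmod_ge0 => //; exact: gt_threshold_ge0 rr.
by apply: le_trans h2 _; apply: le_trans h3; exact: Dw.
Qed.

End FatouContinuity.

(** * Continuous logarithms along paths and over the unit square *)

HB.lock Definition curve (R : realType) (f : R -> CC R) : Prop := continuous f.

Section ContinuousLogarithm.
Variable R : realType.
Implicit Types (g : CC R -> CC R) (a b p q z w : CC R) (s t e d : R).
Local Notation ii := (ii R).

(** The retraction onto [0, 1]: composing with it turns a path on the interval into a function
    continuous on the whole line, so that subspace topologies can be left behind. *)
Definition clamp t : R := Num.max 0 (Num.min 1 t).

Lemma clamp01 t : 0 <= clamp t <= 1.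
Proof. by rewrite /clamp le_max lexx /= ge_max ler01 ge_min lexx. Qed.

Lemma clampE t : 0 <= t <= 1 -> clamp t = t.
Proof. by move=> /andP[t0 t1]; rewrite /clamp min_r// max_r. Qed.

Lemma clamp_le0 t : t <= 0 -> clamp t = 0.
Proof. by move=> t0; rewrite /clamp min_r ?(le_trans t0)// max_l. Qed.

Lemma clamp_ge1 t : 1 <= t -> clamp t = 1.
Proof. by move=> t1; rewrite /clamp min_l// max_r. Qed.

Lemma clamp_lip s t : `|clamp s - clamp t| <= `|s - t|.
Proof.
wlog st : s t / s <= t.
  by move=> H; have [/H//|/ltW/H] := leP s t; rewrite distrC (distrC t).
have cle : clamp s <= clamp t.
  rewrite /clamp ge_max; apply/andP; split; first by rewrite le_max lexx.
  rewrite le_max; apply/orP; right; rewrite le_min ge_min lexx /=.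
  by rewrite ge_min st orbT.
rewrite distrC (distrC s) !ger0_norm ?subr_ge0//.
have [s0|s0] := leP s 0.
  rewrite (clamp_le0 s0); have [t0|t0] := leP t 0; first by rewrite clamp_le0//; lra.
  have [t1|t1] := leP t 1; first by rewrite clampE ?(ltW t0)//; lra.
  by rewrite clamp_ge1 ?(ltW t1)//; lra.
have [s1|s1] := leP s 1; last first.
  by rewrite !clamp_ge1 ?(ltW s1) ?(le_trans (ltW s1))//; lra.
rewrite (clampE (t := s)) ?(ltW s0)//.
have [t1|t1] := leP t 1; last by rewrite clamp_ge1 ?(ltW t1)//; lra.
by rewrite clampE ?t1 ?andbT ?(le_trans (ltW s0)).
Qed.

Lemma curveP (f : R -> CC R) : curve f <-> forall t e, 0 < e ->
  exists2 d : R, 0 < d & forall s, `|s - t| < d -> modulus (f s - f t) < e.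
Proof. by rewrite unlock; split=> [cf t|cf t]; [exact/contcP/cf | exact/contcP/cf]. Qed.

(** The Lipschitz constant 2 covers the maps 2 t, 2 t - 1 and 2 - 2 t used in concatenations. *)
Lemma curve_reparam (f : R -> CC R) (u : R -> R) : curve f ->
  (forall s t, `|u s - u t| <= 2 * `|s - t|) -> curve (fun t => f (clamp (u t))).
Proof.
move=> /curveP cf ul; apply/curveP => t e /(cf (clamp (u t)))[d d0 Hd].
exists (d / 2) => [|s st]; first by rewrite divr_gt0.
apply: Hd; apply: le_lt_trans (clamp_lip _ _) _; apply: le_lt_trans (ul _ _) _; lra.
Qed.

Lemma curve_cst (c : CC R) : curve (fun _ => c).
Proof. by rewrite unlock => t; exact: cst_continuous. Qed.
Lemma curve_rc : curve (@rc R).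
Proof. by rewrite unlock; exact: rc_cont. Qed.
Lemma curveD (f1 f2 : R -> CC R) : curve f1 -> curve f2 -> curve (fun t => f1 t + f2 t).
Proof.
rewrite unlock => c1 c2 t; exact: (@continuousD _ _ _ f1 f2 t (c1 t) (c2 t)).
Qed.
Lemma curveM (f1 f2 : R -> CC R) : curve f1 -> curve f2 -> curve (fun t => f1 t * f2 t).
Proof.
rewrite unlock => c1 c2 t; exact: (@continuousM _ _ f1 f2 t (c1 t) (c2 t)).
Qed.
Lemma curve_cont (f : R -> CC R) (h : CC R -> CC R) : curve f ->
  (forall t, cont h (f t)) -> curve (fun t => h (f t)).
Proof.
move=> /curveP cf ch; apply/curveP => t e e0.
have /contP/(_ e e0)[d d0 Hd] := ch t; have [d' d'0 Hd'] := cf t d d0.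
by exists d' => // s /Hd'; exact: Hd.
Qed.
Lemma curveB (f1 f2 : R -> CC R) : curve f1 -> curve f2 -> curve (fun t => f1 t - f2 t).
Proof.
move=> c1 c2; apply: curveD => //.
by apply: (@curve_cont f2 (fun w => - w)) => // t; exact: contN (@cont_id _ _).
Qed.

Lemma within_clamp (f : R -> CC R) : {within `[0, 1], continuous f} ->
  curve (fun t => f (clamp t)).
Proof.
move=> /subspace_continuousP cf; apply/curveP => t e e0.
have c01 : `[0, 1]%classic (clamp t) by rewrite /= in_itv; exact: clamp01.
have Ve : nbhs (f (clamp t)) [set w | modulus (w - f (clamp t)) < e].
  by apply/nbhsCP; exists e.
have /nbhs_ballP[d d0 H] := cf _ c01 _ Ve; exists d => // y yt; apply: H.
  by rewrite /ball /= (le_lt_trans (clamp_lip _ _))// distrC.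
by rewrite /= in_itv; exact: clamp01.
Qed.

Lemma within_clamp2 (H : R * R -> CC R) :
  {within `[0, 1]%classic `*` `[0, 1]%classic, continuous H} ->
  forall s t e, 0 < e -> exists2 d : R, 0 < d & forall s' t', `|s' - s| < d ->
    `|t' - t| < d -> modulus (H (clamp s', clamp t') - H (clamp s, clamp t)) < e.
Proof.
move=> /subspace_continuousP cH s t e e0.
have in01 x : `[0, 1]%classic (clamp x) by rewrite /= in_itv; exact: clamp01.
have Ve : nbhs (H (clamp s, clamp t)) [set w | modulus (w - H (clamp s, clamp t)) < e].
  by apply/nbhsCP; exists e.
have /nbhs_ballP[d d0 Hd] := cH (clamp s, clamp t) (conj (in01 s) (in01 t)) _ Ve.
exists d => // s' t' sd td; apply: Hd.
  split; rewrite /ball /= (le_lt_trans (clamp_lip _ _))// distrC//.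
by split; exact: in01.
Qed.

(** The unit square is seen as a compact set of the plane, star-shaped about 0. The lemma serves
    homotopies and, with [h] constant in [s], single paths. *)
Lemma square_logarithm (h : R -> R -> CC R) :
  (forall s t e, 0 < e -> exists2 d : R, 0 < d & forall s' t', `|s' - s| < d ->
    `|t' - t| < d -> modulus (h s' t' - h s t) < e) ->
  (forall s t, h s t != 0) ->
  exists L : CC R -> CC R, [/\ L 0 = 0,
    forall s t, 0 <= s <= 1 -> 0 <= t <= 1 -> expC (L (cplx s t)) = h s t / h 0 0 &
    forall s t, 0 <= s <= 1 -> 0 <= t <= 1 -> cont L (cplx s t)].
Proof.
move=> ch h0.
pose K := [set z : CC R | 0 <= cre z <= 1 /\ 0 <= cim z <= 1].
have cK : compact K.
  apply: (@compact_of_closed_bounded R K 2); last first.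
    move=> z [x01 y01]; apply: le_trans (modulus_le z) _.
    by rewrite !ger0_norm; lra.
  have -> : K = ([set z : CC R | 0 <= cre z] `&` [set z | cre z <= 1]) `&`
      ([set z | 0 <= cim z] `&` [set z | cim z <= 1]).
    apply/seteqP; split=> z; first by move=> [/andP[? ?] /andP[? ?]].
    by move=> [[/= h1 h2] [h3 h4]]; split; apply/andP.
  apply: closedI; apply: closedI.
  - exact: (closed_superlevel (x := 0) (@cre_cont R)).
  - exact: (closed_sublevel (x := 1) (@cre_cont R)).
  - exact: (closed_superlevel (x := 0) (@cim_cont R)).
  - exact: (closed_sublevel (x := 1) (@cim_cont R)).
have K0 : K 0 by rewrite /K /= cre0 cim0 lexx ler01.
pose G z := h (cre z) (cim z).
have [|w _|w _|L [L0 LE cL _]] := @star_log R K 0 G cK K0.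
- move=> w t [/andP[x0 x1] /andP[y0 y1]] /andP[t0 t1]; rewrite add0r subr0 /K /= !cE.
  by rewrite !mul0r subr0 addr0 !mulr_ge0//= !mulr_ile1.
- apply/contP => e e0; have [d d0 Hd] := ch (cre w) (cim w) e e0.
  exists d => // z zw; apply: Hd.
    by apply: le_lt_trans zw; rewrite -creN -creD cre_le.
  by apply: le_lt_trans zw; rewrite -cimN -cimD cim_le.
- exact: h0.
have Kst s t : 0 <= s <= 1 -> 0 <= t <= 1 -> K (cplx s t).
  by rewrite /K /mkset cre_cplx cim_cplx.
exists L; split=> // s t s01 t01; last exact: cL (Kst _ _ s01 t01).
have -> : h s t = G (cplx s t) by rewrite /G cre_cplx cim_cplx.
have -> : h 0 0 = G 0 by rewrite /G cre0 cim0.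
exact: LE (Kst _ _ s01 t01).
Qed.

(* A continuous logarithm of a constant cannot cross the strip between two
   consecutive zeros of sin. *)
Lemma logarithm_const (l : R -> CC R) (c : CC R) : curve l ->
  (forall t, 0 <= t <= 1 -> expC (l t) = c) -> l 0 = l 1.
Proof.
move=> cl lc; have I0 : 0 <= (0 : R) <= 1 by rewrite lexx ler01.
have I1 : 0 <= (1 : R) <= 1 by rewrite lexx ler01.
pose d t := l t - l 0.
have dE t : 0 <= t <= 1 -> expC (d t) = 1.
  by move=> t01; rewrite expCB !lc// divff// -(lc _ I0) expC_neq0.
have d_re t : 0 <= t <= 1 -> cre (d t) = 0.
  move=> /dE/(congr1 (@modulus R)); rewrite modulus_expC modulus1 -expR0.
  exact: expR_inj.
have d_sin t : 0 <= t <= 1 -> sin (cim (d t)) = 0.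
  move=> t01; have := congr1 (@cim R) (dE t t01).
  by rewrite /expC d_re// expR0 rc1 mul1r cim_cplx cim1.
apply/esym/eqP; rewrite -subr_eq0 -/(d 1); apply/eqP; apply: cplx_inj.
  by rewrite d_re// cre0.
rewrite cim0; apply/eqP/negPn/negP => y0.
set y := cim (d 1) in y0 *.
have pi1 : 1 < pi :> R by have := pi_ge2 R; lra.
(* An intermediate value between 0 and y with 0 < |v| < 1 < pi, where sin does not vanish. *)
pose v := y / (1 + `|y|).
have y1 : 0 < 1 + `|y| by rewrite ltr_wpDr.
have vy : `|v| < 1.
  by rewrite normf_div (gtr0_norm y1) ltr_pdivrMr//; lra.
have v0 : v != 0 by rewrite mulf_neq0// invr_eq0 gt_eqF.
have cd : continuous (fun t => cim (d t)).
  have := curveB cl (curve_cst (l 0)); rewrite unlock => cd t.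
  exact: (@continuous_comp _ _ _ d (@cim R) t (cd t) (@cim_cont R (d t))).
have [|t] := @IVT R (fun t => cim (d t)) 0 1 v ler01 (continuous_subspaceT cd).
  rewrite {1 3}/d subrr cim0 -/y /v; have [yp|yn] := leP 0 y.
    rewrite divr_ge0 ?(ltW y1)//= ler_pdivrMr// ger0_norm//; nra.
  apply/andP; split; last by rewrite ler_pdivrMr// mul0r ltW.
  by rewrite ler_pdivlMr// ltr0_norm//; nra.
rewrite in_itv /= => /d_sin h tv; move: h; rewrite tv => sv.
have [vp|vn] := ltP 0 v.
  have := @sin_gt0_pi R v; rewrite sv ltxx vp /=; move: vy; rewrite gtr0_norm// => vy.
  by rewrite (lt_trans vy pi1) => /(_ isT).
have vn' : 0 < - v by rewrite oppr_gt0 lt_neqAle v0.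
have := @sin_gt0_pi R (- v); rewrite sinN sv oppr0 ltxx vn' /=.
by move: vy; rewrite ler0_norm// => vy; rewrite (lt_trans vy pi1) => /(_ isT).
Qed.

End ContinuousLogarithm.

(** * Logarithms on simply connected open sets *)

Section SimplyConnected.
Variables (R : realType) (U : set (CC R)) (g : CC R -> CC R).
Hypothesis scU : simply_connected U.
Hypothesis openU : forall z, U z -> exists2 d : R, 0 < d & forall w, modulus (w - z) < d -> U w.
Hypothesis cg : forall z, U z -> cont g z.
Hypothesis g_neq0 : forall z, U z -> g z != 0.
Implicit Types (a b p q z w : CC R) (s t e d : R).
Local Notation ii := (ii R).

(** Composing g with a null homotopy gives a function on the unit square with a logarithm L. On
    three sides the homotopy rests at the base point, so L agrees at all four corners; on the
    fourth, l and L differ by a constant. *)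
Lemma loop_logarithm (gam l : R -> CC R) : curve gam -> (forall t, U (gam t)) ->
  gam 0 = gam 1 -> curve l ->
  (forall t, 0 <= t <= 1 -> expC (l t) = g (gam t) / g (gam 0)) -> l 0 = l 1.
Proof.
move=> cgam Ugam loop cl lE.
have I0 : 0 <= (0 : R) <= 1 by rewrite lexx ler01.
have I1 : 0 <= (1 : R) <= 1 by rewrite lexx ler01.
have [|//|H [cH UH H0 H1 Hs]] := scU.2 gam.
  split; last by move=> t _; exact: Ugam.
  by move: cgam; rewrite unlock => cgam; exact: (continuous_subspaceT cgam).
have Uc s t : U (H (clamp s, clamp t)).
  by apply: UH; split; rewrite /= in_itv; exact: clamp01.
pose h s t := g (H (clamp s, clamp t)).
have [s t e e0|s t|L [L0 LE cL]] := @square_logarithm R h.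
- have /contP/(_ e e0)[d d0 Hd] := cg (Uc s t).
  have [d' d'0 Hd'] := within_clamp2 cH s t d0.
  by exists d' => // s' t' sd td; apply: Hd; exact: Hd'.
- exact/g_neq0/Uc.
have h00 : h 0 0 = g (gam 0) by rewrite /h clampE// H0.
have side (u v : R -> R) : (forall s t, `|u s - u t| <= 2 * `|s - t|) ->
    (forall s t, `|v s - v t| <= 2 * `|s - t|) ->
    curve (fun t => L (cplx (clamp (u t)) (clamp (v t)))).
  move=> cu cv; apply: (@curve_cont R (fun t => cplx (clamp (u t)) (clamp (v t))) L).
    have -> : (fun t => cplx (clamp (u t)) (clamp (v t)) : CC R) =
        (fun t => rc (clamp (u t)) + ii * rc (clamp (v t))).
      by apply/funext => x; apply: cplx_inj; rewrite !cE; ring.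
    apply: curveD; first exact: curve_reparam (@curve_rc R) cu.
    exact: curveM (@curve_cst _ _) (curve_reparam (@curve_rc R) cv).
  by move=> t; exact: cL (clamp01 _) (clamp01 _).
have cid (s t : R) : `|s - t| <= 2 * `|s - t| by have := normr_ge0 (s - t); lra.
have cc (c s t : R) : `|c - c| <= 2 * `|s - t|.
  by rewrite subrr normr0 mulr_ge0.
have s1 := @logarithm_const R _ 1 (side (fun _ => 1) id (cc 1) cid).
have s2 := @logarithm_const R _ 1 (side id (fun _ => 0) cid (cc 0)).
have s3 := @logarithm_const R _ 1 (side id (fun _ => 1) cid (cc 1)).
have s4 := @logarithm_const R (fun t => l t - L (cplx (clamp 0) (clamp t))) (expC (l 0)).
rewrite /= !(clampE I0) !(clampE I1) in s1 s2 s3 s4.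
have hE s t : 0 <= s <= 1 -> 0 <= t <= 1 -> h s t = g (H (s, t)).
  by move=> s01 t01; rewrite /h !clampE.
have gg : g (gam 0) != 0 by exact/g_neq0.
have {}s1 : L (cplx 1 0) = L (cplx 1 1).
  by apply: s1 => t t01; rewrite clampE// LE// h00 hE// H1// divff.
have {}s2 : L (cplx 0 0) = L (cplx 1 0).
  by apply: s2 => t t01; rewrite clampE// LE// h00 hE// (Hs t t01).1 divff.
have {}s3 : L (cplx 0 1) = L (cplx 1 1).
  by apply: s3 => t t01; rewrite clampE// LE// h00 hE// (Hs t t01).2 divff.
have {}s4 : l 0 - L (cplx 0 0) = l 1 - L (cplx 0 1).
  apply: s4.
    by apply: curveB cl _; have := side (fun _ => 0) id (cc 0) cid; rewrite (clampE I0).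
  move=> t t01; rewrite clampE// expCB LE// h00 hE// H0// lE// lE//.
  have gt : g (gam t) != 0 by exact/g_neq0.
  by field; rewrite gg gt.
by move: s4; rewrite s2 s1 -s3 => /addIr.
Qed.

(* z is reached from b by a path along which g has a continuous logarithm
   increasing by la. *)
Definition log_along b z (la : CC R) := exists gam l : R -> CC R,
  [/\ curve gam, curve l, forall t, U (gam t), gam 0 = b /\ gam 1 = z &
    [/\ l 0 = 0, l 1 = la & forall t, 0 <= t <= 1 -> expC (l t) = g (gam t) / g b]].

Lemma log_along_exists b z : U b -> U z -> exists la, log_along b z la.
Proof.
move=> Ub Uz; have [gam0 [[cgam0 Ugam0] g0 g1]] := scU.1 b z Ub Uz.
have I0 : 0 <= (0 : R) <= 1 by rewrite lexx ler01.
have I1 : 0 <= (1 : R) <= 1 by rewrite lexx ler01.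
pose gam t := gam0 (clamp t).
have cgam : curve gam by exact: within_clamp.
have Ugam t : U (gam t) by apply: Ugam0; exact: clamp01.
have [s t e e0|s t|L [L0 LE cL]] := @square_logarithm R (fun s t => g (gam t)).
- have /contP/(_ e e0)[d d0 Hd] := cg (Ugam t).
  have /curveP/(_ t d d0)[d' d'0 Hd'] := cgam.
  by exists d' => // s' t' _ td; apply: Hd; exact: Hd'.
- exact/g_neq0.
exists (L (cplx 0 1)), gam, (fun t => L (cplx 0 (clamp t))); split; [exact: cgam| |exact: Ugam| | ].
- apply/curveP => t e e0.
  have /contP/(_ e e0)[d d0 Hd] := cL _ _ I0 (clamp01 t).
  exists d => // s st; apply: Hd.
  have -> : cplx 0 (clamp s) - cplx 0 (clamp t) = ii * rc (clamp s - clamp t).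
    by apply: cplx_inj; rewrite !cE; ring.
  rewrite modulusM modulus_ii mul1r modulus_rc.
  by apply: le_lt_trans st; exact: clamp_lip.
- by rewrite /gam !clampE.
- split; rewrite ?clampE//.
  by move=> t t01; rewrite clampE// LE// /gam (clampE I0) g0.
Qed.

(** The first path followed by the reverse of the second is a loop, along which a logarithm grows by
    la1 - la2. *)
Lemma log_along_uniq b z la1 la2 : log_along b z la1 -> log_along b z la2 -> la1 = la2.
Proof.
move=> [gam1 [l1 [cgam1 cl1 U1 [g10 g11] [l10 l11 l1E]]]].
move=> [gam2 [l2 [cgam2 cl2 U2 [g20 g21] [l20 l21 l2E]]]].
have I0 : 0 <= (0 : R) <= 1 by rewrite lexx ler01.
have I1 : 0 <= (1 : R) <= 1 by rewrite lexx ler01.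
pose u t : R := 2 * t; pose v t : R := 2 - 2 * t.
have cu s t : `|u s - u t| <= 2 * `|s - t|.
  by rewrite /u -mulrBr normrM normr_nat.
have cv s t : `|v s - v t| <= 2 * `|s - t|.
  have -> : v s - v t = - (2 * (s - t)) by rewrite /v; ring.
  by rewrite normrN normrM normr_nat.
(* Concatenation as a sum: clamping keeps one of the two paths at the common end point, which is
   subtracted, so that continuity needs no gluing. *)
have cat (f1 f2 : R -> CC R) c : curve f1 -> curve f2 ->
    curve (fun t => f1 (clamp (u t)) + f2 (clamp (v t)) - c).
  move=> c1 c2; apply: curveB (@curve_cst _ _).
  exact: curveD (curve_reparam c1 cu) (curve_reparam c2 cv).
have dich t : (clamp (v t) = 1) \/ (clamp (u t) = 1).
  by have [h|h] := leP t (1 / 2); [left|right]; rewrite clamp_ge1// /u /v; lra.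
have Ub : U b by rewrite -g10.
have Uz : U z by rewrite -g11.
have gb := g_neq0 Ub; have gz := g_neq0 Uz.
have u0 : clamp (u 0) = 0 by rewrite /u mulr0 clampE.
have v0 : clamp (v 0) = 1 by rewrite /v mulr0 subr0 clamp_ge1//; lra.
have u1 : clamp (u 1) = 1 by rewrite /u mulr1 clamp_ge1//; lra.
have v1 : clamp (v 1) = 0 by rewrite /v mulr1 subrr clampE.
pose gam t := gam1 (clamp (u t)) + gam2 (clamp (v t)) - z.
pose l t := l1 (clamp (u t)) + l2 (clamp (v t)) - la2.
have := @loop_logarithm gam l (cat _ _ z cgam1 cgam2).
have gamE t : (clamp (v t) = 1 -> gam t = gam1 (clamp (u t))) /\
    (clamp (u t) = 1 -> gam t = gam2 (clamp (v t))).
  rewrite /gam; split=> ->; rewrite ?g21 ?g11 ?addrK//.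
  by rewrite addrAC subrr add0r.
have gam0 : gam 0 = b by rewrite (gamE 0).1// u0.
have gam1' : gam 1 = b by rewrite (gamE 1).2// v1.
have lat0 : l 0 = 0 by rewrite /l u0 v0 l10 l21 add0r subrr.
have lat1 : l 1 = la1 - la2 by rewrite /l u1 v1 l11 l20 addr0.
rewrite gam0 gam1' lat0 lat1 => H; apply/eqP; rewrite -subr_eq0; apply/eqP/esym.
apply: H => //.
- move=> t; have [h|h] := dich t.
    by rewrite (gamE t).1.
  by rewrite (gamE t).2.
- exact: cat.
- move=> t _; rewrite /l; have [h|h] := dich t.
    by rewrite (gamE t).1// h l21 addrK l1E// clamp01.
  rewrite (gamE t).2// h l11 addrAC expCD expCB l2E ?clamp01//.
  by rewrite -l11 -l21 !l1E// !l2E// g11 g21 divff ?mul1r// mulf_neq0// invr_eq0.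
Qed.

(** The segment from z to w is appended; along it g / g(z) stays within 1 of 1, so [logC] continues
    the logarithm. *)
Lemma log_along_extend b z w la : log_along b z la ->
  (forall t, 0 <= t <= 1 -> U (z + rc t * (w - z)) /\
     modulus (g (z + rc t * (w - z)) / g z - 1) < 1) ->
  log_along b w (la + logC (g w / g z)).
Proof.
move=> [gam1 [l1 [cgam1 cl1 U1 [g10 g11] [l10 l11 l1E]]]] seg.
have I0 : 0 <= (0 : R) <= 1 by rewrite lexx ler01.
have I1 : 0 <= (1 : R) <= 1 by rewrite lexx ler01.
pose u t : R := 2 * t; pose v t : R := 2 * t - 1.
have cu s t : `|u s - u t| <= 2 * `|s - t|.
  by rewrite /u -mulrBr normrM normr_nat.
have cv s t : `|v s - v t| <= 2 * `|s - t|.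
  have -> : v s - v t = 2 * (s - t) by rewrite /v; ring.
  by rewrite normrM normr_nat.
pose sg t : CC R := z + rc (clamp t) * (w - z).
have cid (s t : R) : `|s - t| <= 2 * `|s - t| by have := normr_ge0 (s - t); lra.
have csg : curve sg.
  apply: curveD (@curve_cst _ _) _; apply: curveM _ (@curve_cst _ _).
  exact: (@curve_reparam R (@rc R) id (@curve_rc R) cid).
have Usg t : U (sg t) by case: (seg _ (clamp01 t)).
have dich t : (clamp (v t) = 0) \/ (clamp (u t) = 1).
  have [h|h] := leP t (1 / 2); [left|right].
    by rewrite clamp_le0// /v; lra.
  by rewrite clamp_ge1// /u; lra.
have Ub : U b by rewrite -g10.
have Uz : U z by rewrite -g11.
have gb := g_neq0 Ub; have gz := g_neq0 Uz.
have u0 : clamp (u 0) = 0 by rewrite /u mulr0 clampE.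
have v0 : clamp (v 0) = 0 by rewrite /v mulr0 sub0r clamp_le0//; lra.
have u1 : clamp (u 1) = 1 by rewrite /u mulr1 clamp_ge1//; lra.
have v1 : clamp (v 1) = 1 by rewrite /v mulr1 clamp_ge1//; lra.
have sg0 : sg 0 = z by rewrite /sg (clampE I0) rc0 mul0r addr0.
have sg1 : sg 1 = w by rewrite /sg (clampE I1) rc1 mul1r addrC subrK.
pose m t := logC (g (sg t) / g z).
have cm : curve m.
  apply: (@curve_cont R sg (fun x => logC (g x / g z)) csg) => t.
  have [_ hm] := seg _ (clamp01 t).
  apply: (@cont_comp _ (fun x => g x / g z) (@logC R)).
    by apply: contM; [exact/cg | exact: cont_cst].
  by apply: cont_logC; exact: cre_gt0_near1.
have m0 : m 0 = 0 by rewrite /m sg0 divff// logC1.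
pose gam t := gam1 (clamp (u t)) + sg (clamp (v t)) - z.
pose l t := l1 (clamp (u t)) + m (clamp (v t)).
have gamE t : (clamp (v t) = 0 -> gam t = gam1 (clamp (u t))) /\
    (clamp (u t) = 1 -> gam t = sg (clamp (v t))).
  rewrite /gam; split=> ->; rewrite ?sg0 ?g11 ?addrK//.
  by rewrite addrAC subrr add0r.
exists gam, l; split.
- apply: curveB (@curve_cst _ _).
  exact: curveD (curve_reparam cgam1 cu) (curve_reparam csg cv).
- exact: curveD (curve_reparam cl1 cu) (curve_reparam cm cv).
- move=> t; have [h|h] := dich t.
    by rewrite (gamE t).1.
  by rewrite (gamE t).2.
- by rewrite (gamE 0).1// (gamE 1).2// u0 v1.
split.
- by rewrite /l u0 v0 l10 m0 addr0.
- by rewrite /l u1 v1 l11 /m sg1.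
move=> t _; rewrite /l; have [h|h] := dich t.
  by rewrite (gamE t).1// h m0 addr0 l1E// clamp01.
rewrite (gamE t).2// h expCD l1E// g11 /m expC_logC.
  by field; rewrite gb gz.
apply: cre_gt0_near1; rewrite /sg clampE ?clamp01//; exact: (seg _ (clamp01 _)).2.
Qed.

(** L(z) is the increment of a logarithm of g along any path from b to z, well defined by
    [log_along_uniq]. The local formula yields both continuity of L and its increments. *)
Lemma local_logarithm : (exists b, U b) -> exists L : CC R -> CC R, forall p, U p ->
  exists2 d : R, 0 < d & forall q, modulus (q - p) < d ->
    L q = L p + logC (g q / g p).
Proof.
move=> [b Ub].
have [L HL] : exists L : CC R -> CC R, forall z, U z -> log_along b z (L z).
  have H z : {la | U z -> log_along b z la}.
    apply: cid; have [Uz|nUz] := pselect (U z); last by exists 0.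
    by have [la Hla] := log_along_exists Ub Uz; exists la.
  by exists (fun z => sval (H z)) => z; case: (H z).
exists L => p Up; have [d d0 Hd] := openU Up.
have gp : 0 < modulus (g p) by rewrite modulus_gt0 g_neq0.
have /contP/(_ _ gp)[d' d'0 Hd'] := cg Up.
exists (Num.min d d') => [|q]; first by rewrite lt_min d0.
rewrite lt_min => /andP[qd qd'].
have Uq := Hd _ qd.
apply: (log_along_uniq (HL _ Uq)).
apply: log_along_extend (HL _ Up) _ => t /andP[t0 t1].
have tq : modulus (p + rc t * (q - p) - p) <= modulus (q - p).
  rewrite addrAC subrr add0r modulusM modulus_rc ger0_norm//.
  by rewrite ler_piMl ?modulus_ge0.
split; first by apply: Hd; exact: le_lt_trans qd.
have -> : g (p + rc t * (q - p)) / g p - 1 = (g (p + rc t * (q - p)) - g p) / g p.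
  by field; rewrite -modulus_gt0.
rewrite modulusM modulusV ltr_pdivrMr// mul1r.
by apply: Hd'; exact: le_lt_trans qd'.
Qed.

(* A continuous imaginary part of log g on U would have no maximum on K. *)
Lemma no_rotation (K : set (CC R)) : compact K -> K !=set0 -> K `<=` U ->
  (forall p d, K p -> 0 < d -> exists2 e0 : R, 0 < e0 & forall e, 0 < e < e0 ->
     exists q, [/\ K q, modulus (q - p) < d & g q = g p * expC (ii * rc e)]) -> False.
Proof.
move=> cK K0 KU rot; have [|L HL] := local_logarithm.
  by case: K0 => p Kp; exists p; exact: KU.
have [z Kz|p Kp Hp] := @argmax_on_compact R (fun z => cim (L z)) K cK K0.
  have Uz := KU _ Kz; have [d d0 Hd] := HL z Uz.
  apply: (@continuous_comp _ _ _ L (@cim R)); last exact: cim_cont.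
  have : cont L z.
    apply: (@cont_near _ (fun q => L z + logC (g q / g z))).
      by apply/nbhsCP; exists d => // q /Hd ->.
    apply: contD; first exact: cont_cst.
    apply: (@cont_comp _ (fun x => g x / g z) (@logC R)).
      by apply: contM; [exact: cg | exact: cont_cst].
    by rewrite divff ?g_neq0//; apply: cont_logC; rewrite cre1.
  by rewrite unlock.
have Up := KU _ Kp; have [d d0 Hd] := HL p Up.
have [e0 e00 He] := rot p d Kp d0.
(* The bound 1 / 2 < pi / 2 keeps e in the range where atan inverts tan, so that Im L grows by
   exactly e. *)
pose e := Num.min (e0 / 2) (1 / 2).
have e_gt0 : 0 < e by rewrite lt_min !divr_gt0.
have ee0 : e < e0 by rewrite gt_min; apply/orP; left; lra.
have e1 : e <= 1 / 2 by rewrite ge_min lexx orbT.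
have [|q [Kq qp gq]] := He e; first by rewrite e_gt0.
have := Hp _ Kq; rewrite (Hd _ qp) cimD gerDl; apply/negP; rewrite -ltNge.
rewrite gq mulrC mulKf ?g_neq0// /logC cim_cplx.
have -> : expC (ii * rc e) = cplx (cos e) (sin e).
  rewrite /expC !cE; have -> : 0 * e - 1 * 0 = 0 :> R by ring.
  by have -> : 0 * 0 + 1 * e = e :> R; [ring | rewrite expR0 rc1 mul1r].
rewrite cre_cplx cim_cplx -/(tan e) tanK//.
rewrite in_itv /=; have := pi_ge2 R; lra.
Qed.

End SimplyConnected.

(** * Images of balls that contain whole circles *)

Section CircleCovering.
Variable R : realType.
Implicit Types (g : CC R -> CC R) (a b p q z w v : CC R) (s t e d r : R).
Local Notation ii := (ii R).

Lemma expC_ii t : expC (ii * rc t) = cplx (cos t) (sin t).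
Proof.
rewrite /expC !cE; have -> : 0 * t - 1 * 0 = 0 :> R by ring.
have -> : 0 * 0 + 1 * t = t :> R by ring.
by rewrite expR0 rc1 mul1r.
Qed.

Lemma modulus_expC_ii t : modulus (expC (ii * rc t)) = 1.
Proof. by rewrite modulus_expC !cE; have -> : 0 * t - 1 * 0 = 0 :> R; [ring | exact: expR0]. Qed.

(** The bound 4 is a crude substitute for pi. *)
Lemma unit_angle z : modulus z = 1 -> exists2 t : R, `|t| <= 4 & z = expC (ii * rc t).
Proof.
move=> z1.
have pi4 : pi <= 4 :> R by have := pihalf_lt2 R; lra.
have x1 : -1 <= cre z <= 1 by rewrite -ler_norml -z1 cre_le.
have sq : 1 - cre z ^+ 2 = cim z ^+ 2.
  by have := modulus_sqr z; rewrite z1 expr1n; lra.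
have xin : cre z \in `[-1, 1] by rewrite in_itv.
have a0 := acos_ge0 x1; have a1 := acos_lepi x1.
have [y0|y0] := leP 0 (cim z).
  exists (acos (cre z)); first by rewrite ger0_norm//; lra.
  rewrite expC_ii acosK// sin_acos// sq sqrtr_sqr ger0_norm//; exact: cplxE.
exists (- acos (cre z)); first by rewrite normrN ger0_norm//; lra.
rewrite expC_ii cosN sinN acosK// sin_acos// sq sqrtr_sqr ltr0_norm// opprK.
exact: cplxE.
Qed.

(* If a point v of the circle is omitted, then log g - log v is a nonvanishing
   function which is bounded at a point where |g| = |v| but of size comparable to
   log |g| at q, against Harnack's inequality. *)
Lemma circle_covered g z0 d p q c : 0 < d ->
  (forall w, modulus (w - z0) < d -> cdiff g w) ->
  (forall w, modulus (w - z0) < d -> 1 < modulus (g w)) ->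
  modulus (p - z0) < d / 16 -> modulus (q - z0) < d / 16 -> 1 < c ->
  c * ln (modulus (g p)) <= ln (modulus (g q)) ->
  4 < ln (modulus (g q)) -> 36 < ((1 - c^-1) / 2) ^+ 3 * ln (modulus (g q)) ->
  forall v, modulus v = expR ((ln (modulus (g p)) + ln (modulus (g q))) / 2) ->
  exists2 w, modulus (w - z0) < d & g w = v.
Proof.
move=> d0 dg g1 pz qz c1; set X := ln (modulus (g q)); set Y := ln (modulus (g p)).
move=> cYX X4 Xbig v vE; apply: contrapT => nv.
have pd : modulus (p - z0) < d by lra.
have qd : modulus (q - z0) < d by lra.
have Y0 : 0 < Y by apply: ln_gt0; exact: g1.
have c0 : 0 < c by lra.
have YX : Y <= X / c by rewrite ler_pdivlMr// mulrC.
have cV : 0 < c^-1 < 1 by rewrite invr_gt0 c0 invf_lt1.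
have YltX : Y < X by apply: le_lt_trans YX _; rewrite ltr_pdivrMr//; nra.
pose x := (Y + X) / 2.
pose sg t : CC R := p + rc t * (q - p).
have sgz t : 0 <= t <= 1 -> modulus (sg t - z0) < d / 16.
  move=> /andP[t0 t1]; have -> : sg t - z0 = rc (1 - t) * (p - z0) + rc t * (q - z0).
    by rewrite /sg rcD rcN rc1; ring.
  apply: le_lt_trans (modulusD _ _) _; rewrite !modulusM !modulus_rc.
  rewrite !ger0_norm ?subr_ge0//.
  apply: (@le_lt_trans _ _ (Num.max (modulus (p - z0)) (modulus (q - z0)))).
    have : modulus (p - z0) <= Num.max (modulus (p - z0)) (modulus (q - z0)).
      by rewrite le_max lexx.
    have : modulus (q - z0) <= Num.max (modulus (p - z0)) (modulus (q - z0)).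
      by rewrite le_max lexx orbT.
    by nra.
  by rewrite gt_max pz.
(* Centring at a point where |g| already equals |v| makes v / g(a) a unit e^(i th), so that omitting
   v implies that L omits i th. *)
have [a az ga] : exists2 a, modulus (a - z0) < d / 16 & ln (modulus (g a)) = x.
  have [||t] := @IVT R (fun t => ln (modulus (g (sg (clamp t))))) 0 1 x ler01.
  - have csg : curve (fun t => g (sg (clamp t))).
      apply: (@curve_cont R (fun t => sg (clamp t)) g).
        apply: curveD (@curve_cst _ _) _; apply: curveM _ (@curve_cst _ _).
        apply: (@curve_reparam R (@rc R) id (@curve_rc R)) => s t.
        by have := normr_ge0 (s - t); lra.
      by move=> t; apply/cdiff_cont/dg; apply: lt_trans (sgz _ (clamp01 t)) _; lra.
    apply: continuous_subspaceT => t; move: csg; rewrite unlock => csg.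
    apply: (@continuous_comp _ _ _ (fun t => modulus (g (sg (clamp t)))) (@ln R)).
      exact: (@continuous_comp _ _ _ (fun t => g (sg (clamp t))) (@modulus R) t (csg t) (@modulus_cont R _)).
    apply: continuous_ln; apply: lt_trans ltr01 (g1 _ _).
    by apply: lt_trans (sgz _ (clamp01 t)) _; lra.
  - have I0 : 0 <= (0 : R) <= 1 by rewrite lexx ler01.
    have I1 : 0 <= (1 : R) <= 1 by rewrite lexx ler01.
    rewrite (clampE I0) (clampE I1) /sg rc0 rc1 mul0r mul1r addr0 (addrC p) subrK.
    rewrite -/X -/Y min_l ?max_r ?(ltW YltX)// /x; lra.
  rewrite in_itv /= => t01 gt; exists (sg (clamp t)) => //; exact: sgz (clamp01 t).
pose r := d / 2; have r0 : 0 < r by rewrite divr_gt0.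
have inb w : cball a r w -> modulus (w - z0) < d.
  by rewrite /cball /mkset /r => h; have := modulusBD w z0 a; lra.
have [aK sK] := star_cball a (ltW r0).
have g0 w : cball a r w -> g w != 0.
  by move=> /inb/g1 h; rewrite -modulus_gt0 (lt_trans ltr01 h).
have [L [La LE _ dL]] := star_log (@cball_compact _ a r) aK sK
  (fun w wK => cdiff_cont (dg w (inb w wK))) g0.
have {}dL w : cball a r w -> cdiff L w by apply: dL => u /inb; exact: dg.
pose L1 w := L w + rc x.
have reL w : cball a r w -> cre (L w) = ln (modulus (g w)) - x.
  move=> wK; rewrite -[LHS]expRK -modulus_expC LE//.
  by rewrite modulusM modulusV ln_div ?posrE ?modulus_gt0 ?g0// ga.
have dL1 w : cball a r w -> cdiff L1 w.
  by move=> wK; exact: cdiffD (dL _ wK) (@cdiff_cst _ _ _).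
have L1_gt0 w : cball a r w -> 0 < cre (L1 w).
  by move=> wK; rewrite /L1 creD cre_rc reL// subrK ln_gt0// g1// inb.
have x0 : 0 < x by rewrite /x; lra.
have xX : x < X by rewrite /x; lra.
have Lb b : modulus (b - a) <= d / 4 -> modulus (L b) <= 2 * x.
  move=> bd; have h0 : 0 <= 1 / 2 :> R by rewrite divr_ge0.
  have br : modulus (b - a) <= 1 / 2 * r by rewrite /r; lra.
  have h1 : 1 / 2 < 1 :> R by lra.
  have [_] := harnack_half_plane r0 dL1 L1_gt0 h0 br h1.
  have -> : L1 b - L1 a = L b by rewrite /L1 La; ring.
  by rewrite /L1 La creD cre_rc cre0; lra.
have ga0 : g a != 0 by exact: g0.
have [th th4 thE] : exists2 th : R, `|th| <= 4 & v / g a = expC (ii * rc th).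
  apply: unit_angle; rewrite modulusM modulusV vE -/x -ga lnK ?posrE ?modulus_gt0//.
  by rewrite divff// modulus_eq0.
pose N w := L w - ii * rc th.
have d4 : 0 < d / 4 by rewrite divr_gt0.
have d4r w : cball a (d / 4) w -> cball a r w.
  by rewrite /cball /mkset /r; lra.
have N0 w : cball a (d / 4) w -> N w != 0.
  move=> /d4r wK; rewrite /N subr_eq0; apply/eqP => LN; apply: nv; exists w; first exact: inb.
  by have := LE _ wK; rewrite LN -thE => /(mulIf (invr_neq0 ga0)).
have Nth : modulus (ii * rc th) <= 4 by rewrite modulusM modulus_ii mul1r modulus_rc.
have NC w : cball a (d / 4) w -> modulus (N w) < 3 * X.
  move=> wK; have := modulusD (L w) (- (ii * rc th)); rewrite modulusN.
  by have := Lb _ wK; rewrite -/(N w); lra.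
have dN w : cball a (d / 4) w -> cdiff N w.
  by move=> /d4r wK; exact: cdiffB (dL _ wK) (@cdiff_cst _ _ _).
have qa : modulus (q - a) <= d / 4 / 2.
  by have := modulusBD q a z0; rewrite (modulusB z0); lra.
(* The constant 36 arises here: |N| < 3 X on the ball and |N(a)| <= 4 give |N(q)|^3 <= 9 X^2 4,
   whereas |N(q)| >= k X with k = (1 - 1 / c) / 2. *)
have := harnack_small d4 dN N0 NC qa.
have Na : modulus (N a) <= 4 by rewrite /N La sub0r modulusN.
have qK : cball a r q by rewrite /cball /mkset /r; lra.
have Nq : (1 - c^-1) / 2 * X <= modulus (N q).
  apply: le_trans (cre_le _); apply: le_trans (ler_norm _).
  have -> : cre (N q) = X - x.
    rewrite /N creD creN reL//; have -> : cre (ii * rc th) = 0 by rewrite !cE; ring.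
    by rewrite subr0.
  by rewrite /x; lra.
set k := (1 - c^-1) / 2 in Xbig Nq *.
have k0 : 0 < k by rewrite divr_gt0// subr_gt0; case/andP: cV.
have Xp : 0 < X by lra.
have : (k * X) ^+ 3 <= modulus (N q) ^+ 3.
  have kX : 0 <= k * X by apply: mulr_ge0; exact: ltW.
  by rewrite lerXn2r ?nnegrE ?modulus_ge0.
move=> h1 h2; have := le_trans h1 h2; apply/negP; rewrite -ltNge.
apply: (@le_lt_trans _ _ ((3 * X) ^+ 2 * 4)); first by rewrite ler_wpM2l// sqr_ge0.
have -> : (3 * X) ^+ 2 * 4 = X ^+ 2 * 36 by ring.
have -> : (k * X) ^+ 3 = X ^+ 2 * (k ^+ 3 * X) by ring.
by rewrite ltr_pM2l// exprn_gt0.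
Qed.

End CircleCovering.

(** * Constancy of R_A on simply connected Fatou components *)

Section SimplyConnectedComponent.
Variables (R : realType) (f : CC R -> CC R).
Hypothesis df : forall z, cdiff f z.
Hypothesis f0 : f 0 = 0.
Hypothesis f_transc : ~ exists p : {poly CC R}, forall z, f z = p.[z].
Implicit Types (p a z w u : CC R) (r s e d t : R) (n k m l N : nat).
Local Notation Mn n := (iter n (maxmod f)).
Local Notation fn n := (iter n f).
Local Notation rho := (escape_threshold f).
Local Notation A := (fast_escaping f).
Local Notation F := (fatou_set f).
Local Notation ii := (ii R).

Lemma connected_ind (U P : set (CC R)) z0 : connected U -> U z0 -> P z0 ->
  (forall w, U w -> P w -> exists2 d : R, 0 < d & forall u, modulus (u - w) < d -> U u -> P u) ->
  (forall w, U w -> ~ P w -> exists2 d : R, 0 < d & forall u, modulus (u - w) < d -> U u -> ~ P u) ->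
  U `<=` P.
Proof.
move=> cU Uz Pz oP oNP.
(* An open set of the plane whose trace on U is Q when Q is relatively open in U. *)
pose thick (Q : set (CC R)) := [set z : CC R | exists w d, [/\ U w, 0 < d, modulus (z - w) < d &
  forall u, modulus (u - w) < d -> U u -> Q u]].
have o_thick Q : open (thick Q).
  rewrite openE => z [w [d [Uw d0 zw H]]]; apply/nbhsCP.
  exists (d - modulus (z - w)); first by rewrite subr_gt0.
  by move=> u uz; exists w, d; split=> //; have := modulusBD u w z; lra.
have tsub Q : U `&` thick Q `<=` Q by move=> z [Uz' [w [d [_ _ zw H]]]]; exact: H.
have : U `&` P = U.
  apply: cU; first by exists z0.
  - exists (thick P) => //; apply/seteqP; split=> z [Uz' Hz]; split=> //; last exact: tsub.
    have [d d0 Hd] := oP _ Uz' Hz; exists z, d; split=> //.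
    by rewrite subrr modulus0.
  - exists (~` thick (~` P)); first by rewrite closedC; exact: o_thick.
    apply/seteqP; split=> z [Uz' Hz]; split=> //.
      by move=> tz; apply: (tsub (~` P) z (conj Uz' tz)).
    apply: contrapT => nPz; apply: Hz.
    have [d d0 Hd] := oNP _ Uz' nPz; exists z, d; split=> //.
    by rewrite subrr modulus0.
by move=> <- z [].
Qed.

Lemma fatou_ball z : F z -> exists2 d : R, 0 < d & forall w, modulus (w - z) < d -> F w.
Proof. by move=> Fz; have := open_nbhs_nbhs (conj (@fatou_open R f) Fz) => /nbhsCP. Qed.

Lemma component_absorb x w (B : set (CC R)) : connected_component F x w ->
  connected B -> B w -> B `<=` F -> B `<=` connected_component F x.
Proof.
move=> xw cB Bw BF y By; apply: connected_component_trans xw _.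
exact: (connected_component_max Bw BF cB).
Qed.

Lemma curve_image_connected (gam : R -> CC R) (x y : R) : curve gam ->
  connected (gam @` `[x, y]).
Proof.
rewrite unlock => cg; apply: connected_continuous_connected.
  exact: segment_connected.
exact: (continuous_subspaceT cg).
Qed.

Lemma component_ball x w d : connected_component F x w ->
  (forall u, modulus (u - w) < d -> F u) ->
  forall u, modulus (u - w) < d -> connected_component F x u.
Proof.
move=> xw BF u uw.
have csg : curve (fun t => w + rc t * (u - w)).
  apply: curveD (@curve_cst _ _) _; apply: curveM _ (@curve_cst _ _); exact: curve_rc.
apply: (component_absorb xw (curve_image_connected (x := 0) (y := 1) csg)).
- by exists 0; rewrite ?rc0 ?mul0r ?addr0//= in_itv /= lexx ler01.
- move=> _ [t /= t01 <-]; apply: BF; move: t01; rewrite in_itv /= => /andP[t0 t1].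
  rewrite addrAC subrr add0r modulusM modulus_rc ger0_norm//.
  by apply: le_lt_trans uw; rewrite ler_piMl ?modulus_ge0.
- by exists 1; rewrite ?rc1 ?mul1r ?(addrC w) ?subrK//= in_itv /= lexx ler01.
Qed.

Lemma component_open x w : connected_component F x w ->
  exists2 d : R, 0 < d & forall u, modulus (u - w) < d -> connected_component F x u.
Proof.
move=> xw; have [d d0 Hd] := fatou_ball (connected_component_sub xw).
by exists d => //; exact: component_ball.
Qed.

Lemma component_closed x w : F w ->
  (forall d, 0 < d -> exists2 u, connected_component F x u & modulus (u - w) < d) ->
  connected_component F x w.
Proof.
move=> Fw H; have [d d0 Hd] := fatou_ball Fw.
have d2 : 0 < d / 2 by rewrite divr_gt0.
have [u xu uw] := H _ d2.
apply: (component_ball (d := d / 2) xu); last by rewrite modulusB.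
by move=> y yu; apply: Hd; have := modulusBD y w u; lra.
Qed.

Lemma fast_escaping_component x w : connected_component F x w -> A w ->
  connected_component F x `<=` A.
Proof.
move=> xw Aw; apply: (connected_ind _ xw Aw); first exact: component_connected.
- move=> u xu Au; have [d d0 Hd] := fast_escaping_open_fatou df f0 f_transc
    (connected_component_sub xu) Au.
  by exists d => // y /Hd.
- move=> u xu nAu; apply: contrapT => H; apply: nAu.
  apply: (fast_escaping_closed_fatou df f0 f_transc (connected_component_sub xu)).
  move=> d d0; apply: contrapT => H2; apply: H; exists d => // y yu _ Ay.
  by apply: H2; exists y.
Qed.

Lemma iter0 n : fn n 0 = 0.
Proof. by elim: n => //= n ->. Qed.

(** f^n is not constant: it vanishes at 0 but not at the point u of A(f). *)
Lemma iter_open u n r : A u -> 0 < r -> exists2 e : R, 0 < e & forall v,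
  modulus (v - fn n u) < e -> exists2 w, modulus (w - u) <= r & fn n w = v.
Proof.
move=> Au r0; apply: open_mapping => // [z|H]; first exact: cdiff_iter.
have := not_fast_escaping_iter0 df f0 f_transc n Au.
by rewrite -(H 0) iter0 eqxx.
Qed.

(** By the open mapping theorem the image of the ball under f^n is a neighbourhood of f^n(u), and on
    it |f^k| >= M^(k+n)(r) tends to infinity uniformly. *)
Lemma image_fatou z0 d r u n : rho < r -> (forall w, modulus (w - z0) < d -> r <= RA f w) ->
  modulus (u - z0) < d -> F (fn n u).
Proof.
move=> rr H uz.
have Au : A u.
  by apply/(fast_escaping_RA df f0 f_transc); apply: lt_le_trans rr _; exact: H.
have d2 : 0 < (d - modulus (u - z0)) / 2 by rewrite divr_gt0// subr_gt0.
have [e e0 He] := iter_open n Au d2.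
apply: (@escape_fatou _ f _ e) => // B.
have [N HN] := iter_maxmod_unbounded df f0 f_transc B rr.
exists N.+1 => k v Nk /He[w wu <-].
have wz : modulus (w - z0) < d by have := modulusBD w z0 u; lra.
rewrite -iterD; have /(RA_geP df f0 f_transc w rr) := H w wz.
move=> /(_ (k + n)%N); have k1 : (0 < k)%N by exact: leq_ltn_trans Nk.
move=> /(_ (leq_trans k1 (leq_addr _ _))); apply: le_trans; apply: HN.
by apply: leq_trans (ltnW Nk) (leq_addr _ _).
Qed.

(** Radii r1 < r2 strictly between R_A(p) and R_A(q) give |f^n(p)| < M^n(r1) and |f^n(q)| >= M^n(r2)
    for late n. By [iter_ratio] the logarithms then differ by a factor c > 1 independent of n, as
    [circle_covered] requires. *)
Lemma large_circle z0 d p q (S : R) : 0 < d ->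
  (forall N, exists2 n, (N <= n)%N &
     forall w, modulus (w - z0) < d -> 3 <= modulus (fn n w)) ->
  modulus (p - z0) < d / 16 -> modulus (q - z0) < d / 16 ->
  RA f p < RA f q -> exists n (s : R), S < s /\ forall v, modulus v = s ->
    exists2 w, modulus (w - z0) < d & fn n w = v.
Proof.
move=> d_gt0 ball_large pz qz pq.
have pd : modulus (p - z0) < d by lra.
have qd : modulus (q - z0) < d by lra.
have rp := RA_ge_threshold df f0 f_transc p.
pose r1 := RA f p + (RA f q - RA f p) / 3; pose r2 := RA f p + (RA f q - RA f p) * 2 / 3.
have pr1 : RA f p < r1 by rewrite /r1; lra.
have r12 : r1 < r2 by rewrite /r1 /r2; lra.
have r2q : r2 <= RA f q by rewrite /r2; lra.
have rr1 : rho < r1 by lra.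
have rr2 : rho < r2 by lra.
have [n0 Hp] : exists n0, forall n, (n0 <= n)%N -> modulus (fn n p) < Mn n r1.
  have : ~ dominates f r1 p by move=> /(RA_geP df f0 f_transc p rr1); rewrite leNgt pr1.
  move=> /existsNP[n /not_implyP[_ /negP]]; rewrite -ltNge => h.
  exists n => m nm; rewrite -(subnK nm); apply: (orbit_lt df f0 f_transc _ h).
  exact: gt_threshold_ge0 rr1.
have Dq : dominates f r2 q by exact/(RA_geP df f0 f_transc q rr2).
have [|N [c [c1 Hc]]] := @iter_ratio R f df f0 f_transc r1 r2; first by rewrite rr1.
have cV : c^-1 < 1 by rewrite invf_lt1//; lra.
pose k : R := ((1 - c^-1) / 2) ^+ 3.
have k0 : 0 < k by rewrite exprn_gt0// divr_gt0// subr_gt0.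
pose S' := Num.max S 1.
have S'0 : 0 < S' by rewrite lt_max ltr01 orbT.
have q37 : 0 < 37 / k by rewrite divr_gt0.
have lS := normr_ge0 (ln S').
(* The first two bounds meet the hypotheses of [circle_covered]; the third makes the radius exp((Y +
   X) / 2) > exp(X / 2) exceed S. *)
have [X0 [X04 X0k X0S]] : exists X0 : R, [/\ 4 < X0, 37 / k < X0 & 2 * `|ln S'| < X0].
  by exists (5 + 37 / k + 2 * `|ln S'|); split; lra.
have [N2 HN2] := iter_maxmod_unbounded df f0 f_transc (expR X0) rr2.
have [n nN Hn] := ball_large (n0 + N + N2).+1.
have n_n0 : (n0 <= n)%N by apply: leq_trans nN; rewrite -addnA leqW// leq_addr.
have n_N : (N <= n)%N by apply: leq_trans nN; rewrite -addnA addnCA leqW// leq_addr.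
have n_N2 : (N2 <= n)%N by apply: leq_trans nN; rewrite leqW// leq_addl.
have n1 : (1 <= n)%N by exact: leq_ltn_trans nN.
have big w : modulus (w - z0) < d -> 1 < modulus (fn n w).
  by move=> /Hn; apply: lt_le_trans; rewrite ltr1n.
have [ln1 ln2] := Hc n n_N.
have Mr2 : 0 < Mn n r2 by apply: lt_le_trans (expR_gt0 X0) _; exact: HN2.
have fq0 : 0 < modulus (fn n q) by exact: lt_trans (big _ qd).
have fp0 : 0 < modulus (fn n p) by exact: lt_trans (big _ pd).
set X := ln (modulus (fn n q)); set Y := ln (modulus (fn n p)).
have X0X : X0 <= X.
  rewrite -[X0]expRK ler_ln ?posrE ?expR_gt0//; apply: le_trans (HN2 _ n_N2) _; exact: Dq.
have XM : ln (Mn n r2) <= X by rewrite ler_ln ?posrE// Dq.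
have YM : Y <= ln (Mn n r1).
  rewrite ler_ln ?posrE//; first exact/ltW/Hp.
  exact: lt_trans fp0 (Hp _ n_n0).
have c0 : 0 < c by lra.
have cYX : c * Y <= X.
  by apply: le_trans XM; apply: le_trans ln2; rewrite ler_pM2l.
have Y0 : 0 < Y by apply: ln_gt0; exact: big.
exists n, (expR ((Y + X) / 2)); split.
  apply: (@le_lt_trans _ _ S'); first by rewrite le_max lexx.
  rewrite -[S']lnK ?posrE// ltr_expR.
  by have := ler_norm (ln S'); lra.
apply: (@circle_covered R (fn n) z0 d p q c) => //.
- by move=> w _; exact: cdiff_iter.
- exact: lt_le_trans X04 X0X.
- rewrite -/X -/k -ltr_pdivrMl// mulrC; apply: lt_le_trans X0X.
  by apply: lt_trans X0k; rewrite ltr_pM2r ?invr_gt0// ltr_nat.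
Qed.

Lemma rotation_small (z : CC R) (e1 : R) : 0 < e1 -> exists2 e0 : R, 0 < e0 &
  forall e, 0 < e < e0 -> modulus (z * expC (ii * rc e) - z) < e1.
Proof.
move=> e10.
have cr : curve (fun e => z * expC (ii * rc e)).
  apply: curveM (@curve_cst _ _) _.
  apply: (@curve_cont R (fun e => ii * rc e) (@expC R)).
    exact: curveM (@curve_cst _ _) (@curve_rc _).
  move=> t; have [phi [cphi _] phiE] := expC_slope (ii * rc t).
  by apply: cdiff_cont; exists phi.
move/curveP: cr => /(_ 0 e1 e10)[d d0 Hd].
exists d => // e /andP[e0 ed]; have := Hd e; rewrite subr0 gtr0_norm// => /(_ ed).
by rewrite rc0 mulr0 expC0 mulr1.
Qed.

Lemma RA_locally_constant x z0 : simply_connected (connected_component F x) ->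
  connected_component F x z0 -> A z0 ->
  exists2 d : R, 0 < d & forall w, modulus (w - z0) < d -> RA f w = RA f z0.
Proof.
set U := connected_component F x => scU Uz0 Az0.
have Fz0 : F z0 by exact: connected_component_sub Uz0.
have UA : U `<=` A by exact: fast_escaping_component Uz0 Az0.
have rz0 : rho < RA f z0 by apply/(fast_escaping_RA df f0 f_transc).
have [|d1 d10 H1] := @RA_lsc R f df f0 f_transc z0 ((rho + RA f z0) / 2) Fz0.
  by apply/andP; split; lra.
have r3r : rho < (rho + RA f z0) / 2 by lra.
set r3 := (rho + RA f z0) / 2 in H1 r3r.
have [|d2 d20 H2] := near_escape df f0 f_transc Fz0.
  by move=> d d0; exists z0; rewrite ?subrr ?modulus0.
have [d3 d30 H3] := component_open Uz0.
pose d := Num.min d1 (Num.min d2 d3).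
have d0 : 0 < d by rewrite !lt_min d10 d20 d30.
have dd w : modulus (w - z0) < d -> [/\ modulus (w - z0) < d1, modulus (w - z0) < d2 &
    modulus (w - z0) < d3] by rewrite !lt_min => /andP[? /andP[? ?]].
have ball_RA w : modulus (w - z0) < d -> r3 <= RA f w by move=> /dd[/H1].
have ball_U w : modulus (w - z0) < d -> U w by move=> /dd[_ _ /H3].
have ball_large N : exists2 n, (N <= n)%N & forall w, modulus (w - z0) < d -> 3 <= modulus (fn n w).
  by have [n nN Hn] := H2 N; exists n => // w /dd[_ /Hn].
exists (d / 16) => [|w wz]; first by rewrite divr_gt0.
apply/eqP/negPn/negP => neq.
have [p [q [pz qz pq]]] : exists p q, [/\ modulus (p - z0) < d / 16,
    modulus (q - z0) < d / 16 & RA f p < RA f q].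
  have zz : modulus (z0 - z0) < d / 16 by rewrite subrr modulus0 divr_gt0.
  by move: neq; rewrite neq_lt => /orP[h|h]; [exists w, z0 | exists z0, w].
have circles S : exists n (s : R), S < s /\ forall v, modulus v = s ->
    exists2 w, modulus (w - z0) < d & fn n w = v.
  exact: (large_circle S d0 ball_large pz qz pq).
have circleF n (s : R) : (forall v, modulus v = s ->
    exists2 w, modulus (w - z0) < d & fn n w = v) -> forall v, modulus v = s -> F v.
  by move=> H v /H[u uz <-]; exact: (image_fatou n r3r ball_RA uz).
have openU z : U z -> exists2 d : R, 0 < d & forall w, modulus (w - z) < d -> U w.
  exact: component_open.
(* By openness f^n takes the slightly rotated value near p'. As |f^n| is unchanged there, the new
   point stays in the level set. *)
have rot n K p' e1 : K p' -> A p' -> 0 < e1 ->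
    (forall u, modulus (u - p') < e1 -> modulus (fn n u) = modulus (fn n p') -> K u) ->
    exists2 e0 : R, 0 < e0 & forall e, 0 < e < e0 ->
     exists q, [/\ K q, modulus (q - p') < e1 & fn n q = fn n p' * expC (ii * rc e)].
  move=> Kp Ap e10 HK; have e12 : 0 < e1 / 2 by rewrite divr_gt0.
  have [e2 e20 He2] := iter_open n Ap e12.
  have [e0 e00 He0] := rotation_small (fn n p') e20.
  exists e0 => // e /He0/He2[u up fu]; have up' : modulus (u - p') < e1 by lra.
  by exists u; split=> //; apply: HK => //; rewrite fu modulusM modulus_expC_ii mulr1.
(* The radius s is taken beyond |z0|: if no point of U has modulus s, connectedness confines U to
   the disc. *)
have Ubound : exists S : R, forall z, U z -> modulus z < S.
  have [n [s [zs cs]]] := circles (modulus z0); exists s.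
  suff H : forall z, U z -> modulus z != s.
    apply: (connected_ind _ Uz0); [exact: component_connected | exact: zs | | ].
      move=> u Uu /= us; exists (s - modulus u); first by rewrite subr_gt0.
      by move=> y yu _; have := modulus_dist y u; rewrite ler_norml; lra.
    move=> u Uu /= us; have us' : s < modulus u.
      by rewrite lt_neqAle eq_sym H//= leNgt; apply/negP.
    exists (modulus u - s); first by rewrite subr_gt0.
    move=> y yu _; apply/negP; rewrite -leNgt.
    by have := modulus_dist y u; rewrite ler_norml; lra.
  move=> z Uz; apply/negP => /eqP zs'.
  have sp : 0 < s by exact: le_lt_trans (modulus_ge0 _) zs.
  pose K := [set v : CC R | modulus v = s].
  have KU : K `<=` U.
    pose gam (t : R) := rc s * expC (ii * rc t).
    have cgam : curve gam.
      apply: curveM (@curve_cst _ _) _.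
      apply: (@curve_cont R (fun e => ii * rc e) (@expC R)).
        exact: curveM (@curve_cst _ _) (@curve_rc _).
      move=> t; have [phi [cphi _] phiE] := expC_slope (ii * rc t).
      by apply: cdiff_cont; exists phi.
    have KE v : K v -> (gam @` `[-4, 4]) v.
      move=> Kv; have s0 : rc s != 0 by rewrite -modulus_gt0 modulus_rc gtr0_norm.
      have [|t t4 tE] := @unit_angle R (v / rc s).
        by rewrite modulusM modulusV Kv modulus_rc gtr0_norm// divff// gt_eqF.
      exists t; first by rewrite /= in_itv /= -ler_norml.
      by rewrite /gam -tE mulrC divfK.
    apply: (subset_trans KE).
    apply: (component_absorb Uz (curve_image_connected cgam) (KE _ zs')).
    move=> _ [t _ <-]; apply: (circleF n s cs).
    by rewrite modulusM modulus_expC_ii mulr1 modulus_rc gtr0_norm.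
  (* The case n = 0: the circle K lies in U, where z would have a continuous logarithm. *)
  apply: (@no_rotation R U id scU openU _ _ K).
  - by move=> y _; exact: cont_id.
  - by move=> y /UA Ay; apply: (not_fast_escaping_iter0 df f0 f_transc 0%N Ay).
  - apply: (@compact_of_closed_bounded R K s); last by move=> y ->.
    exact: (closed_level (x := s) (@modulus_cont R)).
  - by exists z.
  - exact: KU.
  - move=> p' e1 Kp e10; apply: (rot 0%N) => //; first exact/UA/KU.
    by move=> u _ h; exact: etrans h Kp.
have [S HS] := Ubound.
have [n [s [s_gt0 cs]]] := circles 0.
pose K := [set z : CC R | U z /\ modulus (fn n z) = s].
have [u uz us] : exists2 u, modulus (u - z0) < d & modulus (fn n u) = s.
  have [|u uz fu] := cs (rc s); first by rewrite modulus_rc gtr0_norm.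
  by exists u => //; rewrite fu modulus_rc gtr0_norm.
apply: (@no_rotation R U (fn n) scU openU _ _ K).
- by move=> y _; exact/cdiff_cont/cdiff_iter.
- by move=> y /UA Ay; exact: (not_fast_escaping_iter0 df f0 f_transc n Ay).
- apply: (@compact_of_closed_bounded R K S); last by move=> y [/HS/ltW].
  rewrite -[K]setCK closedC openE => z nKz; apply/nbhsCP.
  apply: contrapT => H; apply: nKz.
  have clK e : 0 < e -> exists2 u, K u & modulus (u - z) < e.
    move=> e0; apply: contrapT => nH; apply: H; exists e => // y yz Ky.
    by apply: nH; exists y.
  have fz : modulus (fn n z) = s.
    apply/eqP/negPn/negP => ns.
    have e0 : 0 < `|modulus (fn n z) - s| by rewrite normr_gt0 subr_eq0.
    have /contP/(_ _ e0)[e e_gt0 He] := cdiff_cont (cdiff_iter df n z).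
    have [y [_ ys] yz] := clK _ e_gt0.
    have := He _ yz; rewrite ltNge => /negP; apply.
    by rewrite -ys distrC; exact: modulus_dist.
  split=> //; apply: component_closed.
    exact: (fatou_preimage_iter df (circleF n s cs _ fz)).
  by move=> e /clK[y [Uy _] yz]; exists y.
- by exists u; split=> //; exact: ball_U.
- by move=> y [].
- move=> p' e1 [Up fp] e10; have [e2 e20 He2] := openU _ Up.
  have e3 : 0 < Num.min e1 e2 by rewrite lt_min e10.
  have [|e0 e00 He0] := rot n K p' _ (conj Up fp) (UA _ Up) e3.
    by move=> y; rewrite lt_min => /andP[_ /He2 Uy] fy; split=> //; rewrite fy.
  exists e0 => // e /He0[y [Ky yp fy]]; exists y; split=> //.
  by move: yp; rewrite lt_min => /andP[].
Qed.

Lemma RA_constant U : fatou_component f U -> simply_connected U ->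
  exists c, forall z, U z -> RA f z = c.
Proof.
move=> [x Fx ->] scU; set U' := connected_component F x in scU *.
have [[z0 [Uz0 Az0]]|nA] := pselect (exists z0, U' z0 /\ A z0); last first.
  by exists rho => z Uz; apply: RA_not_fast => Az; apply: nA; exists z.
have UA : U' `<=` A by exact: fast_escaping_component Uz0 Az0.
exists (RA f z0); apply: (connected_ind _ Uz0); first exact: component_connected.
- by [].
- move=> w Uw wE; have [d d0 Hd] := RA_locally_constant scU Uw (UA _ Uw).
  by exists d => // u /Hd -> _.
- move=> w Uw wE; have [d d0 Hd] := RA_locally_constant scU Uw (UA _ Uw).
  by exists d => // u /Hd uE _; rewrite uE.
Qed.

End SimplyConnectedComponent.

Theorem theorem6p2 (R : realType) (f : CC R -> CC R)
    (hf : transcendental_entire f) (hf0 : f 0 = 0) :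
  [/\ upper_semicontinuous (RA f),
      forall z, (fast_escaping f `&` julia_set f) z -> ~ {for z, continuous (RA f)},
      forall U, fatou_component f U -> simply_connected U ->
        exists c, forall z, U z -> RA f z = c &
      forall z, (~` fast_escaping f `|` fatou_set f) z ->
        {for z, continuous (RA f)}].
Proof.
case: hf => ef f_transc; have df z : cdiff f z := derivable_cdiff (ef z).
split.
- exact: RA_usc.
- by move=> z; exact: RA_not_continuous.
- by move=> U; exact: RA_constant.
- by move=> z; exact: RA_continuous.
Qed.
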